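(* For $d=3$, the Cauchy problem $$\partial_tu-\Delta u=\sqrt{-\Delta}\,(u^2)\ \text{ in }\mathbb{R}^3\times(0,\infty),\qquad u(\cdot,0)=u_0,$$ with the scale-invariant initial data $u_0(x)=\frac2\pi\frac1{|x|}$ has at least two solutions: the time-decaying solution $u_1(x,t)=\left(\frac2\pi\right)^{3/2}\mathscr{F}^{-1}\{|\xi|^{-2}\,\mathbb{P}_\xi(\zeta>t)\}$ and the time-independent solution $u_2(x,t)=u_0(x)$. Here $\zeta$ is the explosion time of the stochastic cascade associated with the scale-invariant kernel $h(\xi)=\pi^{-3}|\xi|^{-2}$.
   Context: Fourier transform: $\mathscr{F}\{u\}(\xi)=c_0\int_{\mathbb{R}^3}u(x)e^{-ix\cdot\xi}dx$, $c_0=(2\pi)^{-3/2}$. A solution of the Cauchy problem is understood through the Fourier-transformed integral equation for $v=\mathscr{F}\{u\}$, $v_0=\mathscr{F}\{u_0\}$: $$v(\xi,t)=e^{-t|\xi|^2}v_0(\xi)+c_0\int_0^te^{-s|\xi|^2}|\xi|\int_{\mathbb{R}^3}v(\eta,t-s)v(\xi-\eta,t-s)\,d\eta\,ds .$$ Cascade: $h(\xi)=\pi^{-3}|\xi|^{-2}$ on $\mathbb{R}^3\setminus\{0\}$ satisfies $(h*h)(\xi)=|\xi|h(\xi)$, and $H(\eta|\xi)=\frac{h(\eta)h(\xi-\eta)}{|\xi|h(\xi)}$ is a probability density in $\eta$. $\mathbb{T}=\{0\}\cup\bigcup_{n\ge1}\{1,2\}^n$ is the binary tree with root $0$; $|v|$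 is the generation of $v$ ($|0|=0$), $v|j$ is the truncation of $v$ to generation $j$ ($v|0=0$), and $v1,v2$ are the children of $v$ (the children of the root being $1,2$). For each $\xi\ne0$, on a probability space with measure $\mathbb{P}_\xi$ there are families $\{W_v\}_{v\in\mathbb{T}}$, $\{T_v\}_{v\in\mathbb{T}}$ such that: (i) $W_0=\xi$; (ii) given $W_v$, $T_v$ is exponentially distributed with mean $|W_v|^{-2}$, $W_{v1}$ is independent of $T_v$ with density $H(\cdot|W_v)$, and $W_{v2}=W_v-W_{v1}$; (iii) given $W_{v1}$ and $W_{v2}$, the sub-families (of $W$'s and $T$'s) indexed by the subtrees rooted at $v1$ and $v2$ are independent of each other (and are cascades started at $W_{v1}$, $W_{v2}$). The explosion time is $\zeta=\zeta_\xi=\sup_{n\ge0}\min_{|v|=n}\sum_{j=0}^nT_{v|j}$.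
   Formalization: In (iii) the formal cascade also requires that, given W_{v1} and W_{v2}, the clock T_v is independent of the two sub-families rooted at v1 and v2; without this the law of ζ is not determined and u_1 need not be a solution. *)

(* Defs.v *)
From HB Require Import structures.
From mathcomp Require Import all_boot all_order all_algebra.
From mathcomp Require Import all_classical all_reals all_analysis.
From mathcomp Require Import complex.
Set Implicit Arguments.
Unset Strict Implicit.
Unset Printing Implicit Defensive.
Import Order.TTheory GRing.Theory Num.Theory.
Import numFieldNormedType.Exports.
Local Open Scope classical_set_scope.
Local Open Scope ring_scope.
Local Open Scope complex_scope.

Notation R3 R := (R * R * R)%type.

(* The norm that the library puts on a product is the sup norm, hence the
   separate Euclidean norm. *)
Definition dot3 (R : realType) (x y : R3 R) : R :=
  x.1.1 * y.1.1 + x.1.2 * y.1.2 + x.2 * y.2.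

Definition norm3 (R : realType) (x : R3 R) : R := Num.sqrt (dot3 x x).

(* [measurableTypeR R] is R with its Borel sets, as in [lebesgue_measure]. *)
Definition leb2 (R : realType) :
    {measure set (measurableTypeR R * measurableTypeR R)%type -> \bar R} :=
  (@lebesgue_measure R \x @lebesgue_measure R)%E.

Definition leb3 (R : realType) :
    {measure set (R3 (measurableTypeR R)) -> \bar R} :=
  (leb2 R \x @lebesgue_measure R)%E.

Definition cintegrable d (T : measurableType d) (R : realType)
    (mu : {measure set T -> \bar R}) (D : set T) (f : T -> R[i]) : Prop :=
  mu.-integrable D (EFin \o (@complex.Re R) \o f) /\
  mu.-integrable D (EFin \o (@complex.Im R) \o f).

Definition cintegral d (T : measurableType d) (R : realType)
    (mu : {measure set T -> \bar R}) (D : set T) (f : T -> R[i]) : R[i] :=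
  Rintegral mu D (fun x => complex.Re (f x)) +i*
  Rintegral mu D (fun x => complex.Im (f x)).

Definition expNi (R : realType) (a : R) : R[i] := cos a -i* sin a.

Definition c0 (R : realType) : R := (2 * pi) `^ (- (3 / 2)).

Definition fourier_integral (R : realType) (f : R3 R -> R[i]) (xi : R3 R) : R[i] :=
  (c0 R)%:C * cintegral (leb3 R) setT (fun x => f x * expNi (dot3 x xi)).

Definition unit3 (R : realType) (j : 'I_3) : R3 R :=
  ((j == 0)%:R, (j == 1)%:R, (j == 2)%:R).

(* [partials [:: j1; ...; jk] f] is the iterated partial derivative
   D_j1 ( ... (D_jk f)). *)
Definition partials (R : realType) (s : seq 'I_3) (f : R3 R -> R) : R3 R -> R :=
  foldr (fun j (g : R3 R -> R) x => 'D_(unit3 R j) g x) f s.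

Definition schwartz (R : realType) (f : R3 R -> R) : Prop :=
  forall s : seq 'I_3,
    [/\ continuous (partials s f),
        forall j x, derivable (partials s f) x (unit3 R j) &
        forall k : nat, exists C : R,
          forall x, norm3 x ^+ k * `|partials s f x| <= C].

(* [is_fourier u v] is v = F{u} for tempered functions, by duality with
   Schwartz functions: neither |x|^-1 nor |xi|^-2 is integrable on R^3, so
   the absolutely convergent integral does not cover them. Real-valued test
   functions suffice, by linearity. *)
Definition is_fourier (R : realType) (u v : R3 R -> R[i]) : Prop :=
  forall phi : R3 R -> R, schwartz phi ->
    let phiC := fun x => (phi x)%:C in
    [/\ cintegrable (leb3 R) setT (fun x => u x * fourier_integral phiC x),
        cintegrable (leb3 R) setT (fun xi => v xi * phiC xi) &
        cintegral (leb3 R) setT (fun x => u x * fourier_integral phiC x) =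
        cintegral (leb3 R) setT (fun xi => v xi * phiC xi)].

Definition self_conv (R : realType) (v : R3 R -> R[i]) (xi : R3 R) : R[i] :=
  cintegral (leb3 R) setT (fun eta => v eta * v (xi - eta)).

(* The integral equation satisfied by v = F{u} and v0 = F{u0}; the
   integrability clauses state that its integrals are meaningful. *)
Definition fourier_equation (R : realType)
    (v0 : R3 R -> R[i]) (v : R3 R -> R -> R[i]) : Prop :=
  forall (xi : R3 R) (t : R), xi != 0 -> 0 <= t ->
    let g := fun s => (expR (- (s * norm3 xi ^+ 2)) * norm3 xi)%:C *
                      self_conv (v ^~ (t - s)) xi in
    [/\ forall s, 0 < s < t ->
          cintegrable (leb3 R) setT (fun eta => v eta (t - s) * v (xi - eta) (t - s)),
        cintegrable (@lebesgue_measure R) `[0, t] g &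
        v xi t = (expR (- (t * norm3 xi ^+ 2)))%:C * v0 xi +
                 (c0 R)%:C * cintegral (@lebesgue_measure R) `[0, t] g].

(* u solves  u_t - Laplacian u = sqrt(-Laplacian)(u^2),  u(., 0) = u0. *)
Definition is_solution (R : realType)
    (u0 : R3 R -> R[i]) (u : R3 R -> R -> R[i]) : Prop :=
  exists (v0 : R3 R -> R[i]) (v : R3 R -> R -> R[i]),
    [/\ is_fourier u0 v0,
        forall t, 0 <= t -> is_fourier (u ^~ t) (v ^~ t) &
        fourier_equation v0 v].

Definition h3 (R : realType) (xi : R3 R) : R := (pi ^+ 3)^-1 * (norm3 xi ^+ 2)^-1.

Definition H3 (R : realType) (eta xi : R3 R) : R :=
  h3 eta * h3 (xi - eta) / (norm3 xi * h3 xi).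

(* The binary tree: a vertex is the word read from the root, [false] and
   [true] standing for the letters 1 and 2; the root is [::], the
   generation of v is [size v] and the truncation v|j is [take j v]. *)
Notation vertex := (seq bool).
Notation child1 v := (rcons v false).
Notation child2 v := (rcons v true).

Section cascade.
Context {R : realType}.

(* Sample paths (W_v, T_v)_v, with the product sigma-algebra. *)
Definition path_space : Type := vertex -> R3 R * R.

Definition path_cylinders : set (set path_space) :=
  [set C | exists (v : vertex) (B : set (R3 R * R)),
     measurable B /\ C = [set p | B (p v)]].

Definition path_measurable : set (set path_space) := <<s path_cylinders >>.

(* The sub-family indexed by the subtree rooted at v, as a sample path. *)
Definition subtree (Omega : Type) (W : vertex -> Omega -> R3 R)
    (T : vertex -> Omega -> R) (v : vertex) (omega : Omega) : path_space :=
  fun w => (W (v ++ w) omega, T (v ++ w) omega).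

Definition is_cascade_family (d : R3 R -> measure_display)
    (Omega : forall xi, measurableType (d xi))
    (P : forall xi, probability (Omega xi) R)
    (W : forall xi, vertex -> Omega xi -> R3 R)
    (T : forall xi, vertex -> Omega xi -> R) : Prop :=
  (* law of the cascade started at eta, as a sample path *)
  let Q eta (C : set path_space) :=
    P eta [set omega | C (subtree (W eta) (T eta) [::] omega)] in
  forall xi, xi != 0 ->
  [/\ forall v, measurable_fun setT (W xi v) /\ measurable_fun setT (T xi v),
      {ae P xi, forall omega, W xi [::] omega = xi},
      (* given W_v, T_v is exponential with mean |W_v|^-2, and W_v1 is
         independent of T_v with density H(. | W_v) *)
      forall v,
        (forall (A : set (R3 R)) (B : set R) (C : set (R3 R)),
          measurable A -> measurable B -> measurable C ->
          P xi [set omega | [/\ A (W xi v omega), B (T xi v omega) &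
                                C (W xi (child1 v) omega)]] =
          (\int[P xi]_(omega in [set omega | A (W xi v omega)])
             (exponential_prob (norm3 (W xi v omega) ^+ 2) B *
              \int[leb3 R]_(eta in C) (H3 eta (W xi v omega))%:E))%E) /\
        {ae P xi, forall omega,
           W xi (child2 v) omega = W xi v omega - W xi (child1 v) omega} &
      (* given W_v1 and W_v2 (hence also W_v), T_v and the sub-families
         of the subtrees rooted at v1 and v2 are independent, the latter two
         being cascades started at W_v1 and W_v2 *)
      forall v (A : set R) (B1 B2 : set (R3 R)) (C1 C2 : set path_space),
        measurable A -> measurable B1 -> measurable B2 ->
        path_measurable C1 -> path_measurable C2 ->
        let E := [set omega | [/\ A (T xi v omega),
                                  B1 (W xi (child1 v) omega) &
                                  B2 (W xi (child2 v) omega)]] in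
        P xi (E `&` [set omega | C1 (subtree (W xi) (T xi) (child1 v) omega) /\
                                 C2 (subtree (W xi) (T xi) (child2 v) omega)]) =
        (\int[P xi]_(omega in E) (Q (W xi (child1 v) omega) C1 *
                                  Q (W xi (child2 v) omega) C2))%E].

Definition explosion_time (Omega : Type) (T : vertex -> Omega -> R)
    (omega : Omega) : \bar R :=
  ereal_sup (range (fun n : nat =>
    (\big[mine/+oo]_(v : n.-tuple bool)
       (\sum_(j < n.+1) T (take j v) omega)%:E)%E)).

End cascade.
Arguments path_space : clear implicits.

(* (2/pi)^(3/2) |xi|^-2 P_xi(zeta > t) *)
Definition cascade_profile (R : realType) (d : R3 R -> measure_display)
    (Omega : forall xi, measurableType (d xi))
    (P : forall xi, probability (Omega xi) R)
    (T : forall xi, vertex -> Omega xi -> R) (xi : R3 R) (t : R) : R[i] :=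
  ((2 / pi) `^ (3 / 2) * (norm3 xi ^+ 2)^-1 *
   fine (P xi [set omega | (t%:E < explosion_time (T xi) omega)%E]))%:C.

Definition u_init (R : realType) (x : R3 R) : R[i] := (2 / pi * (norm3 x)^-1)%:C.

(* Main.v *)
Require Import Defs.
From HB Require Import structures.
From mathcomp Require Import all_boot all_order all_algebra.
From mathcomp Require Import all_classical all_reals all_analysis.
From mathcomp Require Import measurable_realfun complex.
From mathcomp Require Import ring lra.
Import Order.TTheory GRing.Theory Num.Theory.
Import numFieldNormedType.Exports.
Local Open Scope classical_set_scope.
Local Open Scope ring_scope.
Local Open Scope complex_scope.
Set Implicit Arguments.
Unset Strict Implicit.
Unset Printing Implicit Defensive.

(*@P1*)
Lemma sigma_finite_product d1 d2 (T1 : measurableType d1)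
    (T2 : measurableType d2) (R : realType)
    (m1 : {sigma_finite_measure set T1 -> \bar R})
    (m2 : {sigma_finite_measure set T2 -> \bar R}) :
  sigma_finite setT (m1 \x m2)%E.
Proof.
have [F [FT ndF finF]] := (sigma_finiteP _ _).1 (sigma_finiteT m1).
have [G [GT ndG finG]] := (sigma_finiteP _ _).1 (sigma_finiteT m2).
exists (fun n => F n `*` G n).
  apply/seteqP; split=> // -[x y] _.
  have [n _ Fnx] : (\bigcup_i F i) x by rewrite -FT.
  have [k _ Gky] : (\bigcup_i G i) y by rewrite -GT.
  exists (maxn n k) => //; split => /=.
  - by move/subsetPset : (ndF _ _ (leq_maxl n k)); exact.
  - by move/subsetPset : (ndG _ _ (leq_maxr n k)); exact.
move=> n; have [mF Foo] := finF n; have [mG Goo] := finG n.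
split; first exact: measurableX.
by rewrite product_measure1E// lte_mul_pinfty// ge0_fin_numE.
Qed.

Definition lebesgue2 (R : realType) :
    set (measurableTypeR R * measurableTypeR R)%type -> \bar R :=
  (@lebesgue_measure R \x @lebesgue_measure R)%E.

Arguments lebesgue2 R : clear implicits.
HB.instance Definition _ (R : realType) := Measure.on (lebesgue2 R).
HB.instance Definition _ (R : realType) := @Measure_isSigmaFinite.Build _ _ _ (lebesgue2 R)
  (sigma_finite_product _ _).

(** [leb3] as a sigma-finite measure, which is what Fubini asks for. *)
Definition lebesgue3 (R : realType) : set (R3 (measurableTypeR R)) -> \bar R :=
  (lebesgue2 R \x @lebesgue_measure R)%E.

Arguments lebesgue3 R : clear implicits.
HB.instance Definition _ (R : realType) := Measure.on (lebesgue3 R).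
HB.instance Definition _ (R : realType) := @Measure_isSigmaFinite.Build _ _ _ (lebesgue3 R)
  (sigma_finite_product (lebesgue2 R) (@lebesgue_measure R)).

Section whole_line.
Context {R : realType}.
Notation mu := (@lebesgue_measure R).

Lemma lebesgue3E : lebesgue3 R = leb3 R :> (set _ -> _).
Proof. by []. Qed.

Lemma tonelli3 (f : R3 (measurableTypeR R) -> \bar R) :
  measurable_fun setT f -> (forall x, 0 <= f x)%E ->
  (\int[lebesgue3 R]_x f x =
   \int[mu]_x1 \int[mu]_x2 \int[mu]_x3 f (x1, x2, x3))%E.
Proof.
move=> mf f0.
rewrite fubini_tonelli1 //.
rewrite (fubini_tonelli1 (fubini_F (@lebesgue_measure R) f)) //.
  exact: measurable_fun_fubini_tonelli_F.
by move=> x; exact: integral_ge0.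
Qed.

Lemma cvg_itv_integral (f : R -> R) : mu.-integrable setT (EFin \o f) ->
  \int[mu]_(x in `[- n%:R, n%:R]) f x @[n --> \oo] --> \int[mu]_x f x.
Proof.
move=> intf.
have mf := measurable_int _ intf.
pose F n := (EFin \o f) \_ `[- n%:R, n%:R].
have mF n : measurable_fun setT (F n).
  by apply/(measurable_restrict _ _ _) => //; exact: measurable_funTS.
have Ff : {ae mu, forall x, setT x -> F ^~ x @ \oo --> (f x)%:E}.
  apply/aeW => x _; apply: cvg_near_cst.
  exists (Num.truncn `|x|).+1 => // n /= xn.
  rewrite /F patchE mem_set//= in_itv/= -ler_norml.
  by rewrite ltW// (lt_le_trans (truncnS_gt _))// ler_nat.
have F_le : {ae mu, forall x n, setT x -> (`|F n x| <= `|(f x)%:E|)%E}.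
  by apply/aeW => x n _; rewrite /F patchE; case: ifP => //; rewrite abse0.
have [_ _] := @dominated_convergence _ _ _ mu _ measurableT _ _ _ mF mf Ff
  (integrable_abse intf) F_le.
rewrite -[X in _ --> X]fineK ?integrable_fin_num// => /fine_cvg.
apply: cvg_trans; apply: near_eq_cvg; near=> n.
by rewrite /= /Rintegral /F -integral_mkcond.
Unshelve. all: end_near. Qed.

(** Integration by parts on the whole line, with vanishing boundary terms. *)
Lemma integral_derive_eq0 (F f : R -> R) :
  (forall x : R, is_derive x 1 F (f x)) -> continuous f ->
  mu.-integrable setT (EFin \o f) ->
  F n%:R @[n --> \oo] --> (0 : R) -> F (- n%:R) @[n --> \oo] --> (0 : R) ->
  \int[mu]_x f x = 0.
Proof.
move=> dF cf intf F0 F0'.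
have cF : continuous F.
  by move=> x; apply: differentiable_continuous; apply/derivable1_diffP.
rewrite -(cvg_lim _ (cvg_itv_integral intf)); last exact: norm_hausdorff.
apply/cvg_lim; first exact: norm_hausdorff.
rewrite -(subr0 0).
apply: cvg_trans (cvgB F0 F0').
apply: near_eq_cvg; near=> n.
rewrite /Rintegral (@continuous_FTC2 _ f F)//=.
- by apply: gtrN; rewrite ltr0n; near: n; exists 1%N.
- exact: continuous_subspaceT.
- split => [x _||]; first by [].
  + by apply: cvg_at_right_filter; exact: cF.
  + by apply: cvg_at_left_filter; exact: cF.
- by move=> x _; rewrite derive1E derive_val.
Unshelve. all: end_near. Qed.


Lemma integral_gaussian (s m : R) : 0 < s ->
  (\int[mu]_x (expR (- s * (x - m) ^+ 2))%:E = (Num.sqrt (pi / s))%:E)%E.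
Proof.
move=> s0.
pose sigma := Num.sqrt ((2 * s)^-1).
have sigma2 : sigma ^+ 2 *+ 2 = s^-1.
  rewrite sqr_sqrtr ?invr_ge0 ?mulr_ge0 ?ltW// -mulr_natr.
  by field; rewrite gt_eqF.
have sigma0 : sigma != 0 by rewrite gt_eqF// sqrtr_gt0 invr_gt0 mulr_gt0.
have pk : normal_peak sigma = (Num.sqrt (pi / s))^-1.
  by rewrite /normal_peak -mulrnAl sigma2 mulrC.
have pis0 : Num.sqrt (pi / s) != 0 by rewrite gt_eqF// sqrtr_gt0 divr_gt0// pi_gt0.
have -> : (fun x => (expR (- s * (x - m) ^+ 2))%:E) =
    (fun x => (Num.sqrt (pi / s))%:E * (normal_pdf m sigma x)%:E)%E.
  apply/funext => x; rewrite normal_pdfE// -EFinM /= pk mulVKf//.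
  by rewrite /normal_fun sigma2 invrK mulrC mulrN mulNr.
by rewrite integralZl//= ?integral_normal_pdf ?mule1//; exact: integrable_normal_pdf.
Qed.

Lemma integrable_gaussian (s m : R) : 0 < s ->
  mu.-integrable setT (EFin \o (fun x => expR (- s * (x - m) ^+ 2))).
Proof.
move=> s0; apply/integrableP; split.
  apply/measurable_EFinP; apply: measurableT_comp => //.
  by apply: measurable_funM => //; apply: measurable_funX; exact: measurable_funB.
under eq_integral do rewrite /= ger0_norm ?expR_ge0//.
by rewrite integral_gaussian// ltry.
Qed.


Lemma integral_gaussian0 (s : R) : 0 < s ->
  \int[mu]_x expR (- s * x ^+ 2) = Num.sqrt (pi / s).
Proof.
move=> s0; rewrite /Rintegral -[RHS]/(fine (Num.sqrt (pi / s))%:E).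
by rewrite -(integral_gaussian 0 s0); under [in RHS]eq_integral do rewrite subr0.
Qed.

Lemma integrable_gaussian0 (s : R) : 0 < s ->
  mu.-integrable setT (EFin \o (fun x => expR (- s * x ^+ 2))).
Proof.
move=> s0; have := integrable_gaussian 0 s0.
by under eq_fun do rewrite subr0.
Qed.

Lemma mulr_expR_gaussian_le (s x : R) : 0 < s ->
  `|x| * expR (- s * x ^+ 2) <= (1 + 2 / s) * expR (- (s / 2) * x ^+ 2).
Proof.
move=> s0.
have -> : - s * x ^+ 2 = - (s / 2) * x ^+ 2 - s / 2 * x ^+ 2 by field.
rewrite expRD mulrCA mulrC ler_pM2r ?expR_gt0//.
rewrite expRN ler_pdivrMr ?expR_gt0//.
apply: (@le_trans _ _ ((1 + 2 / s) * (1 + s / 2 * x ^+ 2))); last first.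
  by rewrite ler_pM2l ?expR_ge1Dx// addr_gt0// divr_gt0.
have -> : (1 + 2 / s) * (1 + s / 2 * x ^+ 2) =
    1 + 2 / s + s / 2 * x ^+ 2 + x ^+ 2 by field; rewrite gt_eqF.
have h1 : 0 <= 2 / s by rewrite divr_ge0// ltW.
have h2 : 0 <= s / 2 * x ^+ 2 by rewrite mulr_ge0 ?sqr_ge0// divr_ge0// ltW.
by have : `|x| <= 1 + x ^+ 2; [rewrite ler_norml; apply/andP; split; nra|lra].
Qed.

Lemma cvg_expR_sqr (s : R) : 0 < s -> expR (- s * n%:R ^+ 2) @[n --> \oo] --> 0.
Proof.
move=> s0; apply: (@squeeze_cvgr _ _ _ _ (cst 0) (fun n => expR (- (s * n%:R)))).
- apply/nearW => n; rewrite expR_ge0/= ler_expR mulNr lerN2 ler_pM2l//.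
  by rewrite -natrX ler_nat; case: n => // n; rewrite leq_pmulr.
- exact: cvg_cst.
- apply: (@cvg_comp _ _ _ _ (fun x => expR (- (s * x))) _ _ _ (@cvgr_idn R)).
  apply: (@cvg_comp _ _ _ _ (fun x => expR (- x)) _ _ _ _ (@cvgr_expR R)).
  by apply: gt0_cvgMry => //; exact: cvg_id.
Qed.

Section gaussian_characteristic.
Variables (s b : R).
Hypothesis s0 : 0 < s.
Let g (a x : R) := expR (- s * x ^+ 2) * cos (a * x + b).
Let g' (a x : R) := - (x * expR (- s * x ^+ 2) * sin (a * x + b)).

Let dg (a x : R) : is_derive a (1 : R) (g^~ x) (g' a x).
Proof. by rewrite /g /g' /=; apply: is_derive_eq; rewrite /GRing.scale/=; ring. Qed.

Let cg a : continuous (g a).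
Proof.
move=> x; apply: differentiable_continuous; apply/derivable1_diffP.
by rewrite /g; apply: ex_derive.
Qed.

Let cg' a : continuous (g' a).
Proof.
move=> x; apply: differentiable_continuous; apply/derivable1_diffP.
by rewrite /g'; apply: ex_derive.
Qed.

Let intg a : mu.-integrable setT (EFin \o g a).
Proof.
apply: le_integrable (integrable_gaussian0 s0) => //.
  by apply/measurable_EFinP; apply: continuous_measurable_fun; exact: cg.
move=> x _ /=; rewrite lee_fin /g normrM.
by rewrite ler_piMr// cos_max.
Qed.

Let s20 : 0 < s / 2. Proof. by rewrite divr_gt0. Qed.

Let bound (x : R) := (1 + 2 / s) * expR (- (s / 2) * x ^+ 2).

Let int_bound : mu.-integrable setT (EFin \o bound).
Proof.
have := integrableZl measurableT (1 + 2 / s) (integrable_gaussian0 s20).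
by apply: eq_integrable.
Qed.

Let g'_le a x : `|g' a x| <= bound x.
Proof.
rewrite /g' normrN !normrM (ger0_norm (expR_ge0 _)).
by apply: le_trans (mulr_expR_gaussian_le x s0); rewrite ler_piMr ?mulr_ge0 ?expR_ge0// sin_max.
Qed.

Let intg' a : mu.-integrable setT (EFin \o g' a).
Proof.
apply: le_integrable int_bound => //.
  by apply/measurable_EFinP; apply: continuous_measurable_fun; exact: cg'.
by move=> x _ /=; rewrite lee_fin (le_trans (g'_le a x))// ler_norm.
Qed.

Let J a := \int[mu]_x g a x.

(* whole-line integration by parts applied to exp(-s x^2) sin(a x + b) *)
Let Jparts a : \int[mu]_x g' a x = - (a / (2 * s)) * J a.
Proof.
pose F x := expR (- s * x ^+ 2) * sin (a * x + b).
have squeeze0 (u : nat -> R) : (forall n, `|u n| = n%:R) -> F (u n) @[n --> \oo] --> (0 : R).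
  move=> uE; apply: norm_cvg0.
  apply: (squeeze_cvgr _ (cvg_cst 0) (cvg_expR_sqr s0)); apply: nearW => n.
  rewrite normr_ge0/= /F normrM -(real_normK (num_real (u n))) uE.
  by rewrite ger0_norm ?expR_ge0// ler_piMr ?expR_ge0// sin_max.
have : \int[mu]_x (2 * s * g' a x + a * g a x) = 0.
  apply: (@integral_derive_eq0 F).
  - by move=> x; rewrite /F /g /g'; apply: is_derive_eq; rewrite /GRing.scale/=; ring.
  - by move=> x; apply: cvgD; apply: cvgM; [exact: cvg_cst|exact: cg'|exact: cvg_cst|exact: cg].
  - have := integrableD measurableT (integrableZl measurableT (2 * s) (intg' a))
      (integrableZl measurableT a (intg a)).
    by apply: eq_integrable.
  - by apply: squeeze0 => n; rewrite normr_nat.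
  - by apply: squeeze0 => n; rewrite normrN normr_nat.
rewrite RintegralD//.
- rewrite !RintegralZl//.
  move/eqP; rewrite addr_eq0 => /eqP h; apply: (@mulfI _ (2 * s)).
    by rewrite mulf_neq0// gt_eqF.
  by rewrite h /J; field; rewrite gt_eqF.
- by have := integrableZl measurableT (2 * s) (intg' a); apply: eq_integrable.
- by have := integrableZl measurableT a (intg a); apply: eq_integrable.
Qed.

Let dJ (a : R) : is_derive a (1 : R) J (- (a / (2 * s)) * J a).
Proof.
have Ia : `]a - 1, a + 1[%classic a by rewrite /= in_itv/= ltrBlDr ltrDl ltr01 andbb.
have dg1 x y : `]a - 1, a + 1[%classic x -> setT y -> derivable (g^~ y) x 1.
  by move=> _ _; have [] := dg x y.
have partialE x y : partial1of2 g x y = g' x y.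
  by rewrite partial1of2E; have dgx := dg x y; rewrite derive_val.
have bound_ge0 x : 0 <= bound x.
  by rewrite mulr_ge0 ?expR_ge0// addr_ge0// divr_ge0// ltW.
have le x y : `]a - 1, a + 1[%classic x -> setT y -> `|partial1of2 g x y| <= bound y.
  by move=> _ _; rewrite partialE.
have ig x : `]a - 1, a + 1[%classic x -> mu.-integrable setT (EFin \o g x) by [].
apply: DeriveDef.
  exact: (@derivable_under_integral _ _ _ mu g setT measurableT a (a-1) (a+1) Ia ig dg1 bound bound_ge0 int_bound le).
rewrite -derive1E (@differentiation_under_integral _ _ _ mu g setT measurableT a (a-1) (a+1) Ia ig dg1 bound bound_ge0 int_bound le).
by rewrite -Jparts; apply: eq_Rintegral => x _; exact: partialE.
Qed.

(** Both sides solve J' = - a / (2 s) J in [a] and agree at [a = 0]. *)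
Lemma gaussian_characteristic a :
  \int[mu]_x (expR (- s * x ^+ 2) * cos (a * x + b)) =
  Num.sqrt (pi / s) * expR (- (a ^+ 2 / (4 * s))) * cos b.
Proof.
pose K (x : R) := J x * expR (x ^+ 2 / (4 * s)).
have dK x : is_derive x (1 : R) K 0.
  have dJx := dJ x; rewrite /K; apply: is_derive_eq; rewrite /GRing.scale/=.
  by field; rewrite gt_eqF.
have := is_derive_0_is_cst a 0 dK.
rewrite /K expr0n/= mul0r expR0 mulr1 => KE.
have -> : Num.sqrt (pi / s) * expR (- (a ^+ 2 / (4 * s))) * cos b =
    J 0 * expR (- (a ^+ 2 / (4 * s))).
  rewrite mulrAC; congr (_ * _).
  rewrite -(integral_gaussian0 s0) /J /g.
  under [in RHS]eq_Rintegral do rewrite mul0r add0r.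
  by rewrite RintegralZr//; exact: integrable_gaussian0.
by rewrite -KE -mulrA -expRD subrr expR0 mulr1.
Qed.
End gaussian_characteristic.

End whole_line.

(*@P2*)
Section space.
Context {R : realType}.
Notation mu := (@lebesgue_measure R).


Lemma dot3_ge0 (x : R3 R) : 0 <= dot3 x x.
Proof. by rewrite /dot3 !addr_ge0 // -expr2 sqr_ge0. Qed.

Lemma norm3_sqr (x : R3 R) : norm3 x ^+ 2 = x.1.1 ^+ 2 + x.1.2 ^+ 2 + x.2 ^+ 2.
Proof. by rewrite sqr_sqrtr ?dot3_ge0// /dot3 !expr2. Qed.

Lemma norm3_ge0 (x : R3 R) : 0 <= norm3 x. Proof. exact: sqrtr_ge0. Qed.

Lemma norm3_eq0 (x : R3 R) : (norm3 x == 0) = (x == 0).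
Proof.
apply/idP/eqP => [|->]; last by rewrite /norm3 /dot3 /= !mulr0 !addr0 sqrtr0.
rewrite -(sqrf_eq0 (norm3 x)) norm3_sqr.
rewrite !paddr_eq0 ?addr_ge0 ?sqr_ge0// !sqrf_eq0.
by case: x => -[x1 x2] x3 /= => /andP[/andP[/eqP-> /eqP->] /eqP->].
Qed.

Lemma norm3_gt0 (x : R3 R) : x != 0 -> 0 < norm3 x.
Proof. by move=> x0; rewrite lt_neqAle norm3_ge0 andbT eq_sym norm3_eq0. Qed.

Lemma norm3_0 : norm3 (0 : R3 R) = 0. Proof. by apply/eqP; rewrite norm3_eq0. Qed.

Lemma norm3_sub_sym (x y : R3 R) : norm3 (x - y) = norm3 (y - x).
Proof. by rewrite /norm3 /dot3 /=; congr Num.sqrt; ring. Qed.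

Lemma measurable_fun_R3 d (T : measurableType d) (f : T -> R3 R) :
  measurable_fun setT (fun x => (f x).1.1) -> measurable_fun setT (fun x => (f x).1.2) ->
  measurable_fun setT (fun x => (f x).2) -> measurable_fun setT f.
Proof.
move=> m1 m2 m3.
rewrite (_ : f = fun x => ((f x).1.1, (f x).1.2, (f x).2)); last first.
  by apply/funext => x; case: (f x) => -[].
by apply: measurable_fun_pair => //; exact: measurable_fun_pair.
Qed.

Lemma measurable_coord1 : measurable_fun setT (fun x : R3 R => x.1.1).
Proof. exact: (measurableT_comp measurable_fst measurable_fst). Qed.
Lemma measurable_coord2 : measurable_fun setT (fun x : R3 R => x.1.2).
Proof. exact: (measurableT_comp measurable_snd measurable_fst). Qed.
Lemma measurable_coord3 : measurable_fun setT (fun x : R3 R => x.2).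
Proof. exact: measurable_snd. Qed.
Hint Resolve measurable_coord1 measurable_coord2 measurable_coord3 : core.

Lemma measurable_fun_subR3 d (T : measurableType d) (f g : T -> R3 R) :
  measurable_fun setT f -> measurable_fun setT g ->
  measurable_fun setT (fun x => f x - g x).
Proof.
move=> mf mg; apply: measurable_fun_R3 => /=; apply: measurable_funB.
- exact: (measurableT_comp measurable_coord1 mf).
- exact: (measurableT_comp measurable_coord1 mg).
- exact: (measurableT_comp measurable_coord2 mf).
- exact: (measurableT_comp measurable_coord2 mg).
- exact: (measurableT_comp measurable_coord3 mf).
- exact: (measurableT_comp measurable_coord3 mg).
Qed.

Lemma measurable_fun_dot3 d (T : measurableType d) (f g : T -> R3 R) :
  measurable_fun setT f -> measurable_fun setT g ->
  measurable_fun setT (fun x => dot3 (f x) (g x)).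
Proof.
move=> mf mg; apply: measurable_funD; first apply: measurable_funD.
all: apply: measurable_funM.
- exact: (measurableT_comp measurable_coord1 mf).
- exact: (measurableT_comp measurable_coord1 mg).
- exact: (measurableT_comp measurable_coord2 mf).
- exact: (measurableT_comp measurable_coord2 mg).
- exact: (measurableT_comp measurable_coord3 mf).
- exact: (measurableT_comp measurable_coord3 mg).
Qed.

Lemma measurable_fun_norm3 d (T : measurableType d) (f : T -> R3 R) :
  measurable_fun setT f -> measurable_fun setT (fun x => norm3 (f x)).
Proof.
move=> mf; apply: (measurableT_comp (f := @Num.sqrt R)).
  by apply: continuous_measurable_fun; exact: sqrt_continuous.
exact: measurable_fun_dot3.
Qed.

Lemma measurable_norm3 : measurable_fun setT (@norm3 R).
Proof. exact: measurable_fun_norm3. Qed.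

Lemma measurable_inv : measurable_fun setT (@GRing.inv R).
Proof.
rewrite -(setvU [set 0]); apply/measurable_funU => //; first exact: measurableC.
split; last exact: measurable_fun_set1.
apply: open_continuous_measurable_fun; first by apply: closed_openC; exact: closed_eq.
by move=> x; rewrite inE => /= /eqP x0; exact: inv_continuous.
Qed.

Lemma measurable_fun_inv d (T : measurableType d) (f : T -> R) :
  measurable_fun setT f -> measurable_fun setT (fun x => (f x)^-1).
Proof. exact: measurableT_comp measurable_inv. Qed.

Lemma measurable_fun_h3 d (T : measurableType d) (f : T -> R3 R) :
  measurable_fun setT f -> measurable_fun setT (fun x => h3 (f x)).
Proof.
move=> mf; apply: measurable_funM => //; apply: measurable_fun_inv.
by apply: measurable_funX; exact: measurable_fun_norm3.
Qed.

Lemma measurable_fun_H3 d (T : measurableType d) (f g : T -> R3 R) :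
  measurable_fun setT f -> measurable_fun setT g ->
  measurable_fun setT (fun x => H3 (f x) (g x)).
Proof.
move=> mf mg; apply: measurable_funM.
  apply: measurable_funM; apply: measurable_fun_h3 => //.
  exact: measurable_fun_subR3.
apply: measurable_fun_inv; apply: measurable_funM.
  exact: measurable_fun_norm3.
exact: measurable_fun_h3.
Qed.

Lemma lebesgue3_point (x : R3 R) : lebesgue3 R [set x] = 0%E.
Proof.
case: x => -[x1 x2] x3.
have -> : [set (x1, x2, x3)] = [set (x1, x2)] `*` [set x3] :> set (R3 R).
  by apply/seteqP; split=> [[[a b] c]|[[a b] c]] /=; [case=> -> -> ->|case=> [[-> ->] ->]].
have m12 : measurable ([set (x1, x2)] : set (R * R)).
  have -> : [set (x1, x2)] = [set x1] `*` [set x2] :> set (R * R).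
    by apply/seteqP; split=> [[a b]|[a b]] /= => [[-> ->]//|[-> ->]].
  exact: measurableX.
have x30 : mu [set x3] = 0%E by exact: lebesgue_measure_set1.
apply: (etrans (product_measure1E (lebesgue2 R) mu m12 _)); first exact: measurable_set1.
by apply: (etrans (congr1 (fun z => lebesgue2 R _ * z)%E x30)); rewrite mule0.
Qed.

Lemma expR_norm3_split (s : R) (x : R3 R) :
  expR (- s * norm3 x ^+ 2) =
  expR (- s * x.1.1 ^+ 2) * expR (- s * x.1.2 ^+ 2) * expR (- s * x.2 ^+ 2).
Proof. by rewrite norm3_sqr !mulrDr !expRD. Qed.

Lemma measurable_gaussian3 (s : R) (m : R3 R) :
  measurable_fun setT (fun x : R3 R => expR (- s * norm3 (x - m) ^+ 2)).
Proof.
apply: measurableT_comp => //; apply: measurable_funM => //.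
apply: measurable_funX; apply: measurable_fun_norm3.
exact: measurable_fun_subR3.
Qed.

Lemma integral_product3 (f1 f2 f3 : R -> R) :
  measurable_fun setT f1 -> measurable_fun setT f2 -> measurable_fun setT f3 ->
  (forall x, 0 <= f1 x) -> (forall x, 0 <= f2 x) -> (forall x, 0 <= f3 x) ->
  (\int[lebesgue3 R]_x (f1 x.1.1 * f2 x.1.2 * f3 x.2)%:E =
   \int[mu]_x (f1 x)%:E * (\int[mu]_x (f2 x)%:E * \int[mu]_x (f3 x)%:E))%E.
Proof.
move=> m1 m2 m3 f1_ge0 f2_ge0 f3_ge0; rewrite tonelli3/=; last 2 first.
- apply/measurable_EFinP; apply: measurable_funM; first apply: measurable_funM.
  + exact: (measurableT_comp m1 measurable_coord1).
  + exact: (measurableT_comp m2 measurable_coord2).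
  + exact: (measurableT_comp m3 measurable_coord3).
- by move=> x; rewrite lee_fin !mulr_ge0.
have I_ge0 (f : R -> R) : (forall x, 0 <= f x) -> (0 <= \int[mu]_x (f x)%:E)%E.
  by move=> f0; apply: integral_ge0 => x _; rewrite lee_fin.
under eq_integral => x1 _.
  under eq_integral => x2 _.
    under eq_integral => x3 _ do rewrite EFinM.
    rewrite ge0_integralZl_EFin//; first last.
    - by rewrite mulr_ge0.
    - exact/measurable_EFinP.
    - by move=> x _; rewrite lee_fin.
    rewrite EFinM -muleA.
    over.
  rewrite ge0_integralZl_EFin//; first last.
  - by apply: emeasurable_funM => //; exact/measurable_EFinP.
  - by move=> x _; rewrite mule_ge0 ?I_ge0// lee_fin.
  rewrite ge0_integralZr//; first last.
  - exact: I_ge0.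
  - by move=> x _; rewrite lee_fin.
  - exact/measurable_EFinP.
  over.
rewrite ge0_integralZr//.
- exact/measurable_EFinP.
- by move=> x _; rewrite lee_fin.
- by rewrite mule_ge0 ?I_ge0.
Qed.

Lemma measurable_gaussian (s m : R) :
  measurable_fun setT (fun x : R => expR (- s * (x - m) ^+ 2)).
Proof.
apply: measurableT_comp => //; apply: measurable_funM => //.
by apply: measurable_funX; exact: measurable_funB.
Qed.

Lemma integral_gaussian3 (s : R) (m : R3 R) : 0 < s ->
  (\int[lebesgue3 R]_x (expR (- s * norm3 (x - m) ^+ 2))%:E =
   (Num.sqrt (pi / s) ^+ 3)%:E)%E.
Proof.
move=> s0; under eq_integral do rewrite expR_norm3_split/=.
have := @integral_product3 (fun x => expR (- s * (x - m.1.1) ^+ 2))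
  (fun x => expR (- s * (x - m.1.2) ^+ 2)) (fun x => expR (- s * (x - m.2) ^+ 2)).
move=> -> //; try exact: measurable_gaussian; try by move=> x; exact: expR_ge0.
by rewrite !integral_gaussian// -!EFinM !exprS expr0 mulr1.
Qed.

Lemma integrable_gaussian3 (s : R) (m : R3 R) : 0 < s ->
  (lebesgue3 R).-integrable setT (EFin \o (fun x => expR (- s * norm3 (x - m) ^+ 2))).
Proof.
move=> s0; apply/integrableP; split.
  by apply/measurable_EFinP; exact: measurable_gaussian3.
under eq_integral do rewrite /= ger0_norm ?expR_ge0//.
by rewrite integral_gaussian3// ltry.
Qed.

Lemma integrable_gaussian30 (s : R) : 0 < s ->
  (lebesgue3 R).-integrable setT (EFin \o (fun x => expR (- s * norm3 x ^+ 2))).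
Proof.
move=> s0; have := integrable_gaussian3 0 s0.
by under eq_fun do rewrite subr0.
Qed.

Lemma integrable_dominated d (T : measurableType d) (nu : {measure set T -> \bar R})
    (f g : T -> R) : measurable_fun setT f -> nu.-integrable setT (EFin \o g) ->
  (forall x, `|f x| <= g x) -> nu.-integrable setT (EFin \o f).
Proof.
move=> mf ig fg; apply: le_integrable ig => //; first exact/measurable_EFinP.
by move=> x _ /=; rewrite lee_fin (le_trans (fg x))// ler_norm.
Qed.

Lemma measurable_cos : measurable_fun setT (@cos R).
Proof. by apply: continuous_measurable_fun; exact: continuous_cos. Qed.

Lemma measurable_cos_dot3 (a : R3 R) (b : R) :
  measurable_fun setT (fun x : R3 R => cos (dot3 x a + b)).
Proof.
apply: (measurableT_comp measurable_cos).
by apply: measurable_funD => //; exact: measurable_fun_dot3.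
Qed.

Lemma gaussian_characteristicE (s a b : R) : 0 < s ->
  (\int[mu]_x (expR (- s * x ^+ 2) * cos (a * x + b))%:E =
   (Num.sqrt (pi / s) * expR (- (a ^+ 2 / (4 * s))) * cos b)%:E)%E.
Proof.
move=> s0; rewrite -gaussian_characteristic// fineK//.
apply: integrable_fin_num => //.
apply: (integrable_dominated _ (integrable_gaussian0 s0)).
  apply: measurable_funM.
    by have := measurable_gaussian s 0; under eq_fun do rewrite subr0.
  apply: (measurableT_comp measurable_cos).
  by apply: measurable_funD => //; exact: measurable_funM.
by move=> x; rewrite normrM ger0_norm ?expR_ge0// ler_piMr ?expR_ge0// cos_max.
Qed.

Lemma integral_fubini3 (f : R3 R -> R) : (lebesgue3 R).-integrable setT (EFin \o f) ->
  (\int[lebesgue3 R]_x (f x)%:E =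
   \int[mu]_x1 \int[mu]_x2 \int[mu]_x3 (f (x1, x2, x3))%:E)%E.
Proof.
move=> intf.
rewrite -(integral12_prod_meas1 intf).
have intF : (lebesgue2 R).-integrable setT (fubini_F mu (EFin \o f)).
  exact: integrable_fubini_F.
by rewrite -(integral12_prod_meas1 intF).
Qed.

Lemma gaussian_characteristic3 (s : R) (a : R3 R) (b : R) : 0 < s ->
  \int[lebesgue3 R]_x (expR (- s * norm3 x ^+ 2) * cos (dot3 x a + b)) =
  Num.sqrt (pi / s) ^+ 3 * expR (- (norm3 a ^+ 2 / (4 * s))) * cos b.
Proof.
move=> s0; rewrite /Rintegral integral_fubini3; last first.
  apply: (integrable_dominated _ (integrable_gaussian30 s0)).
    apply: measurable_funM; last exact: measurable_cos_dot3.
    by have := measurable_gaussian3 s 0; under eq_fun do rewrite subr0.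
  by move=> x; rewrite normrM ger0_norm ?expR_ge0// ler_piMr ?expR_ge0// cos_max.
rewrite -[RHS]/(fine (_ %:E)); congr fine.
have ig (c b' : R) : mu.-integrable setT
    (EFin \o (fun x => expR (- s * x ^+ 2) * cos (c * x + b'))).
  apply: (integrable_dominated _ (integrable_gaussian0 s0)).
    apply: measurable_funM.
      by have := measurable_gaussian s 0; under eq_fun do rewrite subr0.
    apply: (measurableT_comp measurable_cos).
    by apply: measurable_funD => //; exact: measurable_funM.
  by move=> x; rewrite normrM ger0_norm ?expR_ge0// ler_piMr ?expR_ge0// cos_max.
pose r := Num.sqrt (pi / s).
pose e (x : R) := expR (- s * x ^+ 2).
pose k (x : R) := r * expR (- (x ^+ 2 / (4 * s))).
have step (c C b' : R) :
    (\int[mu]_x (C * (e x * cos (c * x + b')))%:E = (C * (k c * cos b'))%:E)%E.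
  under eq_integral do rewrite EFinM.
  rewrite integralZl//; last exact: ig.
  by apply: (etrans (congr1 (fun z => C%:E * z)%E (gaussian_characteristicE c b' s0))).
transitivity (\int[mu]_x1 \int[mu]_x2
    (e x1 * k a.2 * (e x2 * cos (a.1.2 * x2 + (a.1.1 * x1 + b))))%:E)%E.
  apply: eq_integral => x1 _; apply: eq_integral => x2 _.
  transitivity (\int[mu]_x3
      (e x1 * e x2 * (e x3 * cos (a.2 * x3 + (a.1.1 * x1 + a.1.2 * x2 + b))))%:E)%E.
    apply: eq_integral => x3 _; rewrite expR_norm3_split /dot3/= -mulrA.
    by congr (_ * (_ * cos _))%:E; ring.
  rewrite step; congr EFin; rewrite /e.
  have -> : a.1.1 * x1 + a.1.2 * x2 + b = a.1.2 * x2 + (a.1.1 * x1 + b) by ring.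
  by ring.
transitivity (\int[mu]_x1
    (k a.2 * k a.1.2 * (e x1 * cos (a.1.1 * x1 + b)))%:E)%E.
  apply: eq_integral => x1 _; rewrite step; congr EFin; ring.
rewrite step norm3_sqr /k; congr EFin.
have -> : - ((a.1.1 ^+ 2 + a.1.2 ^+ 2 + a.2 ^+ 2) / (4 * s)) =
  - (a.1.1 ^+ 2 / (4 * s)) - (a.1.2 ^+ 2 / (4 * s)) - (a.2 ^+ 2 / (4 * s)) by ring.
by rewrite !expRD -/r; ring.
Qed.

End space.

(*@P3*)
Section schwartz.
Context {R : realType}.
Notation mu := (@lebesgue_measure R).
Local Hint Resolve measurable_coord1 measurable_coord2 measurable_coord3 : core.

Lemma integral_oneDsqrV : (\int[mu]_x ((oneDsqr x)^-1)%:E = pi%:E)%E.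
Proof.
rewrite (@ge0_symfun_integralT _ (fun x : R => (oneDsqr x)^-1)).
- by rewrite -set_itvcy integral0y_oneDsqr -EFinM mulrC divfK.
- by move=> x; rewrite invr_ge0 (le_trans ler01)// oneDsqr_ge1.
- exact: continuous_oneDsqrV.
- by move=> x /=; rewrite /oneDsqr sqrrN.
Qed.

Let oneDsqr_gt0 (x : R) : 0 < oneDsqr x.
Proof. exact: lt_le_trans ltr01 (oneDsqr_ge1 _). Qed.

Lemma measurable_oneDsqrV : measurable_fun setT (fun x : R => (oneDsqr x)^-1).
Proof. by apply: continuous_measurable_fun; exact: continuous_oneDsqrV. Qed.

Lemma integrable_oneDsqrV : mu.-integrable setT (EFin \o (fun x => (oneDsqr x)^-1)).
Proof.
apply/integrableP; split; first by apply/measurable_EFinP; exact: measurable_oneDsqrV.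
under eq_integral do rewrite /= ger0_norm ?invr_ge0 ?ltW//.
by rewrite integral_oneDsqrV ltry.
Qed.

(** A positive integrable function dominating the functions of decay
    |x|^-6. *)
Definition cauchy3 (x : R3 R) : R :=
  (oneDsqr x.1.1)^-1 * (oneDsqr x.1.2)^-1 * (oneDsqr x.2)^-1.

Lemma integrable_cauchy3 : (lebesgue3 R).-integrable setT (EFin \o cauchy3).
Proof.
apply/integrableP; split.
  apply/measurable_EFinP; apply: measurable_funM; first apply: measurable_funM.
  - exact: (measurableT_comp measurable_oneDsqrV measurable_coord1).
  - exact: (measurableT_comp measurable_oneDsqrV measurable_coord2).
  - exact: (measurableT_comp measurable_oneDsqrV measurable_coord3).
under eq_integral do rewrite /= ger0_norm ?mulr_ge0 ?invr_ge0 ?ltW//.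
rewrite (@integral_product3 _ (fun x => (oneDsqr x)^-1) (fun x => (oneDsqr x)^-1)
  (fun x => (oneDsqr x)^-1)) ?integral_oneDsqrV -?EFinM ?ltry//.
all: by [exact: measurable_oneDsqrV | move=> x; rewrite invr_ge0 ltW].
Qed.

Lemma cauchy3_ge (x : R3 R) : ((1 + norm3 x ^+ 2) ^+ 3)^-1 <= cauchy3 x.
Proof.
rewrite /cauchy3 -!invfM lef_pV2 ?posrE ?mulr_gt0// ?exprn_gt0// ?ltr_pwDl ?sqr_ge0//.
rewrite norm3_sqr /oneDsqr.
have := sqr_ge0 x.1.1; have := sqr_ge0 x.1.2; have := sqr_ge0 x.2.
move: (x.1.1 ^+ 2) (x.1.2 ^+ 2) (x.2 ^+ 2) => a b c c0 b0 a0.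
have la : 1 + a <= 1 + (a + b + c) by lra.
have lb : 1 + b <= 1 + (a + b + c) by lra.
have lc : 1 + c <= 1 + (a + b + c) by lra.
rewrite exprS expr2 mulrA; apply: ler_pM => //; try lra.
  by rewrite mulr_ge0//; lra.
by apply: ler_pM => //; lra.
Qed.

Definition rapid (f : R3 R -> R) :=
  exists C : R, forall x, `|f x| <= C * ((1 + norm3 x ^+ 2) ^+ 3)^-1.

Lemma rapid_integrable (f : R3 R -> R) : measurable_fun setT f -> rapid f ->
  (lebesgue3 R).-integrable setT (EFin \o f).
Proof.
move=> mf [C Cf].
have ig : (lebesgue3 R).-integrable setT (EFin \o (fun x => `|C| * cauchy3 x)).
  exact: (integrableZl measurableT `|C| integrable_cauchy3).
apply: (integrable_dominated _ ig) => // x /=.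
apply: le_trans (Cf x) _; apply: le_trans (ler_wpM2l _ (cauchy3_ge x)) => //.
apply: ler_wpM2r; last exact: ler_norm.
by rewrite invr_ge0 exprn_ge0// addr_ge0// sqr_ge0.
Qed.

Lemma measurable_fun_countable d (T : measurableType d) (C : countType)
    (h : T -> C) (g : C -> R) :
  (forall c, measurable (h @^-1` [set c])) -> measurable_fun setT (g \o h).
Proof.
move=> mh _ Y mY; rewrite setTI.
rewrite (_ : _ @^-1` Y = \bigcup_(c in g @^-1` Y) (h @^-1` [set c])); last first.
  by apply/seteqP; split=> [t Yt|t [c Yc hc]]; [exists (h t)|rewrite /= hc].
rewrite bigcup_mkcond; apply: countable_bigcupT_measurable => [|c].
  exact: countableP.
by case: ifP.
Qed.

(* the dyadic-like grid point below y at scale 1/(n+1) *)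
Let grid (n : nat) (k : int) : R := k%:~R / n.+1%:R.
Let index (n : nat) (y : R) : int := Num.floor (y * n.+1%:R).

Let gridK (y : R) : grid n (index n y) @[n --> \oo] --> y.
Proof.
apply/cvgrPdist_le => e e0.
near=> n.
have n0 : 0 < n.+1%:R :> R by [].
rewrite /grid /index; have /andP[] := floor_itv (y * n.+1%:R).
move: (Num.floor _) => k; rewrite intrD1 => ky yk.
have en : 1 <= e * n.+1%:R.
  rewrite mulrC -ler_pdivrMr// div1r.
  near: n; exists (Num.truncn e^-1) => // n /= nn; apply: ltW.
  by rewrite (lt_le_trans (truncnS_gt _))// ler_nat.
rewrite -[X in `|X - _|](mulfK (lt0r_neq0 n0)) -mulrBl normrM (ger0_norm (_ : 0 <= _^-1)) ?invr_ge0//.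
rewrite ler_pdivrMr// ger0_norm ?subr_ge0//; lra.
Unshelve. all: end_near. Qed.

Let measurable_index n (k : int) : measurable (index n @^-1` [set k]).
Proof.
have -> : index n @^-1` [set k] = (fun y : R => y * n.+1%:R) @^-1` `[k%:~R, (k + 1)%:~R[.
  apply/seteqP; split=> y; rewrite /= in_itv/= /index.
    by move=> <-; exact: floor_itv.
  by move=> /floor_def.
rewrite -[X in measurable X]setTI.
have : measurable_fun setT (fun y : R => y * n.+1%:R) by exact: measurable_funM.
by apply.
Qed.

Lemma continuous_measurable_R3 (f : R3 R -> R) : continuous f -> measurable_fun setT f.
Proof.
move=> cf.
pose idx n (x : R3 R) := (index n x.1.1, index n x.1.2, index n x.2).
pose pt n (k : int * int * int) : R3 R := (grid n k.1.1, grid n k.1.2, grid n k.2).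
have H (x : R3 R) : (fun n => pt n (idx n x)) @ \oo --> x.
  have pairing (U V : topologicalType) (u : nat -> U) (v : nat -> V) (a : U) (b : V) :
      u @ \oo --> a -> v @ \oo --> b -> (fun n => (u n, v n)) @ \oo --> (a, b).
    move=> ua vb A [[P Q] /= [aP bQ] PQA].
    have H1 : \forall n \near \oo, P (u n) := ua P aP.
    have H2 : \forall n \near \oo, Q (v n) := vb Q bQ.
    by apply: filterS2 H1 H2 => n Pn Qn; exact: PQA.
  move: x => [[x1 x2] x3].
  by apply: (pairing _ _ (fun n => (grid n (index n x1), grid n (index n x2))));
    [exact: (pairing _ _ _ _ _ _ (@gridK x1) (@gridK x2))|exact: gridK].
apply: (@measurable_fun_cvg _ _ _ _ (fun n x => f (pt n (idx n x)))) => [n|x _].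
  apply: (@measurable_fun_countable _ _ _ (idx n) (f \o pt n)) => -[[i j] k].
  rewrite (_ : _ @^-1` _ = (fun x : R3 R => x.1.1) @^-1` (index n @^-1` [set i]) `&`
     (fun x : R3 R => x.1.2) @^-1` (index n @^-1` [set j]) `&`
     (fun x : R3 R => x.2) @^-1` (index n @^-1` [set k])); last first.
    by apply/seteqP; split=> [x [<- <- <-]//|x [[h1 h2] h3]]; rewrite /= /idx h1 h2 h3.
  have mpre (c : R3 R -> R) m : measurable_fun setT c ->
      measurable (c @^-1` (index n @^-1` [set m])).
    by move=> mc; rewrite -[X in measurable X]setTI; apply: mc.
  by apply: measurableI; [apply: measurableI|]; apply: mpre.
exact: (@cvg_comp _ _ _ (fun n => pt n (idx n x)) f _ _ _ (H x) (cf x)).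
Qed.

End schwartz.

(*@P4*)
Section parts.
Context {R : realType}.
Notation mu := (@lebesgue_measure R).
Local Notation e := (unit3 R).

Lemma lineE (t : R) (a x : R3 R) :
  t *: a + x = (t * a.1.1 + x.1.1, t * a.1.2 + x.1.2, t * a.2 + x.2).
Proof. by []. Qed.

Lemma integral_line_eq0 (j : 'I_3) (g : R3 R -> R) :
  (lebesgue3 R).-integrable setT (EFin \o g) ->
  (forall x : R3 R, dot3 x (e j) = 0 ->
    (\int[mu]_t (g (t *: e j + x))%:E = 0)%E) ->
  (\int[lebesgue3 R]_x (g x)%:E = 0)%E.
Proof.
move=> ig; case: j => [[|[|[|//]]]] lj g0.
- rewrite -(integral21_prod_meas1 ig).
  transitivity (\int[mu]_(x in setT) cst 0 x)%E; last by rewrite integral0.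
  apply: ae_eq_integral => //.
    exact: (measurable_fubini_G ig).
  have := ae_integrable2 ig; apply: filterS => x3 ig3 _.
  rewrite /fubini_G -(integral21_prod_meas1 ig3).
  transitivity (\int[mu]_(x in setT) cst 0 x)%E; last by rewrite integral0.
  apply: eq_integral => x2 _; rewrite /fubini_G -[RHS](g0 (0, x2, x3)).
    by apply: eq_integral => x1 _; rewrite lineE /unit3/= ?mulr1 ?mulr0 ?addr0 ?add0r.
  by rewrite /dot3 /= ?mul0r ?mulr0 ?add0r ?addr0.
- rewrite -(integral21_prod_meas1 ig).
  transitivity (\int[mu]_(x in setT) cst 0 x)%E; last by rewrite integral0.
  apply: ae_eq_integral => //.
    exact: (measurable_fubini_G ig).
  have := ae_integrable2 ig; apply: filterS => x3 ig3 _.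
  rewrite /fubini_G -(integral12_prod_meas1 ig3).
  transitivity (\int[mu]_(x in setT) cst 0 x)%E; last by rewrite integral0.
  apply: eq_integral => x1 _; rewrite /fubini_F -[RHS](g0 (x1, 0, x3)).
    by apply: eq_integral => x2 _; rewrite lineE /unit3/= ?mulr1 ?mulr0 ?addr0 ?add0r.
  by rewrite /dot3 /= ?mul0r ?mulr0 ?add0r ?addr0.
- rewrite -(integral12_prod_meas1 ig).
  transitivity (\int[lebesgue2 R]_(x in setT) cst 0 x)%E; last by rewrite integral0.
  apply: eq_integral => -[x1 x2] _; rewrite /fubini_F -[RHS](g0 (x1, x2, 0)).
    by apply: eq_integral => x3 _; rewrite lineE /unit3/= ?mulr1 ?mulr0 ?addr0 ?add0r.
  by rewrite /dot3 /= ?mul0r ?mulr0 ?add0r ?addr0.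
Qed.

Definition cosint (f : R3 R -> R) (a : R3 R) (b : R) : R :=
  \int[lebesgue3 R]_x (f x * cos (dot3 x a + b)).

Lemma dot3_linel (t : R) (x y a : R3 R) : dot3 (t *: x + y) a = t * dot3 x a + dot3 y a.
Proof. by rewrite lineE /dot3 /=; ring. Qed.

Lemma dot3C (x y : R3 R) : dot3 x y = dot3 y x.
Proof. by rewrite /dot3; ring. Qed.

Lemma norm3_line (j : 'I_3) (t : R) (x : R3 R) : dot3 x (e j) = 0 ->
  t ^+ 2 <= norm3 (t *: e j + x) ^+ 2.
Proof.
move=> xj.
have ejj : dot3 (e j) (e j) = 1.
  by case: j {xj} => [[|[|[|//]]]] lj; rewrite /dot3 /unit3 /=; ring.
rewrite sqr_sqrtr ?dot3_ge0// dot3_linel.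
rewrite (dot3C (e j) (_ + _)) (dot3C x (_ + _)) !dot3_linel ejj xj (dot3C _ x) xj.
by rewrite mulr0 add0r addr0 mulr1 -expr2 lerDl dot3_ge0.
Qed.

Lemma is_derive_line (j : 'I_3) (f : R3 R -> R) (x : R3 R) (t : R) :
  derivable f (t *: e j + x) (e j) ->
  is_derive t (1 : R) (fun t => f (t *: e j + x)) ('D_(e j) f (t *: e j + x)).
Proof.
move=> df.
have E (h : R) : (f \o shift (t *: e j + x)) (h *: e j) =
    ((fun t => f (t *: e j + x)) \o shift t) (h *: (1 : R)).
  by rewrite /= addrA -scalerDl /GRing.scale /= mulr1.
split.
  by rewrite /derivable; under eq_fun do rewrite -E.
by rewrite /derive; under eq_fun do rewrite -E.
Qed.

Lemma rapid_line (j : 'I_3) (f : R3 R -> R) : rapid f ->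
  exists C : R, forall (x : R3 R) (t : R), dot3 x (e j) = 0 ->
    `|f (t *: e j + x)| <= C * (oneDsqr t)^-1.
Proof.
move=> [C Cf]; exists `|C| => x t xj; apply: le_trans (Cf _) _.
have t2 := norm3_line t xj.
have p0 : 0 < 1 + norm3 (t *: e j + x) ^+ 2 by rewrite ltr_pwDl// sqr_ge0.
apply: (@le_trans _ _ (`|C| * ((1 + norm3 (t *: e j + x) ^+ 2) ^+ 3)^-1)).
  by apply: ler_wpM2r; [rewrite invr_ge0 exprn_ge0// ltW|exact: ler_norm].
apply: ler_wpM2l => //; rewrite lef_pV2 ?posrE ?exprn_gt0// ?(lt_le_trans ltr01 (oneDsqr_ge1 _))//.
apply: (@le_trans _ _ (1 + norm3 (t *: e j + x) ^+ 2)).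
  by rewrite /oneDsqr lerD2l.
by rewrite ler_eXnr// lerDl sqr_ge0.
Qed.

Lemma cvg_oneDsqrV (u : nat -> R) (C : R) : (forall n, `|u n| = n%:R) ->
  C * (oneDsqr (u n))^-1 @[n --> \oo] --> (0 : R).
Proof.
move=> un; rewrite -(mulr0 C); apply: cvgM; first exact: cvg_cst.
have h : 2 * harmonic n @[n --> \oo] --> (0 : R).
  by rewrite -(mulr0 2); apply: cvgM; [exact: cvg_cst|exact: cvg_harmonic].
apply: (squeeze_cvgr _ (cvg_cst 0) h); apply: nearW => n.
rewrite /oneDsqr -(real_normK (num_real (u n))) un invr_ge0 addr_ge0 ?sqr_ge0//=.
rewrite /harmonic -(invrK 2) -invfM lef_pV2 ?posrE ?mulr_gt0 ?invr_gt0 ?ltr_pwDl ?sqr_ge0//.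
rewrite -(natr1 n); have : 0 <= n%:R :> R by []; move: n%:R => y y0.
rewrite mulrC ler_pdivrMr//; nra.
Qed.

Lemma continuous_line (j : 'I_3) (x : R3 R) : continuous (fun t : R => t *: e j + x).
Proof.
move=> t; apply: cvgD; last exact: cvg_cst.
by apply: cvgZr_tmp; exact: cvg_id.
Qed.

Lemma measurable_mul_cos (f : R3 R -> R) (a : R3 R) (b : R) :
  measurable_fun setT f -> measurable_fun setT (fun x : R3 R => f x * cos (dot3 x a + b)).
Proof. by move=> mf; apply: measurable_funM => //; exact: measurable_cos_dot3. Qed.

Lemma rapid_mul_cos (f : R3 R -> R) (a : R3 R) (b : R) : rapid f ->
  rapid (fun x => f x * cos (dot3 x a + b)).
Proof.
move=> [C Cf]; exists C => x; apply: le_trans (Cf x).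
by rewrite normrM ler_piMr// cos_max.
Qed.

Lemma cosint_parts (j : 'I_3) (f f' : R3 R -> R) (a : R3 R) (b : R) :
  continuous f -> continuous f' -> (forall x, derivable f x (e j)) ->
  (forall x, 'D_(e j) f x = f' x) -> rapid f -> rapid f' ->
  cosint f' a b = dot3 (e j) a * cosint f a (b - pi / 2).
Proof.
move=> cf cf' df dfE rf rf'.
have mf := continuous_measurable_R3 cf; have mf' := continuous_measurable_R3 cf'.
have i1 := rapid_integrable (measurable_mul_cos a b mf') (rapid_mul_cos a b rf').
have i2 := rapid_integrable (measurable_mul_cos a (b - pi / 2) mf)
  (rapid_mul_cos a (b - pi / 2) rf).
pose g x := f' x * cos (dot3 x a + b) -
  dot3 (e j) a * (f x * cos (dot3 x a + (b - pi / 2))).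
have i2' : (lebesgue3 R).-integrable setT
    (EFin \o (fun x => dot3 (e j) a * (f x * cos (dot3 x a + (b - pi / 2))))).
  exact: (integrableZl measurableT (dot3 (e j) a) i2).
have ig : (lebesgue3 R).-integrable setT (EFin \o g).
  exact: (integrableB measurableT i1 i2').
apply/eqP; rewrite -subr_eq0 /cosint -RintegralZl// -RintegralB//; apply/eqP.
rewrite /Rintegral; apply: (congr1 fine (_ : _ = 0%E)).
apply: (integral_line_eq0 ig) => x xj.
have [C Cf] := rapid_line j rf; have [C' Cf'] := rapid_line j rf'.
pose F t := f (t *: e j + x) * cos (dot3 (t *: e j + x) a + b).
have gE (t : R) : g (t *: e j + x) = f' (t *: e j + x) * cos (dot3 (t *: e j + x) a + b) -
  dot3 (e j) a * (f (t *: e j + x) * sin (dot3 (t *: e j + x) a + b)).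
  by rewrite /g addrA cosBpihalf.
have clin t : {for t, continuous (fun t : R => dot3 (t *: e j + x) a + b)}.
  apply: cvgD; last exact: cvg_cst.
  under eq_fun do rewrite dot3_linel; rewrite dot3_linel.
  by apply: cvgD; [apply: cvgM; [exact: cvg_id|exact: cvg_cst]|exact: cvg_cst].
have cg : continuous (fun t : R => g (t *: e j + x)).
  under eq_fun do rewrite gE.
  move=> t; apply: cvgB; last (apply: cvgM; first exact: cvg_cst); apply: cvgM.
  - by apply: continuous_comp; [exact: continuous_line|exact: cf'].
  - by apply: (continuous_comp (clin t)); exact: continuous_cos.
  - by apply: continuous_comp; [exact: continuous_line|exact: cf].
  - by apply: (continuous_comp (clin t)); exact: continuous_sin.
have igl : mu.-integrable setT (EFin \o (fun t : R => g (t *: e j + x))).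
  have ib := integrableZl measurableT (C' + `|dot3 (e j) a| * C) (@integrable_oneDsqrV R).
  apply: (integrable_dominated _ (ib : mu.-integrable setT (EFin \o (fun t =>
    (C' + `|dot3 (e j) a| * C) * (oneDsqr t)^-1)))).
    exact: continuous_measurable_fun.
  move=> t; rewrite gE (le_trans (ler_normB _ _))// [leRHS]mulrDl; apply: lerD.
    by apply: le_trans (Cf' x t xj); rewrite normrM ler_piMr// cos_max.
  rewrite normrM -mulrA ler_wpM2l//; apply: le_trans (Cf x t xj).
  by rewrite normrM ler_piMr// sin_max.
have F0 (u : nat -> R) : (forall n, `|u n| = n%:R) -> F (u n) @[n --> \oo] --> (0 : R).
  move=> un; apply: norm_cvg0.
  apply: (squeeze_cvgr _ (cvg_cst 0) (cvg_oneDsqrV C un)); apply: nearW => n.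
  rewrite normr_ge0/=; apply: le_trans (Cf x (u n) xj).
  by rewrite normrM ler_piMr// cos_max.
have : \int[mu]_t g (t *: e j + x) = 0.
  apply: (@integral_derive_eq0 _ F) => //.
  - move=> t; have H := is_derive_line (df (t *: e j + x)).
    rewrite /F; under [X in is_derive _ _ X]eq_fun do rewrite (dot3_linel _ (e j)).
    apply: is_derive_eq; rewrite gE dfE /GRing.scale/= dot3_linel; ring.
  - by apply: F0 => n; rewrite normr_nat.
  - by apply: F0 => n; rewrite normrN normr_nat.
move=> h; apply: (etrans (esym (fineK (integrable_fin_num measurableT igl)))).
exact: (congr1 EFin h).
Qed.

End parts.

(*@P5*)
Section fubini_real.
Context d1 d2 (X : measurableType d1) (Y : measurableType d2) (R : realType).
Variables (m1 : {sigma_finite_measure set X -> \bar R}).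
Variables (m2 : {sigma_finite_measure set Y -> \bar R}).
Implicit Types (f : X -> R) (g : Y -> R).

Lemma integrable_tensor f g : m1.-integrable setT (EFin \o f) ->
  m2.-integrable setT (EFin \o g) ->
  (m1 \x m2)%E.-integrable setT (EFin \o (fun z => f z.1 * g z.2)).
Proof.
move=> intf intg.
have /measurable_EFinP mf := measurable_int _ intf.
have /measurable_EFinP mg := measurable_int _ intg.
apply/integrable12ltyP.
  apply/measurable_EFinP; apply: measurable_funM.
    exact: (measurableT_comp mf measurable_fst).
  exact: (measurableT_comp mg measurable_snd).
have Ng : (\int[m2]_y `|(g y)%:E|)%E \is a fin_num.
  by apply: integrable_fin_num => //; exact: integrable_abse.
have -> : (\int[m1]_x \int[m2]_y `|(EFin \o (fun z : X * Y => f z.1 * g z.2)%R) (x, y)| =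
    \int[m1]_x (`|(f x)%:E| * \int[m2]_y `|(g y)%:E|))%E.
  apply: eq_integral => x _.
  under eq_integral do rewrite /= normrM EFinM.
  by rewrite ge0_integralZl//; apply/measurable_EFinP; exact: measurableT_comp.
rewrite ge0_integralZr//; last 2 first.
  by apply/measurable_EFinP; exact: measurableT_comp.
  exact: integral_ge0.
rewrite lte_mul_pinfty ?integral_ge0//; last by rewrite ltey_eq Ng.
by apply: integrable_fin_num => //; exact: integrable_abse.
Qed.

Lemma Rintegral_fubini (F : X * Y -> R) :
  (m1 \x m2)%E.-integrable setT (EFin \o F) ->
  (forall x, m2.-integrable setT (fun y => (F (x, y))%:E)) ->
  (forall y, m1.-integrable setT (fun x => (F (x, y))%:E)) ->
  \int[m1]_x \int[m2]_y F (x, y) = \int[m2]_y \int[m1]_x F (x, y).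
Proof.
move=> intF int2 int1; rewrite [LHS]/Rintegral [RHS]/Rintegral; congr fine.
transitivity (\int[m1]_x \int[m2]_y (F (x, y))%:E)%E.
  by apply: eq_integral => x _; rewrite fineK// integrable_fin_num.
rewrite (Fubini intF); apply: eq_integral => y _.
by rewrite fineK// integrable_fin_num.
Qed.

End fubini_real.

Lemma measurable_param_integral d1 d2 (X : measurableType d1) (Y : measurableType d2)
    (R : realType) (m2 : {sigma_finite_measure set Y -> \bar R})
    (g : Y -> R) (k : X * Y -> R) :
  m2.-integrable setT (EFin \o g) -> measurable_fun setT k ->
  (forall z, `|k z| <= 1) ->
  measurable_fun setT (fun x => \int[m2]_y (g y * k (x, y))).
Proof.
move=> intg mk k1.
have /measurable_EFinP mg := measurable_int _ intg.
have mg2 : measurable_fun setT (fun z : X * Y => g z.2).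
  exact: (measurableT_comp mg measurable_snd).
have intgk x : m2.-integrable setT (EFin \o (fun y => g y * k (x, y))).
  apply: le_integrable intg => //.
    apply/measurable_EFinP; apply: measurable_funM => //.
    exact: (measurableT_comp mk (pair1_measurable x)).
  by move=> y _ /=; rewrite lee_fin normrM ler_piMr.
have intng : m2.-integrable setT (EFin \o (fun y => `|g y|)).
  exact: integrable_norm.
pose F x := (\int[m2]_y (`|g y| + g y * k (x, y))%:E)%E.
have mF : measurable_fun setT F.
  apply: (measurable_fun_fubini_tonelli_F
    (fun z : X * Y => (`|g z.2| + g z.2 * k z)%:E)).
    apply/measurable_EFinP; apply: measurable_funD; last exact: measurable_funM.
    exact: measurableT_comp.
  move=> z; rewrite lee_fin -lerBlDl sub0r.
  have : `|g z.2 * k z| <= `|g z.2| by rewrite normrM ler_piMr.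
  by rewrite ler_norml => /andP[].
have -> : (fun x => \int[m2]_y (g y * k (x, y))) =
    (fun x => fine (F x) - \int[m2]_y `|g y|).
  apply/funext => x; rewrite -[fine (F x)]/(\int[m2]_y (`|g y| + g y * k (x, y))).
  by rewrite RintegralD// addrC addKr.
apply: measurable_funB => //; exact: measurableT_comp.
Qed.

(*@P6*)
Section fourier.
Context {R : realType}.
Notation mu := (@lebesgue_measure R).
Notation mu3 := (lebesgue3 R).
Local Notation e := (unit3 R).

Lemma schwartz_partials (phi : R3 R -> R) s : schwartz phi -> schwartz (partials s phi).
Proof.
move=> sphi s'; have := sphi (s' ++ s).
by rewrite /partials foldr_cat.
Qed.

Lemma norm3_pow6 (x : R3 R) : norm3 x ^+ 6 = (norm3 x ^+ 2) ^+ 3.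
Proof. by rewrite -exprM. Qed.

Lemma one_add_cube_le (A : R) : 0 <= A -> (1 + A) ^+ 3 <= 4 * (1 + A ^+ 3).
Proof.
move=> A0; rewrite -subr_ge0.
have -> : 4 * (1 + A ^+ 3) - (1 + A) ^+ 3 = 3 * ((A - 1) ^+ 2 * (A + 1)) by ring.
by apply: mulr_ge0 => //; apply: mulr_ge0; [exact: sqr_ge0|exact: addr_ge0].
Qed.

Lemma schwartz_rapid (phi : R3 R -> R) : schwartz phi -> rapid phi.
Proof.
move=> sphi; have [_ _ dec] := sphi [::]; have [C0 h0] := dec 0%N; have [C6 h6] := dec 6%N.
exists (4 * (C0 + C6)) => x.
have := h0 x; have := h6 x; rewrite expr0 mul1r norm3_pow6 /=.
have A0 := sqr_ge0 (norm3 x); move: (norm3 x ^+ 2) A0 => A A0 l6 l0.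
have n0 := normr_ge0 (phi x); move: `|phi x| n0 l6 l0 => p p0 l6 l0.
have B : (1 + A) ^+ 3 <= 4 * (1 + A ^+ 3).
  exact: one_add_cube_le.
rewrite ler_pdivlMr ?exprn_gt0 ?ltr_pwDl//.
apply: le_trans (ler_wpM2l p0 B) _.
by rewrite mulrCA ler_pM2l// mulrDr mulr1 [p * _]mulrC lerD.
Qed.

Lemma schwartz_continuous (phi : R3 R -> R) : schwartz phi -> continuous phi.
Proof. by move=> sphi; have [] := sphi [::]. Qed.

Lemma schwartz_integrable (phi : R3 R -> R) : schwartz phi ->
  mu3.-integrable setT (EFin \o phi).
Proof.
move=> sphi; apply: rapid_integrable; last exact: schwartz_rapid.
by apply: continuous_measurable_R3; exact: schwartz_continuous.
Qed.

Lemma cosint_partials (phi : R3 R -> R) (j : 'I_3) (n : nat) (a : R3 R) (b : R) :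
  schwartz phi ->
  cosint (partials (nseq n j) phi) a b =
  dot3 (e j) a ^+ n * cosint phi a (b - (pi / 2) *+ n).
Proof.
move=> sphi; elim: n b => [|n IH] b; first by rewrite expr0 mul1r mulr0n subr0.
have sn := schwartz_partials (nseq n j) sphi.
have sn1 := schwartz_partials [:: j] sn.
rewrite (@cosint_parts _ j (partials (nseq n j) phi)).
- rewrite IH exprS mulrA; congr (_ * cosint _ _ _).
  by rewrite [in RHS]mulrS opprD addrA.
- exact: schwartz_continuous.
- exact: schwartz_continuous sn1.
- by move=> x; have [_ d _] := sn [::]; exact: d.
- by [].
- exact: schwartz_rapid.
- exact: schwartz_rapid sn1.
Qed.

Lemma integrable_mul_cos (f : R3 R -> R) (a : R3 R) (b : R) :
  mu3.-integrable setT (EFin \o f) ->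
  mu3.-integrable setT (EFin \o (fun x => f x * cos (dot3 x a + b))).
Proof.
move=> intf; have /measurable_EFinP mf := measurable_int _ intf.
apply: le_integrable intf => //.
  by apply/measurable_EFinP; exact: measurable_mul_cos.
by move=> x _ /=; rewrite lee_fin normrM ler_piMr// cos_max.
Qed.

Lemma cosint_le (f : R3 R -> R) (a : R3 R) (b : R) :
  mu3.-integrable setT (EFin \o f) ->
  `|cosint f a b| <= \int[mu3]_x `|f x|.
Proof.
move=> intf; have intfc := integrable_mul_cos a b intf.
apply: le_trans (le_normr_Rintegral _ _) _ => //.
apply: le_Rintegral => //.
- exact: integrable_norm.
- exact: integrable_norm.
- by move=> x _; rewrite normrM ler_piMr// cos_max.
Qed.

(** Rapid decay of the Fourier transform of a Schwartz function, uniformly in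
    the phase. *)
Lemma cosint_rapid (phi : R3 R -> R) : schwartz phi ->
  exists C : R, forall a b, `|cosint phi a b| <= C * ((1 + norm3 a ^+ 2) ^+ 3)^-1.
Proof.
move=> sphi.
pose N (f : R3 R -> R) := \int[mu3]_x `|f x|.
pose D (j : 'I_3) := N (partials (nseq 6 j) phi).
have coord (j : 'I_3) a b : dot3 (e j) a ^+ 6 * `|cosint phi a b| <= D j.
  have := cosint_partials j 6 a (b + (pi / 2) *+ 6) sphi.
  rewrite addrK => /(congr1 Num.norm); rewrite normrM.
  rewrite (ger0_norm (_ : 0 <= _ ^+ 6)); last by rewrite (exprM _ 2 3) exprn_ge0// sqr_ge0.
  move=> <-; apply: cosint_le; exact/schwartz_integrable/schwartz_partials.
pose j0 : 'I_3 := @Ordinal 3 0 isT; pose j1 : 'I_3 := @Ordinal 3 1 isT.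
pose j2 : 'I_3 := @Ordinal 3 2 isT.
exists (4 * (N phi + 9 * (D j0 + D j1 + D j2))) => a b.
have := coord j0 a b; have := coord j1 a b; have := coord j2 a b.
have := cosint_le a b (schwartz_integrable sphi); rewrite -/(N phi).
have -> : dot3 (e j0) a = a.1.1 by rewrite /dot3 /unit3 /=; ring.
have -> : dot3 (e j1) a = a.1.2 by rewrite /dot3 /unit3 /=; ring.
have -> : dot3 (e j2) a = a.2 by rewrite /dot3 /unit3 /=; ring.
have n0 := normr_ge0 (cosint phi a b); move: `|cosint phi a b| n0 => p p0.
have A0 := sqr_ge0 (norm3 a).
rewrite ler_pdivlMr ?exprn_gt0 ?ltr_pwDl// norm3_sqr.
rewrite !(exprM _ 2 3).
have := sqr_ge0 a.1.1; have := sqr_ge0 a.1.2; have := sqr_ge0 a.2.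
move: (a.1.1 ^+ 2) (a.1.2 ^+ 2) (a.2 ^+ 2) => x y z z0 y0 x0.
move: (N phi) (D j0) (D j1) (D j2) => n d0 d1 d2 hp hz hy hx.
have B : (1 + (x + y + z)) ^+ 3 <= 4 * (1 + 9 * (x ^+ 3 + y ^+ 3 + z ^+ 3)).
  apply: le_trans (one_add_cube_le _) _; first by rewrite !addr_ge0.
  rewrite ler_pM2l// lerD2l -subr_ge0.
  have -> : 9 * (x ^+ 3 + y ^+ 3 + z ^+ 3) - (x + y + z) ^+ 3 =
    3 * ((x + y) * (x - y) ^+ 2 + (y + z) * (y - z) ^+ 2 + (x + z) * (x - z) ^+ 2) +
    (x + y + z) * ((x - y) ^+ 2 + (y - z) ^+ 2 + (x - z) ^+ 2) by ring.
  have q u v : 0 <= u -> 0 <= u * v ^+ 2 :> R by move=> u0; rewrite mulr_ge0// sqr_ge0.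
  apply: addr_ge0; apply: mulr_ge0 => //.
  - by rewrite !addr_ge0// q// addr_ge0.
  - by rewrite !addr_ge0.
  - by rewrite !addr_ge0// sqr_ge0.
apply: le_trans (ler_wpM2l p0 B) _.
rewrite mulrCA ler_pM2l// mulrDr mulr1 lerD// mulrCA ler_pM2l// !mulrDr.
by apply: lerD; [apply: lerD|]; rewrite mulrC.
Qed.

End fourier.

(*@P7*)
Section inversion.
Context {R : realType}.
Notation mu := (@lebesgue_measure R).
Notation mu3 := (lebesgue3 R).
Local Notation e := (unit3 R).

Lemma integrable_gaussian_mul (s : R) (f : R3 R -> R) : 0 < s ->
  measurable_fun setT f -> (exists C, forall x, `|f x| <= C) ->
  mu3.-integrable setT (EFin \o (fun x => expR (- s * norm3 x ^+ 2) * f x)).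
Proof.
move=> s0 mf [C fC].
have ig := integrableZl measurableT C (integrable_gaussian30 s0).
apply: (integrable_dominated _ (ig : mu3.-integrable setT (EFin \o (fun x =>
  C * expR (- s * norm3 x ^+ 2))))).
  apply: measurable_funM => //.
  by have := measurable_gaussian3 s 0; under eq_fun do rewrite subr0.
by move=> x; rewrite normrM ger0_norm ?expR_ge0// mulrC ler_pM2r ?expR_gt0.
Qed.

(** Testing an oscillating integral against a Gaussian window smooths it by
    the dual Gaussian. *)
Lemma gaussian_window (f : R3 R -> R) (s : R) (xi : R3 R) (b : R) : 0 < s ->
  mu3.-integrable setT (EFin \o f) ->
  \int[mu3]_x (expR (- s * norm3 x ^+ 2) *
     \int[mu3]_y (f y * cos (dot3 x (xi - y) + b))) =
  Num.sqrt (pi / s) ^+ 3 * cos b *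
     \int[mu3]_y (f y * expR (- (norm3 (xi - y) ^+ 2 / (4 * s)))).
Proof.
move=> s0 intf; have /measurable_EFinP mf := measurable_int _ intf.
have intg := @integrable_gaussian30 R s s0.
have mG : measurable_fun setT (fun x : R3 R => expR (- s * norm3 x ^+ 2)).
  by have := measurable_gaussian3 s 0; under eq_fun do rewrite subr0.
have mk : measurable_fun setT (fun z : R3 R * R3 R => cos (dot3 z.1 (xi - z.2) + b)).
  apply: (measurableT_comp measurable_cos); apply: measurable_funD => //.
  by apply: measurable_fun_dot3 => //; exact: measurable_fun_subR3.
pose F (z : R3 R * R3 R) := expR (- s * norm3 z.1 ^+ 2) * f z.2 *
  cos (dot3 z.1 (xi - z.2) + b).
have intF : (mu3 \x mu3)%E.-integrable setT (EFin \o F).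
  have := integrable_tensor intg intf; apply: le_integrable => //.
    apply/measurable_EFinP; apply: measurable_funM => //; apply: measurable_funM.
      exact: (measurableT_comp mG measurable_fst).
    exact: (measurableT_comp mf measurable_snd).
  by move=> z _ /=; rewrite lee_fin /F normrM ler_piMr// cos_max.
have intfk x : mu3.-integrable setT (EFin \o (fun y => f y * cos (dot3 x (xi - y) + b))).
  apply: le_integrable intf => //.
    apply/measurable_EFinP; apply: measurable_funM => //.
    exact: (measurableT_comp mk (pair1_measurable x)).
  by move=> y _ /=; rewrite lee_fin normrM ler_piMr// cos_max.
have intgk y : mu3.-integrable setT
    (EFin \o (fun x => expR (- s * norm3 x ^+ 2) * cos (dot3 x (xi - y) + b))).
  apply: integrable_gaussian_mul => //; first exact: measurable_cos_dot3.
  by exists 1 => x; exact: cos_max.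
transitivity (\int[mu3]_x \int[mu3]_y F (x, y)).
  apply: eq_Rintegral => x _; rewrite -RintegralZl//.
  by apply: eq_Rintegral => y _; rewrite /F /=; ring.
rewrite Rintegral_fubini//; last 2 first.
- move=> x; have := integrableZl measurableT (expR (- s * norm3 x ^+ 2)) (intfk x).
  by apply: eq_integrable => // y _; rewrite /F /= -EFinM; congr EFin; ring.
- move=> y; have := integrableZl measurableT (f y) (intgk y).
  by apply: eq_integrable => // x _; rewrite /F /= -EFinM; congr EFin; ring.
rewrite -RintegralZl//.
  apply: eq_Rintegral => y _.
  transitivity (\int[mu3]_x (f y * (expR (- s * norm3 x ^+ 2) * cos (dot3 x (xi - y) + b)))).
    by apply: eq_Rintegral => x _; rewrite /F /=; ring.
  by rewrite RintegralZl// gaussian_characteristic3//; ring.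
apply: le_integrable intf => //.
  apply/measurable_EFinP; apply: measurable_funM => //.
  apply: (measurableT_comp (f := expR)) => //; apply: measurable_funN.
  apply: measurable_funM => //; apply: measurable_funX; apply: measurable_fun_norm3.
  exact: measurable_fun_subR3.
move=> y _ /=; rewrite lee_fin normrM ler_piMr// ger0_norm ?expR_ge0//.
by rewrite expR_le1 oppr_le0 divr_ge0 ?sqr_ge0// mulr_ge0// ltW.
Qed.

Lemma schwartz_lipschitz (phi : R3 R -> R) : schwartz phi ->
  exists2 L : R, 0 <= L & forall x y : R3 R, `|phi y - phi x| <=
    L * (`|y.1.1 - x.1.1| + `|y.1.2 - x.1.2| + `|y.2 - x.2|).
Proof.
move=> sphi; have [_ dphi _] := sphi [::].
have bound j : exists2 C : R, 0 <= C & forall x, `|'D_(e j) phi x| <= C.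
  have [_ _ /(_ 0%N) [C hC]] := sphi [:: j]; exists C.
    by apply: le_trans (hC 0); rewrite expr0 mul1r.
  by move=> x; have := hC x; rewrite expr0 mul1r.
have step j (x : R3 R) (C t : R) : (forall x, `|'D_(e j) phi x| <= C) ->
    `|phi (t *: e j + x) - phi x| <= C * `|t|.
  move=> hC; pose g u := phi (u *: e j + x).
  have dg u : is_derive u (1 : R) g ('D_(e j) phi (u *: e j + x)).
    by apply: is_derive_line; exact: dphi.
  have cg : continuous g.
    by move=> u; apply: differentiable_continuous; apply/derivable1_diffP.
  have -> : phi x = g 0 by rewrite /g scale0r add0r.
  rewrite -[phi (t *: _ + _)]/(g t).
  have [t0|t0|->] := ltgtP t 0; last by rewrite subrr !normr0 mulr0.
  - have [c _] := MVT t0 (fun u _ => dg u) (continuous_subspaceT cg).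
    by rewrite distrC => ->; rewrite normrM sub0r normrN ler_wpM2r.
  - have [c _ ->] := MVT t0 (fun u _ => dg u) (continuous_subspaceT cg).
    by rewrite normrM subr0 ler_wpM2r.
pose j0 : 'I_3 := @Ordinal 3 0 isT; pose j1 : 'I_3 := @Ordinal 3 1 isT.
pose j2 : 'I_3 := @Ordinal 3 2 isT.
have [C0 C00 h0] := bound j0; have [C1 C10 h1] := bound j1; have [C2 C20 h2] := bound j2.
exists (C0 + C1 + C2); first by rewrite !addr_ge0.
move=> [[x1 x2] x3] [[y1 y2] y3] /=.
have s0 := step j0 (x1, x2, x3) C0 (y1 - x1) h0.
have s1 := step j1 (y1, x2, x3) C1 (y2 - x2) h1.
have s2 := step j2 (y1, y2, x3) C2 (y3 - x3) h2.
move: s0 s1 s2; rewrite !lineE /unit3 /= ?mulr1 ?mulr0 ?add0r ?subrK => s0 s1 s2.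
have -> : phi (y1, y2, y3) - phi (x1, x2, x3) =
  (phi (y1, x2, x3) - phi (x1, x2, x3)) + (phi (y1, y2, x3) - phi (y1, x2, x3)) +
  (phi (y1, y2, y3) - phi (y1, y2, x3)) by ring.
apply: le_trans (ler_normD _ _) _; apply: le_trans (lerD (ler_normD _ _) (lexx _)) _.
apply: le_trans (lerD (lerD s0 s1) s2) _.
move: (normr_ge0 (y1 - x1)) (normr_ge0 (y2 - x2)) (normr_ge0 (y3 - x3)).
move: `|y1 - x1| `|y2 - x2| `|y3 - x3| => a b c a0 b0 c0; nra.
Qed.

End inversion.

(*@P8*)
Lemma Rintegral_dominated_cvg d (T : measurableType d) (R : realType)
    (nu : {measure set T -> \bar R}) (F : nat -> T -> R) (f g : T -> R) :
  (forall n, measurable_fun setT (F n)) -> measurable_fun setT f ->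
  (forall x, F ^~ x @ \oo --> f x) -> nu.-integrable setT (EFin \o g) ->
  (forall n x, `|F n x| <= g x) ->
  \int[nu]_x F n x @[n --> \oo] --> \int[nu]_x f x.
Proof.
move=> mF mf Ff ig Fg.
have mFE n : measurable_fun setT (EFin \o F n) by apply/measurable_EFinP; exact: mF.
have mfE : measurable_fun setT (EFin \o f) by exact/measurable_EFinP.
have FfE : {ae nu, forall x, setT x -> (EFin \o F n) x @[n --> \oo] --> (EFin \o f) x}.
  by apply/aeW => x _; apply: cvg_EFin; [exact: nearW|exact: Ff].
have FgE : {ae nu, forall x n, setT x -> (`|(EFin \o F n) x| <= (EFin \o g) x)%E}.
  by apply/aeW => x n _; rewrite lee_fin.
have [_ _] := @dominated_convergence _ _ _ nu _ measurableT _ _ _ mFE mfE FfE ig FgE.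
rewrite -[X in _ --> X]fineK; first by move=> /fine_cvg.
apply: integrable_fin_num => //.
apply: le_integrable ig => //.
move=> x _ /=; rewrite lee_fin.
apply: (@le_trans _ _ (g x)); last exact: ler_norm.
by apply: (cvgr_to_le (cvg_norm (Ff x))); apply: nearW => n; exact: Fg.
Qed.

Section inversion.
Context {R : realType}.
Notation mu := (@lebesgue_measure R).
Notation mu3 := (lebesgue3 R).

Lemma gaussian_first_moment_le (r u A : R) : 0 < r -> u ^+ 2 <= A ->
  `|u| * expR (- (r * A)) <= (Num.sqrt r)^-1 * expR (- (r / 2 * A)).
Proof.
move=> r0 uA.
have sr : 0 < Num.sqrt r by rewrite sqrtr_gt0.
have -> : - (r * A) = - (r / 2 * A) - r / 2 * A by field.
rewrite expRD mulrCA mulrC ler_pM2r ?expR_gt0// expRN.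
rewrite ler_pdivrMr ?expR_gt0// -ler_pdivrMl ?invr_gt0// invrK.
apply: le_trans (expR_ge1Dx _).
have : Num.sqrt r ^+ 2 * `|u| ^+ 2 <= r * A.
  by rewrite (sqr_sqrtr (ltW r0)) real_normK ?num_real// ler_pM2l.
move: (Num.sqrt r) `|u| sr (normr_ge0 u) => q v q0 v0 h.
by nra.
Qed.

Lemma Rintegral_gaussian3 (s : R) (m : R3 R) : 0 < s ->
  \int[mu3]_x expR (- s * norm3 (x - m) ^+ 2) = Num.sqrt (pi / s) ^+ 3.
Proof. by move=> s0; rewrite /Rintegral integral_gaussian3. Qed.

Lemma gaussian_smoothing (phi : R3 R -> R) (xi : R3 R) : schwartz phi ->
  exists K : R, forall s : R, 0 < s ->
   `|Num.sqrt (pi / s) ^+ 3 *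
      (\int[mu3]_y (phi y * expR (- (norm3 (xi - y) ^+ 2 / (4 * s))))) -
     (2 * pi) ^+ 3 * phi xi| <= K * Num.sqrt s.
Proof.
move=> sphi; have [L L0 hL] := schwartz_lipschitz sphi.
exists (6 * L * Num.sqrt (8 * pi ^+ 2) ^+ 3) => s s0.
pose r := (4 * s)^-1.
have r0 : 0 < r by rewrite invr_gt0 mulr_gt0.
have r20 : 0 < r / 2 by rewrite divr_gt0.
have gE y : expR (- (norm3 (xi - y) ^+ 2 / (4 * s))) = expR (- r * norm3 (y - xi) ^+ 2).
  by rewrite norm3_sub_sym mulrC mulNr.
under eq_Rintegral do rewrite gE.
have mg : measurable_fun setT (fun y : R3 R => expR (- r * norm3 (y - xi) ^+ 2)).
  exact: measurable_gaussian3.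
have ig := @integrable_gaussian3 R r xi r0.
have igx : mu3.-integrable setT (EFin \o (fun y => phi xi * expR (- r * norm3 (y - xi) ^+ 2))).
  exact: (integrableZl measurableT (phi xi) ig).
have mphi : measurable_fun setT phi.
  by apply: continuous_measurable_R3; exact: schwartz_continuous.
have igp : mu3.-integrable setT (EFin \o (fun y => phi y * expR (- r * norm3 (y - xi) ^+ 2))).
  apply: le_integrable (schwartz_integrable sphi) => //.
    by apply/measurable_EFinP; exact: measurable_funM.
  move=> y _ /=; rewrite lee_fin normrM ler_piMr// ger0_norm ?expR_ge0//.
  by rewrite expR_le1 mulNr oppr_le0 mulr_ge0 ?sqr_ge0// ltW.
have -> : (2 * pi) ^+ 3 * phi xi = Num.sqrt (pi / s) ^+ 3 *
    \int[mu3]_y (phi xi * expR (- r * norm3 (y - xi) ^+ 2)).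
  rewrite RintegralZl// Rintegral_gaussian3// mulrCA mulrC -exprMn -sqrtrM; last first.
    by rewrite divr_ge0 ?pi_ge0// ltW.
  congr (_ * _ ^+ 3).
  have -> : pi / s * (pi / r) = (2 * pi) ^+ 2 by rewrite /r; field; rewrite gt_eqF.
  by rewrite sqrtr_sqr ger0_norm// mulr_ge0// pi_ge0.
rewrite -mulrBr -RintegralB// normrM ger0_norm ?exprn_ge0 ?sqrtr_ge0//.
pose C := 3 * L * (Num.sqrt r)^-1.
have ig2 : mu3.-integrable setT (EFin \o (fun y => C * expR (- (r / 2) * norm3 (y - xi) ^+ 2))).
  exact: (integrableZl measurableT C (@integrable_gaussian3 R (r / 2) xi r20)).
have le y : `|phi y * expR (- r * norm3 (y - xi) ^+ 2) -
    phi xi * expR (- r * norm3 (y - xi) ^+ 2)| <= C * expR (- (r / 2) * norm3 (y - xi) ^+ 2).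
  rewrite -mulrBl normrM (ger0_norm (expR_ge0 _)) !mulNr.
  apply: le_trans (ler_wpM2r (expR_ge0 _) (hL xi y)) _.
  have := norm3_sqr (y - xi); move: (norm3 _ ^+ 2) => A AE.
  have h1 : (y.1.1 - xi.1.1) ^+ 2 <= A by rewrite AE -addrA lerDl addr_ge0 ?sqr_ge0.
  have h2 : (y.1.2 - xi.1.2) ^+ 2 <= A by rewrite AE addrAC lerDr addr_ge0 ?sqr_ge0.
  have h3 : (y.2 - xi.2) ^+ 2 <= A by rewrite AE lerDr addr_ge0 ?sqr_ge0.
  have := gaussian_first_moment_le r0 h1; have := gaussian_first_moment_le r0 h2.
  have := gaussian_first_moment_le r0 h3; rewrite /C.
  move: (expR (- (r * A))) (expR (- (r / 2 * A))) (Num.sqrt r)^-1 => E1 E2 q l3 l2 l1.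
  have -> : 3 * L * q * E2 = L * (3 * (q * E2)) by ring.
  by rewrite -mulrA ler_wpM2l// !mulrDl; lra.
have -> : 6 * L * Num.sqrt (8 * pi ^+ 2) ^+ 3 * Num.sqrt s = Num.sqrt (pi / s) ^+ 3 *
    \int[mu3]_y (C * expR (- (r / 2) * norm3 (y - xi) ^+ 2)).
  rewrite RintegralZl//; last exact: integrable_gaussian3.
  rewrite Rintegral_gaussian3// [RHS]mulrCA -exprMn -sqrtrM; last first.
    by rewrite divr_ge0 ?pi_ge0// ltW.
  have -> : pi / s * (pi / (r / 2)) = 8 * pi ^+ 2 by rewrite /r; field; rewrite gt_eqF.
  rewrite /C /r sqrtrV ?mulr_ge0 ?ltW// invrK.
  have -> : Num.sqrt (4 * s) = 2 * Num.sqrt s.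
    rewrite sqrtrM// (_ : 4 = 2 ^+ 2 :> R); last by ring.
    by rewrite sqrtr_sqr ger0_norm.
  ring.
apply: ler_wpM2l; first by rewrite exprn_ge0 ?sqrtr_ge0.
apply: le_trans (le_normr_Rintegral _ _) _ => //.
  have := integrableB measurableT igp igx.
  by apply: eq_integrable.
apply: le_Rintegral => //.
apply: integrable_norm; have := integrableB measurableT igp igx.
by apply: eq_integrable.
Qed.

(** The inversion formula, with a phase [b] that accounts for both the real
    and the imaginary part. *)
Lemma fourier_inversion (phi : R3 R -> R) (xi : R3 R) (b : R) : schwartz phi ->
  \int[mu3]_x cosint phi x (- (dot3 x xi + b)) = (2 * pi) ^+ 3 * phi xi * cos b.
Proof.
move=> sphi; have [C hC] := cosint_rapid sphi.
have intphi := schwartz_integrable sphi.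
pose L (x : R3 R) := \int[mu3]_y (phi y * cos (dot3 x (xi - y) + b)).
have LE x : cosint phi x (- (dot3 x xi + b)) = L x.
  apply: eq_Rintegral => y _; rewrite -cosN; congr (_ * cos _).
  by rewrite /dot3 /=; ring.
under eq_Rintegral do rewrite LE.
have mL : measurable_fun setT L.
  apply: (@measurable_param_integral _ _ _ _ _ mu3 phi
    (fun z : R3 R * R3 R => cos (dot3 z.1 (xi - z.2) + b)) intphi) => [|z].
    apply: (measurableT_comp measurable_cos); apply: measurable_funD => //.
    by apply: measurable_fun_dot3 => //; exact: measurable_fun_subR3.
  exact: cos_max.
have iL : mu3.-integrable setT (EFin \o L).
  by apply: rapid_integrable => //; exists C => x; rewrite -LE.
pose s_ (n : nat) : R := n.+1%:R^-1.
have s0 n : 0 < s_ n by rewrite invr_gt0.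
have s_cvg : s_ @ \oo --> (0 : R) by exact: cvg_harmonic.
have lhs : \int[mu3]_x (expR (- s_ n * norm3 x ^+ 2) * L x) @[n --> \oo] -->
    \int[mu3]_x L x.
  apply: (Rintegral_dominated_cvg _ _ _ (integrable_norm iL)) => //.
  - move=> n; apply: measurable_funM => //.
    by have := measurable_gaussian3 (s_ n) 0; under eq_fun do rewrite subr0.
  - move=> x; rewrite -[X in _ --> X]mul1r; apply: cvgM; last exact: cvg_cst.
    rewrite -[X in _ --> X]expR0; apply: continuous_cvg; first exact: continuous_expR.
    rewrite -[X in _ --> X](mul0r (norm3 x ^+ 2)); apply: cvgM; last exact: cvg_cst.
    by rewrite -[X in _ --> X]oppr0; exact: cvgN.
  - move=> n x; rewrite normrM ler_piMl// ger0_norm ?expR_ge0// expR_le1.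
    by rewrite mulNr oppr_le0 mulr_ge0 ?sqr_ge0// ltW.
have [K hK] := gaussian_smoothing xi sphi.
have rhs : \int[mu3]_x (expR (- s_ n * norm3 x ^+ 2) * L x) @[n --> \oo] -->
    (2 * pi) ^+ 3 * phi xi * cos b.
  under eq_fun => n do rewrite gaussian_window// mulrAC.
  apply: cvgM; last exact: cvg_cst.
  apply/subr_cvg0; apply: norm_cvg0.
  have hs : K * Num.sqrt (s_ n) @[n --> \oo] --> (0 : R).
    rewrite -(mulr0 K) -(sqrtr0 R); apply: cvgM; first exact: cvg_cst.
    by apply: continuous_cvg => //; exact: sqrt_continuous.
  apply: (squeeze_cvgr _ (cvg_cst 0) hs); apply: nearW => n.
  by rewrite normr_ge0/= hK.
exact: cvg_unique lhs rhs.
Qed.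

End inversion.

(*@P9*)
Section fourier_integrable.
Context {R : realType}.
Notation mu3 := (lebesgue3 R).

Lemma measurable_cosint (f : R3 R -> R) (b : R) :
  mu3.-integrable setT (EFin \o f) -> measurable_fun setT (fun a => cosint f a b).
Proof.
move=> intf.
apply: (@measurable_param_integral _ _ _ _ _ mu3 f
  (fun z : R3 R * R3 R => cos (dot3 z.2 z.1 + b)) intf) => [|z].
  apply: (measurableT_comp measurable_cos); apply: measurable_funD => //.
  exact: measurable_fun_dot3.
exact: cos_max.
Qed.

Lemma cosint_phase (f : R3 R -> R) (a : R3 R) (b : R) :
  mu3.-integrable setT (EFin \o f) ->
  cosint f a b = cos b * cosint f a 0 + sin b * cosint f a (pi / 2).
Proof.
move=> intf; have i0 := integrable_mul_cos a 0 intf.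
have i1 := integrable_mul_cos a (pi / 2) intf.
rewrite /cosint -!RintegralZl// -RintegralD//.
- by apply: eq_Rintegral => x _; rewrite addr0 cosDpihalf cosD; ring.
- exact: (integrableZl measurableT (cos b) i0).
- exact: (integrableZl measurableT (sin b) i1).
Qed.

(** The inverse Fourier integral of a real function, given by its real and
    imaginary parts. *)
Definition inverse_fourier (v : R3 R -> R) (x : R3 R) : R[i] :=
  (c0 R * cosint v x 0) +i* (c0 R * cosint v x (- (pi / 2))).

Lemma fourier_integral_real (phi : R3 R -> R) (x : R3 R) :
  fourier_integral (fun y => (phi y)%:C) x =
  (c0 R * cosint phi x 0) +i* (c0 R * cosint phi x (pi / 2)).
Proof.
rewrite /fourier_integral /cintegral.
have -> : (\int[leb3 R]_y complex.Re ((phi y)%:C * expNi (dot3 y x))) = cosint phi x 0.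
  by apply: eq_Rintegral => y _; rewrite /= mul0r subr0 addr0.
have -> : (\int[leb3 R]_y complex.Im ((phi y)%:C * expNi (dot3 y x))) = cosint phi x (pi / 2).
  by apply: eq_Rintegral => y _; rewrite /= mul0r addr0 cosDpihalf.
by apply/eqP; rewrite eq_complex /= !mul0r subr0 addr0 !eqxx.
Qed.

Lemma fourier_pairing (v phi : R3 R -> R) (b : R) :
  mu3.-integrable setT (EFin \o v) -> schwartz phi ->
  let J x := cosint v x b * cosint phi x 0 + cosint v x (b + pi / 2) * cosint phi x (pi / 2) in
  mu3.-integrable setT (EFin \o J) /\
  \int[mu3]_x J x = (2 * pi) ^+ 3 * cos b * \int[mu3]_xi (v xi * phi xi).
Proof.
move=> intv sphi J.
have /measurable_EFinP mv := measurable_int _ intv.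
have intphi := schwartz_integrable sphi; have [C hC] := cosint_rapid sphi.
have mphi : measurable_fun setT phi.
  by apply: continuous_measurable_R3; exact: schwartz_continuous.
have mK (f : R3 R -> R) c : mu3.-integrable setT (EFin \o f) ->
    measurable_fun setT (cosint f ^~ c) by exact: measurable_cosint.
have iK c : mu3.-integrable setT (EFin \o (fun x => cosint phi x c)).
  by apply: rapid_integrable; [exact: mK|exists C].
have J_int : mu3.-integrable setT (EFin \o J).
  have half c c' : mu3.-integrable setT (EFin \o (fun x => cosint v x c * cosint phi x c')).
    pose N := \int[mu3]_x `|v x|.
    have iN : mu3.-integrable setT (EFin \o (fun x => N * `|cosint phi x c'|)).
      exact: (integrableZl measurableT N (integrable_norm (iK c'))).
    apply: (integrable_dominated _ iN) => [|x].
      by apply: measurable_funM; exact: mK.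
    by rewrite normrM ler_wpM2r// cosint_le.
  exact: (integrableD measurableT (half b 0) (half (b + pi / 2) (pi / 2))).
split=> //.
pose F (z : R3 R * R3 R) := v z.2 * cosint phi z.1 (- (dot3 z.1 z.2 + b)).
have FE x y : cosint phi x (- (dot3 x y + b)) =
    cos (dot3 x y + b) * cosint phi x 0 + cos (dot3 x y + (b + pi / 2)) * cosint phi x (pi / 2).
  by rewrite cosint_phase// cosN sinN addrA cosDpihalf.
have mcos c : measurable_fun setT (fun z : R3 R * R3 R => cos (dot3 z.1 z.2 + c)).
  apply: (measurableT_comp measurable_cos); apply: measurable_funD => //.
  exact: measurable_fun_dot3.
have mF : measurable_fun setT F.
  apply: measurable_funM; first exact: (measurableT_comp mv measurable_snd).
  under eq_fun do rewrite FE; apply: measurable_funD; apply: measurable_funM => //.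
    exact: (measurableT_comp (mK phi 0 intphi) measurable_fst).
  exact: (measurableT_comp (mK phi (pi / 2) intphi) measurable_fst).
pose w (x : R3 R) := C * ((1 + norm3 x ^+ 2) ^+ 3)^-1.
have w_ge0 x : 0 <= w x by apply: le_trans (hC x 0).
have iw : mu3.-integrable setT (EFin \o w).
  apply: rapid_integrable; last first.
    by exists C => x; rewrite ger0_norm.
  apply: measurable_funM => //; apply: measurable_fun_inv; apply: measurable_funX.
  by apply: measurable_funD => //; apply: measurable_funX; exact: measurable_norm3.
have intF : (mu3 \x mu3)%E.-integrable setT (EFin \o F).
  have := integrable_tensor iw intv; apply: le_integrable => //.
    exact/measurable_EFinP.
  move=> z _ /=; rewrite lee_fin /F normrM [leRHS]normrM (ger0_norm (w_ge0 _)) mulrC.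
  by rewrite ler_wpM2r//; exact: hC.
have intFx x : mu3.-integrable setT (fun y => (F (x, y))%:E).
  have iv : mu3.-integrable setT (EFin \o (fun y => w x * `|v y|)).
    exact: (integrableZl measurableT (w x) (integrable_norm intv)).
  change (mu3.-integrable setT (EFin \o (fun y => F (x, y)))).
  apply: (integrable_dominated _ iv).
    exact: (measurableT_comp mF (pair1_measurable x)).
  by move=> y; rewrite /F normrM mulrC ler_wpM2r.
have intFy y : mu3.-integrable setT (fun x => (F (x, y))%:E).
  have ix : mu3.-integrable setT (EFin \o (fun x => `|v y| * w x)).
    exact: (integrableZl measurableT `|v y| iw).
  change (mu3.-integrable setT (EFin \o (fun x => F (x, y)))).
  apply: (integrable_dominated _ ix).
    exact: (measurableT_comp mF (pair2_measurable y)).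
  by move=> x; rewrite /F normrM ler_wpM2l.
transitivity (\int[mu3]_x \int[mu3]_y F (x, y)).
  apply: eq_Rintegral => x _; rewrite /J.
  have i1 := integrable_mul_cos x b intv.
  have i2 := integrable_mul_cos x (b + pi / 2) intv.
  rewrite [cosint v x b]/cosint [cosint v x (b + pi / 2)]/cosint -!RintegralZr//.
  rewrite -RintegralD//.
  - by apply: eq_Rintegral => y _; rewrite /F /= FE (dot3C y x); ring.
  - exact: (integrableZr measurableT (cosint phi x 0) i1).
  - exact: (integrableZr measurableT (cosint phi x (pi / 2)) i2).
rewrite Rintegral_fubini//.
transitivity (\int[mu3]_y ((2 * pi) ^+ 3 * cos b * (v y * phi y))).
  apply: eq_Rintegral => y _.
  rewrite /F/= RintegralZl//.
    by rewrite fourier_inversion//; ring.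
  apply: (integrable_dominated _ iw) => [|x]; last exact: hC.
  under eq_fun do rewrite FE; apply: measurable_funD; apply: measurable_funM => //.
  - exact: (measurableT_comp (mcos b) (pair2_measurable y)).
  - exact: mK.
  - exact: (measurableT_comp (mcos (b + pi / 2)) (pair2_measurable y)).
  - exact: mK.
rewrite RintegralZl//.
have [M [_ Mphi]] : exists M, [/\ True & forall x, `|phi x| <= M].
  by have [_ _ /(_ 0%N) [M hM]] := sphi [::]; exists M; split => // x;
     have := hM x; rewrite expr0 mul1r.
have ivM : mu3.-integrable setT (EFin \o (fun y => M * `|v y|)).
  exact: (integrableZl measurableT M (integrable_norm intv)).
apply: (integrable_dominated _ ivM) => [|y]; first exact: measurable_funM.
by rewrite normrM mulrC ler_wpM2r.
Qed.

Lemma c0_sqr : c0 R ^+ 2 * (2 * pi) ^+ 3 = 1.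
Proof.
have pi2 : 0 < 2 * pi :> R by rewrite mulr_gt0// pi_gt0.
rewrite /c0 -powR_mulrn ?powR_ge0// -powRrM -powR_mulrn ?(ltW pi2)// -powRD.
  by rewrite (_ : - (3 / 2) * 2%:R + 3%:R = 0) ?powRr0//; field.
by rewrite (gt_eqF pi2) implybT.
Qed.

Lemma is_fourier_inverse (v : R3 R -> R) : mu3.-integrable setT (EFin \o v) ->
  is_fourier (inverse_fourier v) (fun xi => (v xi)%:C).
Proof.
move=> intv phi sphi phiC.
have [i0 e0] := fourier_pairing 0 intv sphi.
have [i1 e1] := fourier_pairing (- (pi / 2)) intv sphi.
set J0 := fun x => _ in i0 e0; set J1 := fun x => _ in i1 e1.
have ReE x : complex.Re (inverse_fourier v x * fourier_integral phiC x) =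
    c0 R ^+ 2 * J0 x.
  rewrite fourier_integral_real /= /J0 add0r.
  by rewrite (cosint_phase x (- (pi / 2)) intv) cosN sinN cos_pihalf sin_pihalf; ring.
have ImE x : complex.Im (inverse_fourier v x * fourier_integral phiC x) =
    c0 R ^+ 2 * J1 x.
  by rewrite fourier_integral_real /= /J1 addNr; ring.
have [M Mphi] : exists M, forall x, `|phi x| <= M.
  by have [_ _ /(_ 0%N) [M hM]] := sphi [::]; exists M => x;
     have := hM x; rewrite expr0 mul1r.
have /measurable_EFinP mv := measurable_int _ intv.
have mphi : measurable_fun setT phi.
  by apply: continuous_measurable_R3; exact: schwartz_continuous.
have ivphi : mu3.-integrable setT (EFin \o (fun y => v y * phi y)).
  have ivM : mu3.-integrable setT (EFin \o (fun y => M * `|v y|)).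
    exact: (integrableZl measurableT M (integrable_norm intv)).
  apply: (integrable_dominated _ ivM) => [|y]; first exact: measurable_funM.
  by rewrite normrM mulrC ler_wpM2r.
have ReE' y : complex.Re ((v y)%:C * phiC y) = v y * phi y by rewrite /= mul0r subr0.
have ImE' y : complex.Im ((v y)%:C * phiC y) = 0 by rewrite /= mul0r mulr0 addr0.
split.
- split.
  + have := integrableZl measurableT (c0 R ^+ 2) i0.
    by apply: eq_integrable => // x _; exact: (congr1 EFin (esym (ReE x))).
  + have := integrableZl measurableT (c0 R ^+ 2) i1.
    by apply: eq_integrable => // x _; exact: (congr1 EFin (esym (ImE x))).
- split.
  + by apply: eq_integrable ivphi => // x _; exact: (congr1 EFin (esym (ReE' x))).
  + have := integrable0 mu3 setT.
    by apply: eq_integrable => // x _; exact: (congr1 EFin (esym (ImE' x))).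
- rewrite /cintegral; congr (_ +i* _).
  + transitivity (\int[mu3]_x (c0 R ^+ 2 * J0 x)).
      by apply: eq_Rintegral => x _; rewrite ReE.
    rewrite RintegralZl// e0 cos0 mulr1 mulrA c0_sqr mul1r.
    by apply: eq_Rintegral => x _; rewrite ReE'.
  + transitivity (\int[mu3]_x (c0 R ^+ 2 * J1 x)).
      by apply: eq_Rintegral => x _; rewrite ImE.
    rewrite RintegralZl// e1 cosN cos_pihalf mulr0 mul0r mulr0.
    transitivity (\int[mu3]_x (cst 0 x : R)); last by apply: eq_Rintegral => x _; rewrite ImE'.
    by rewrite Rintegral_cst//= mul0r.
Qed.

Lemma inverse_fourier_le (v : R3 R -> R) (x : R3 R) :
  mu3.-integrable setT (EFin \o v) ->
  `|inverse_fourier v x| <= (2 * c0 R * \int[mu3]_y `|v y|)%:C.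
Proof.
move=> intv; set N := \int[mu3]_y `|v y|.
have c00 : 0 <= c0 R := powR_ge0 _ _.
have N0 : 0 <= N by apply: Rintegral_ge0.
have b (c : R) : `|c0 R * cosint v x c| <= c0 R * N.
  by rewrite normrM ger0_norm// ler_wpM2l// cosint_le.
have := b 0; have := b (- (pi / 2)); rewrite /inverse_fourier.
move: (c0 R * cosint v x 0) (c0 R * cosint v x _) => p q hq hp.
rewrite normc_def lecR -(ger0_norm (_ : 0 <= 2 * c0 R * N)); last by rewrite !mulr_ge0.
rewrite -sqrtr_sqr ler_wsqrtr// -(real_normK (num_real p)) -(real_normK (num_real q)).
move: (normr_ge0 p) (normr_ge0 q) hp hq; rewrite -mulrA.
move: `|p| `|q| (c0 R * N) => P Q S P0 Q0; nra.
Qed.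

End fourier_integrable.

(*@P10*)
Section coulomb.
Context {R : realType}.
Notation mu := (@lebesgue_measure R).
Notation mu3 := (lebesgue3 R).

Definition heaviside (y : R) : R := \1_(`]0, +oo[%classic : set R) y.

Lemma heaviside_gt0 (y : R) : 0 < y -> heaviside y = 1.
Proof. by move=> y0; rewrite /heaviside indicE mem_set//= in_itv/= y0. Qed.

Lemma heaviside_le0 (y : R) : y <= 0 -> heaviside y = 0.
Proof.
move=> y0; rewrite /heaviside indicE memNset//= in_itv/= andbT.
by apply/negP; rewrite -leNgt.
Qed.

Lemma heaviside_ge0 (y : R) : 0 <= heaviside y. Proof. by rewrite /heaviside indicE. Qed.

Lemma heaviside_le1 (y : R) : heaviside y <= 1. Proof. by rewrite /heaviside indicE; case: (_ \in _). Qed.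

Lemma measurable_heaviside : measurable_fun setT heaviside.
Proof. exact: measurable_indic. Qed.

Lemma integral_heaviside (f : R -> R) :
  (\int[mu]_y (heaviside y * f y)%:E = \int[mu]_(y in `]0%R, +oo[) (f y)%:E)%E.
Proof.
rewrite [RHS]integral_mkcond; apply: eq_integral => y _; rewrite patchE.
case: (ltP 0 y) => y0; first by rewrite heaviside_gt0// mul1r mem_set//= in_itv/= y0.
rewrite heaviside_le0// mul0r memNset//= in_itv/= andbT.
by apply/negP; rewrite -leNgt.
Qed.

Lemma integral_half_even (f : R -> R) (c : R) : (forall x, 0 <= f x) ->
  continuous f -> f =1 f \o -%R -> (\int[mu]_x (f x)%:E = c%:E)%E ->
  (\int[mu]_(x in `]0%R, +oo[) (f x)%:E = (c / 2)%:E)%E.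
Proof.
move=> f0 cf fN; rewrite (ge0_symfun_integralT f0 cf fN).
have mf : measurable_fun setT f by exact: continuous_measurable_fun.
rewrite -set_itvcy integral_itv_obnd_cbnd; last first.
  by apply/measurable_EFinP; exact: measurable_funTS.
move: (\int[mu]_(x in `[0%R, +oo[) _)%E => I h.
have {h} : (2^-1%:E * (2%:E * I) = (2^-1 * c)%:E)%E by rewrite h EFinM.
by rewrite muleA -EFinM mulVf// mul1e mulrC.
Qed.

Lemma continuous_gaussian (A : R) : continuous (fun x : R => expR (- A * x ^+ 2)).
Proof.
move=> x; apply: continuous_comp; last exact: continuous_expR.
by apply: cvgM; [exact: cvg_cst|exact: exprn_continuous].
Qed.

Lemma integral_half_gaussian (A : R) : 0 < A ->
  (\int[mu]_(x in `]0%R, +oo[) (expR (- A * x ^+ 2))%:E =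
   (Num.sqrt pi / 2 * (Num.sqrt A)^-1)%:E)%E.
Proof.
move=> A0; rewrite (@integral_half_even _ (Num.sqrt (pi / A))).
- by congr EFin; rewrite sqrtrM ?pi_ge0// sqrtrV ?ltW//; ring.
- by move=> x; exact: expR_ge0.
- exact: continuous_gaussian.
- by move=> x /=; rewrite sqrrN.
- by have := integral_gaussian 0 A0; under eq_integral do rewrite subr0.
Qed.

Let f (A x : R) : R := (x ^+ 3)^-1 * expR (- (A / (4 * x ^+ 2))).
Let F (A x : R) : R := 2 / A * expR (- (A / (4 * x ^+ 2))).

Let dF (A x : R) : A != 0 -> 0 < x -> is_derive x (1 : R) (F A) (f A x).
Proof.
move=> A0 x0; have x20 : 4 * x ^+ 2 != 0 by rewrite gt_eqF// mulr_gt0// exprn_gt0.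
rewrite /F /f; apply: is_derive_eq.
by rewrite /GRing.scale /=; field; rewrite A0 gt_eqF.
Qed.

Let itv (n : nat) : set R := `[n.+1%:R^-1, n.+1%:R].

Let itv_bigcup : \bigcup_n itv n = `]0, +oo[%classic.
Proof.
apply/seteqP; split=> [x [n _]|x]; rewrite /itv /= !in_itv/= andbT.
  by move=> /andP[+ _]; apply: lt_le_trans; rewrite invr_gt0.
move=> x0; exists (maxn (Num.truncn x) (Num.truncn x^-1)) => //=.
rewrite in_itv/=; apply/andP; split.
  rewrite -[leRHS]invrK lef_pV2 ?posrE ?invr_gt0//.
  by rewrite ltW// (lt_le_trans (truncnS_gt _))// ler_nat ltnS leq_maxr.
by rewrite ltW// (lt_le_trans (truncnS_gt _))// ler_nat ltnS leq_maxl.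
Qed.

Let itv_pos n x : itv n x -> 0 < x.
Proof.
rewrite /itv /= in_itv/= => /andP[+ _]; apply: lt_le_trans.
by rewrite invr_gt0.
Qed.

(** The Gaussians of variance s^2 average to a multiple of the kernel
    |x|^-2. *)
Lemma integral_dual_gaussian (A : R) : 0 < A ->
  (\int[mu]_(x in `]0%R, +oo[) ((x ^+ 3)^-1 * expR (- (A / (4 * x ^+ 2))))%:E =
   (2 / A)%:E)%E.
Proof.
move=> A0; have A0' : A != 0 by rewrite gt_eqF.
rewrite -[LHS]/(\int[mu]_(x in `]0%R, +oo[) (f A x)%:E)%E -itv_bigcup.
have cf x : 0 < x -> {for x, continuous (f A)}.
  move=> x0; apply: differentiable_continuous; apply/derivable1_diffP.
  have x20 : 4 * x ^+ 2 != 0 by rewrite gt_eqF// mulr_gt0// exprn_gt0.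
  have x30 : x ^+ 3 != 0 by rewrite gt_eqF// exprn_gt0.
  by rewrite /f; apply: ex_derive.
have cF x : 0 < x -> {for x, continuous (F A)}.
  move=> x0; apply: differentiable_continuous; apply/derivable1_diffP.
  by have := dF A0' x0; move=> [].
have mfn n : measurable_fun (itv n) (fun x => (f A x)%:E).
  apply/measurable_EFinP; apply: subspace_continuous_measurable_fun; first exact: measurable_itv.
  by apply: continuous_in_subspaceT => x; rewrite inE => /itv_pos; exact: cf.
have nd : nondecreasing_seq itv.
  move=> m n mn; apply/subsetPset => x; rewrite /itv /= !in_itv/= => /andP[mx xm].
  apply/andP; split.
    by apply: le_trans mx; rewrite lef_pV2 ?posrE// ler_nat ltnS.
  by apply: le_trans xm _; rewrite ler_nat ltnS.
have f_ge0 n x : itv n x -> (0 <= (f A x)%:E)%E.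
  by move=> /itv_pos x0; rewrite lee_fin mulr_ge0 ?expR_ge0// invr_ge0 exprn_ge0// ltW.
have := @ge0_nondecreasing_set_cvg_integral _ (measurableTypeR R) R itv (fun x => (f A x)%:E) mu nd
  (fun n => measurable_itv _) mfn f_ge0.
set I := (X in _ --> X) => limI.
have ev n : (0 < n)%N -> (\int[mu]_(x in itv n) (f A x)%:E = (F A n.+1%:R - F A n.+1%:R^-1)%:E)%E.
  move=> n0; rewrite EFinB; apply: continuous_FTC2.
  - by rewrite invf_plt ?posrE// (lt_le_trans (_ : _ < 1))// ?invf_lt1 ?ltr1n ?ler1n.
  - by apply: continuous_in_subspaceT => x; rewrite inE => /(@itv_pos n); exact: cf.
  - split.
    + move=> x; rewrite in_itv/= => /andP[nx _].
      have x0 : 0 < x by apply: lt_trans nx; rewrite invr_gt0.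
      by have := dF A0' x0; move=> [].
    + by apply: cvg_at_right_filter; apply: cF; rewrite invr_gt0.
    + by apply: cvg_at_left_filter; exact: cF.
  - move=> x; rewrite in_itv/= => /andP[nx _].
    have x0 : 0 < x by apply: lt_trans nx; rewrite invr_gt0.
    by rewrite derive1E; have := dF A0' x0; move=> [_ ->].
have lim1 : (F A n.+1%:R - F A n.+1%:R^-1) @[n --> \oo] --> 2 / A.
  have h1 : expR (- (A / 4) * harmonic n ^+ 2) @[n --> \oo] --> (1 : R).
    rewrite -[X in _ --> X]expR0; apply: continuous_cvg; first exact: continuous_expR.
    rewrite -[X in _ --> X](mulr0 (- (A / 4))); apply: cvgM; first exact: cvg_cst.
    rewrite -[X in _ --> X](mulr0 (0 : R)); under eq_fun do rewrite expr2.
    by apply: cvgM; exact: cvg_harmonic.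
  have h2 : expR (- (A / 4) * n.+1%:R ^+ 2) @[n --> \oo] --> (0 : R).
    have A40 : 0 < A / 4 by rewrite divr_gt0.
    by have := cvg_expR_sqr A40; rewrite -cvg_shiftS.
  rewrite -[X in _ --> X]subr0 -[X in X - _]mulr1 -[X in _ - X](mulr0 (2 / A)).
  have -> : (fun n => F A n.+1%:R - F A n.+1%:R^-1) =
      (fun n => 2 / A * expR (- (A / 4) * harmonic n ^+ 2) -
                2 / A * expR (- (A / 4) * n.+1%:R ^+ 2)).
    apply/funext => n; rewrite /F /harmonic; congr (_ * expR _ - _ * expR _).
      by rewrite exprVn; field; rewrite nat1r pnatr_eq0.
    by rewrite exprVn; field; rewrite nat1r pnatr_eq0.
  by apply: cvgB; apply: cvgM => //; exact: cvg_cst.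
apply: cvg_unique limI _ => //.
have lim2 : (F A n.+1%:R - F A n.+1%:R^-1)%:E @[n --> \oo] --> (2 / A)%:E.
  by apply: cvg_EFin; [exact: nearW|].
apply: cvg_trans lim2; apply: near_eq_cvg.
by exists 1%N => // n n1; rewrite ev.
Qed.

End coulomb.

(*@P11*)
Lemma integral_mixture d1 d2 (X : measurableType d1) (Y : measurableType d2)
    (R : realType) (m1 : {sigma_finite_measure set X -> \bar R})
    (m2 : {sigma_finite_measure set Y -> \bar R})
    (k : X * Y -> R) (w f : X -> R) :
  measurable_fun setT k -> (forall z, 0 <= k z) -> measurable_fun setT f ->
  (forall x, \int[m2]_y (k (x, y))%:E = (w x)%:E)%E ->
  m1.-integrable setT (EFin \o (fun x => w x * f x)) ->
  (forall y, m1.-integrable setT (EFin \o (fun x => k (x, y) * f x))) ->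
  \int[m1]_x (w x * f x) = \int[m2]_y \int[m1]_x (k (x, y) * f x).
Proof.
move=> mk k0 mf kw iwf ikf.
pose F (z : X * Y) := k z * f z.1.
have w0 x : 0 <= w x by rewrite -lee_fin -kw; apply: integral_ge0 => y _; rewrite lee_fin.
have mkx x : measurable_fun setT (fun y => k (x, y)).
  exact: (measurableT_comp mk (pair1_measurable x)).
have ikx x : m2.-integrable setT (EFin \o (fun y => k (x, y))).
  apply/integrableP; split; first exact/measurable_EFinP.
  under eq_integral do rewrite /= ger0_norm//.
  by rewrite kw ltry.
have intF : (m1 \x m2)%E.-integrable setT (EFin \o F).
  apply/integrable12ltyP.
    apply/measurable_EFinP; apply: measurable_funM => //.
    exact: (measurableT_comp mf measurable_fst).
  have /integrableP[_] := iwf; apply: le_lt_trans.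
  rewrite le_eqVlt; apply/orP; left; apply/eqP; apply: eq_integral => x _ /=.
  rewrite normrM (ger0_norm (w0 x)) EFinM -kw -ge0_integralZr//.
  - by apply: eq_integral => y _; rewrite /= normrM ger0_norm// EFinM.
  - exact/measurable_EFinP.
  - by move=> y _; rewrite lee_fin.
transitivity (\int[m1]_x \int[m2]_y F (x, y)).
  apply: eq_Rintegral => x _; rewrite /F /= RintegralZr//.
  by rewrite /Rintegral kw.
rewrite Rintegral_fubini// => x.
exact: (integrableZr measurableT (f x) (ikx x)).
Qed.

Section coulomb.
Context {R : realType}.
Notation mu := (@lebesgue_measure R).
Notation mu3 := (lebesgue3 R).

Lemma ae_neq0 : {ae mu3, forall x : R3 R, x != 0}.
Proof.
exists [set 0]; split; [|exact: lebesgue3_point|].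
  have -> : [set 0] = (@norm3 R) @^-1` [set 0].
    by apply/seteqP; split=> x /=; [move=> ->; exact: norm3_0|move=> /eqP; rewrite norm3_eq0 => /eqP].
  by rewrite -[X in measurable X]setTI; exact: measurable_norm3.
by move=> x /= /negP; rewrite negbK => /eqP.
Qed.

Lemma eq_Rintegral_neq0 (f g : R3 R -> R) :
  measurable_fun setT f -> measurable_fun setT g ->
  (forall x, x != 0 -> f x = g x) -> \int[mu3]_x f x = \int[mu3]_x g x.
Proof.
move=> mf mg fg; rewrite /Rintegral; congr fine.
apply: ae_eq_integral => //; [exact/measurable_EFinP|exact/measurable_EFinP|].
have [N [mN N0 sub]] := ae_neq0; exists N; split => // x /= nfg.
by apply: sub => /= x0; apply: nfg => _; rewrite fg.
Qed.

#[local] Hint Resolve heaviside_ge0 heaviside_le1 measurable_heaviside : core.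

(** The Newtonian potential |x|^-1 and the kernel |xi|^-2 are the two sides
    of the same mixture of Gaussians. *)
Lemma coulomb_pairing (phi : R3 R -> R) (b : R) : schwartz phi ->
  mu3.-integrable setT (EFin \o (fun x => (norm3 x)^-1 * cosint phi x b)) ->
  mu3.-integrable setT (EFin \o (fun x => (norm3 x ^+ 2)^-1 * phi x)) ->
  \int[mu3]_x ((norm3 x)^-1 * cosint phi x b) =
  4 * pi * cos b * \int[mu3]_x ((norm3 x ^+ 2)^-1 * phi x).
Proof.
move=> sphi iK iphi2.
have iphi := schwartz_integrable sphi.
have mphi : measurable_fun setT phi.
  by apply: continuous_measurable_R3; exact: schwartz_continuous.
have mK : measurable_fun setT (cosint phi ^~ b) by exact: measurable_cosint.
have [C hC] := cosint_rapid sphi.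
have iKb : mu3.-integrable setT (EFin \o (fun x => cosint phi x b)).
  by apply: rapid_integrable => //; exists C.
have mn : measurable_fun setT (fun z : R3 R * R => norm3 z.1).
  by apply: measurable_fun_norm3.
have mn2 : measurable_fun setT (fun z : R3 R * R => norm3 z.1 ^+ 2).
  exact: measurable_funX.
have ms2 : measurable_fun setT (fun z : R3 R * R => z.2 ^+ 2).
  exact: measurable_funX.
have mposn : measurable_fun setT (fun z : R3 R * R => heaviside (norm3 z.1)).
  exact: (measurableT_comp measurable_heaviside mn).
have mposs : measurable_fun setT (fun z : R3 R * R => heaviside z.2).
  exact: (measurableT_comp measurable_heaviside measurable_snd).
have [M Mphi] : exists M, forall x, `|phi x| <= M.
  by have [_ _ /(_ 0%N) [M hM]] := sphi [::]; exists M => x;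
     have := hM x; rewrite expr0 mul1r.
pose k1 (z : R3 R * R) := heaviside (norm3 z.1) * (heaviside z.2 * expR (- norm3 z.1 ^+ 2 * z.2 ^+ 2)).
pose k2 (z : R3 R * R) := heaviside (norm3 z.1) *
  (heaviside z.2 * ((z.2 ^+ 3)^-1 * expR (- (norm3 z.1 ^+ 2 / (4 * z.2 ^+ 2))))).
have mk1 : measurable_fun setT k1.
  apply: measurable_funM => //; apply: measurable_funM => //.
  apply: (measurableT_comp (f := expR)) => //; apply: measurable_funM => //.
  exact: measurable_funN.
have mk2 : measurable_fun setT k2.
  apply: measurable_funM => //; apply: measurable_funM => //; apply: measurable_funM.
    by apply: measurable_fun_inv; exact: measurable_funX.
  apply: (measurableT_comp (f := expR)) => //; apply: measurable_funN.
  apply: measurable_funM => //; apply: measurable_fun_inv; exact: measurable_funM.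
have k1_ge0 z : 0 <= k1 z by rewrite !mulr_ge0// expR_ge0.
have k2_ge0 z : 0 <= k2 z.
  rewrite /k2; case: (ltP 0 z.2) => z0; last by rewrite (heaviside_le0 z0) mul0r mulr0.
  by rewrite !mulr_ge0// ?expR_ge0// invr_ge0 exprn_ge0// ltW.
have k1w x : (\int[mu]_s (k1 (x, s))%:E = (Num.sqrt pi / 2 * (norm3 x)^-1)%:E)%E.
  rewrite /k1 /=; have [->|x0] := eqVneq x 0.
    under eq_integral do rewrite norm3_0 heaviside_le0// mul0r.
    by rewrite integral0 norm3_0 invr0 mulr0.
  under eq_integral do rewrite heaviside_gt0 ?norm3_gt0// mul1r.
  rewrite integral_heaviside integral_half_gaussian ?exprn_gt0 ?norm3_gt0//.
  by rewrite sqrtr_sqr ger0_norm// norm3_ge0.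
have k2w x : (\int[mu]_s (k2 (x, s))%:E = (2 * (norm3 x ^+ 2)^-1)%:E)%E.
  rewrite /k2 /=; have [->|x0] := eqVneq x 0.
    under eq_integral do rewrite norm3_0 heaviside_le0// mul0r.
    by rewrite integral0 norm3_0 expr0n invr0 mulr0.
  under eq_integral do rewrite heaviside_gt0 ?norm3_gt0// mul1r.
  by rewrite integral_heaviside integral_dual_gaussian ?exprn_gt0 ?norm3_gt0.
have ik1 s : mu3.-integrable setT (EFin \o (fun x => k1 (x, s) * cosint phi x b)).
  apply: (integrable_dominated _ (integrable_norm iKb)) => [|x].
    apply: measurable_funM => //; exact: (measurableT_comp mk1 (pair2_measurable s)).
  rewrite normrM ler_piMl// ger0_norm// /k1 /=.
  have E1 : expR (- norm3 x ^+ 2 * s ^+ 2) <= 1.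
    by rewrite expR_le1 mulNr oppr_le0 mulr_ge0 ?sqr_ge0.
  have E2 : heaviside s * expR (- norm3 x ^+ 2 * s ^+ 2) <= 1.
    by apply: mulr_ile1; rewrite ?expR_ge0 ?heaviside_ge0 ?heaviside_le1 ?E1.
  by apply: mulr_ile1; rewrite ?mulr_ge0 ?expR_ge0 ?heaviside_ge0 ?heaviside_le1 ?E2.
have ik2 s : mu3.-integrable setT (EFin \o (fun x => k2 (x, s) * phi x)).
  have ic := integrableZl measurableT (heaviside s * (s ^+ 3)^-1) (integrable_norm iphi).
  apply: (integrable_dominated _ (ic : mu3.-integrable setT (EFin \o (fun x =>
    (heaviside s * (s ^+ 3)^-1) * `|phi x|)))) => [|x].
    apply: measurable_funM => //; exact: (measurableT_comp mk2 (pair2_measurable s)).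
  rewrite normrM ler_wpM2r// ger0_norm// /k2 /=.
  case: (ltP 0 s) => s0; last by rewrite (heaviside_le0 s0) !mul0r mulr0.
  rewrite (heaviside_gt0 s0) !mul1r mulrCA ler_piMr ?invr_ge0 ?(exprn_ge0 _ (ltW s0))//.
  have E1 : expR (- (norm3 x ^+ 2 / (4 * s ^+ 2))) <= 1.
    by rewrite expR_le1 oppr_le0 divr_ge0 ?sqr_ge0// mulr_ge0// sqr_ge0.
  by apply: mulr_ile1; rewrite ?expR_ge0 ?heaviside_ge0 ?heaviside_le1 ?E1.
have w1 : mu3.-integrable setT (EFin \o (fun x =>
    Num.sqrt pi / 2 * (norm3 x)^-1 * cosint phi x b)).
  have := integrableZl measurableT (Num.sqrt pi / 2) iK.
  by apply: eq_integrable => // x _; rewrite /= -EFinM mulrA.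
have w2 : mu3.-integrable setT (EFin \o (fun x => 2 * (norm3 x ^+ 2)^-1 * phi x)).
  have := integrableZl measurableT 2 iphi2.
  by apply: eq_integrable => // x _; rewrite /= -EFinM mulrA.
have E1 := @integral_mixture _ _ _ _ R mu3 mu k1
  (fun x => Num.sqrt pi / 2 * (norm3 x)^-1) _ mk1 k1_ge0 mK k1w w1 ik1.
pose c := Num.sqrt pi ^+ 3 * cos b.
have w2c : mu3.-integrable setT (EFin \o (fun x => 2 * (norm3 x ^+ 2)^-1 * (c * phi x))).
  have := integrableZl measurableT c w2.
  by apply: eq_integrable => // x _; rewrite /= -EFinM; congr EFin; ring.
have ik2c s : mu3.-integrable setT (EFin \o (fun x => k2 (x, s) * (c * phi x))).
  have := integrableZl measurableT c (ik2 s).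
  by apply: eq_integrable => // x _; rewrite /= -EFinM; congr EFin; ring.
have mcphi : measurable_fun setT (fun x => c * phi x) by exact: measurable_funM.
have E2 := @integral_mixture _ _ _ _ R mu3 mu k2
  (fun x => 2 * (norm3 x ^+ 2)^-1) _ mk2 k2_ge0 mcphi k2w w2c ik2c.
have key s : \int[mu3]_x (k1 (x, s) * cosint phi x b) =
    \int[mu3]_x (k2 (x, s) * (c * phi x)).
  case: (ltP 0 s) => s0; last first.
    rewrite /k1 /k2 /=.
    under eq_Rintegral do rewrite (heaviside_le0 s0) mul0r mulr0 mul0r.
    by under [RHS]eq_Rintegral do rewrite (heaviside_le0 s0) mul0r mulr0 mul0r.
  have s20 : 0 < s ^+ 2 by rewrite exprn_gt0.
  transitivity (\int[mu3]_x (expR (- s ^+ 2 * norm3 x ^+ 2) *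
      \int[mu3]_y (phi y * cos (dot3 x (0 - y) + - b)))).
    have cE x : cosint phi x b = \int[mu3]_y (phi y * cos (dot3 x (0 - y) + - b)).
      apply: eq_Rintegral => y _; rewrite -[in RHS]cosN; congr (_ * cos _).
      by rewrite /dot3 /=; ring.
    under [RHS]eq_Rintegral do rewrite -cE.
    apply: eq_Rintegral_neq0.
    - by apply: measurable_funM => //; exact: (measurableT_comp mk1 (pair2_measurable s)).
    - apply: measurable_funM => //.
      by have := measurable_gaussian3 (s ^+ 2) 0; under eq_fun do rewrite subr0.
    - move=> x x0; rewrite /k1 /= (heaviside_gt0 s0) heaviside_gt0 ?norm3_gt0// !mul1r.
      by congr (expR _ * _); ring.
  have mE : measurable_fun setT
      (fun y : R3 R => phi y * expR (- (norm3 (0 - y) ^+ 2 / (4 * s ^+ 2)))).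
    apply: measurable_funM => //; apply: (measurableT_comp (f := expR)) => //.
    apply: measurable_funN; apply: measurable_funM => //; apply: measurable_funX.
    by apply: measurable_fun_norm3; exact: measurable_fun_subR3.
  have iE : mu3.-integrable setT (EFin \o
      (fun y : R3 R => phi y * expR (- (norm3 (0 - y) ^+ 2 / (4 * s ^+ 2))))).
    apply: (integrable_dominated _ (integrable_norm iphi)) => // y.
    rewrite normrM ler_piMr// ger0_norm ?expR_ge0// expR_le1 oppr_le0.
    by rewrite divr_ge0 ?sqr_ge0// mulr_ge0// sqr_ge0.
  rewrite gaussian_window// cosN -RintegralZl//.
  apply: eq_Rintegral_neq0.
  - exact: measurable_funM.
  - apply: measurable_funM => //; exact: (measurableT_comp mk2 (pair2_measurable s)).
  - move=> x x0; rewrite /k2 /= (heaviside_gt0 s0) heaviside_gt0 ?norm3_gt0// !mul1r sub0r.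
    have -> : norm3 (- x) = norm3 x by rewrite -sub0r norm3_sub_sym subr0.
    rewrite sqrtrM ?pi_ge0// sqrtrV ?ltW// sqrtr_sqr ger0_norm ?ltW// /c.
    by rewrite exprMn exprVn; ring.
have : Num.sqrt pi / 2 * \int[mu3]_x ((norm3 x)^-1 * cosint phi x b) =
    2 * c * \int[mu3]_x ((norm3 x ^+ 2)^-1 * phi x).
  rewrite -!RintegralZl//.
  transitivity (\int[mu3]_x (Num.sqrt pi / 2 * (norm3 x)^-1 * cosint phi x b)).
    by apply: eq_Rintegral => x _; rewrite mulrA.
  transitivity (\int[mu3]_x (2 * (norm3 x ^+ 2)^-1 * (c * phi x))).
    by rewrite E1 E2; apply: eq_Rintegral => s _; exact: key.
  by apply: eq_Rintegral => x _; ring.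
have sp : Num.sqrt pi != 0 :> R by rewrite gt_eqF// sqrtr_gt0 pi_gt0.
move=> E; apply: (mulfI (_ : Num.sqrt pi / 2 != 0)); first by rewrite mulf_neq0.
rewrite E /c.
have -> : 4 * pi * cos b = 4 * Num.sqrt pi ^+ 2 * cos b.
  by rewrite sqr_sqrtr// pi_ge0.
by field.
Qed.

Lemma c0_mul8 : 2 / pi * c0 R * (4 * pi) = (2 / pi) `^ (3 / 2).
Proof.
have p0 := @pi_gt0 R.
have aux (p : R) : p != 0 -> 2 / p = 4 * (2 * p)^-1 by move=> p_neq0; field.
rewrite aux ?gt_eqF//.
have q0 : 0 <= 2 * pi :> R by rewrite mulr_ge0// ltW.
have qV0 : 0 <= (2 * pi)^-1 :> R by rewrite invr_ge0.
rewrite powRM//.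
have -> : 4 `^ (3 / 2) = 8 :> R.
  have -> : 4 = 2 `^ 2 :> R by rewrite powR_mulrn//; ring.
  rewrite -powRrM (_ : 2 * (3 / 2) = 3%:R) ?powR_mulrn//; first by ring.
  by field.
rewrite -{2}(powR_inv1 q0) -powRrM mulN1r -/(c0 R).
have aux2 (p c : R) : p != 0 -> 4 / (2 * p) * c * (4 * p) = 8 * c.
  by move=> p_neq0; field.
by rewrite aux2// gt_eqF.
Qed.

Lemma is_fourier_coulomb :
  mu3.-integrable setT (EFin \o (fun x => (norm3 x ^+ 2 * (1 + norm3 x ^+ 2))^-1)) ->
  is_fourier (@u_init R) (fun xi => ((2 / pi) `^ (3 / 2) * (norm3 xi ^+ 2)^-1)%:C).
Proof.
move=> iwt phi sphi phiC.
have [C hC] := cosint_rapid sphi.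
have [C' hC'] := schwartz_rapid sphi.
have iphi := schwartz_integrable sphi.
have mphi : measurable_fun setT phi.
  by apply: continuous_measurable_R3; exact: schwartz_continuous.
have iK b : mu3.-integrable setT (EFin \o (fun x => (norm3 x)^-1 * cosint phi x b)).
  have ic := integrableZl measurableT C iwt.
  apply: (integrable_dominated _ (ic : mu3.-integrable setT (EFin \o (fun x =>
    C * (norm3 x ^+ 2 * (1 + norm3 x ^+ 2))^-1)))) => [|x].
    apply: measurable_funM; last exact: measurable_cosint.
    by apply: measurable_fun_inv; exact: measurable_norm3.
  rewrite normrM ger0_norm ?invr_ge0 ?norm3_ge0//.
  have [->|x0] := eqVneq x 0.
    by rewrite norm3_0 expr0n mul0r invr0 mul0r mulr0.
  have n0 := norm3_gt0 x0.
  apply: le_trans (ler_wpM2l _ (hC x b)) _; first by rewrite invr_ge0 ltW.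
  have C0 : 0 <= C.
    have := le_trans (normr_ge0 _) (hC x b).
    by rewrite pmulr_lge0// invr_gt0 exprn_gt0// ltr_pwDl// sqr_ge0.
  rewrite mulrCA ler_wpM2l// -invfM lef_pV2 ?posrE ?mulr_gt0 ?exprn_gt0 ?ltr_pwDl ?sqr_ge0//.
  move: (norm3 x) n0 => n n0.
  have h1 : n <= 1 + n ^+ 2 by nra.
  have h2 : 1 <= 1 + n ^+ 2 by rewrite lerDl sqr_ge0.
  rewrite expr2 -mulrA ler_pM2l// exprS mulrC ler_pM2l ?(lt_le_trans ltr01)//.
  by apply: le_trans h1 _; rewrite ler_eXnr.
have iphi2 : mu3.-integrable setT (EFin \o (fun x => (norm3 x ^+ 2)^-1 * phi x)).
  have ic := integrableZl measurableT C' iwt.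
  apply: (integrable_dominated _ (ic : mu3.-integrable setT (EFin \o (fun x =>
    C' * (norm3 x ^+ 2 * (1 + norm3 x ^+ 2))^-1)))) => [|x].
    apply: measurable_funM => //; apply: measurable_fun_inv.
    by apply: measurable_funX; exact: measurable_norm3.
  rewrite normrM ger0_norm ?invr_ge0 ?sqr_ge0//.
  apply: le_trans (ler_wpM2l _ (hC' x)) _; first by rewrite invr_ge0 sqr_ge0.
  have A0 := sqr_ge0 (norm3 x).
  have C0 : 0 <= C'.
    have := le_trans (normr_ge0 _) (hC' x).
    by rewrite pmulr_lge0// invr_gt0 exprn_gt0// ltr_pwDl.
  rewrite mulrCA ler_wpM2l// [leRHS]invfM ler_wpM2l ?invr_ge0//.
  rewrite lef_pV2 ?posrE ?exprn_gt0 ?ltr_pwDl//.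
  by rewrite ler_eXnr// lerDl.
have P0 := coulomb_pairing sphi (iK 0) iphi2.
have P1 := coulomb_pairing sphi (iK (pi / 2)) iphi2.
pose a : R := (2 / pi) `^ (3 / 2).
have ReE x : complex.Re (u_init x * fourier_integral phiC x) =
    2 / pi * c0 R * ((norm3 x)^-1 * cosint phi x 0).
  by rewrite fourier_integral_real /u_init /= mul0r subr0; ring.
have ImE x : complex.Im (u_init x * fourier_integral phiC x) =
    2 / pi * c0 R * ((norm3 x)^-1 * cosint phi x (pi / 2)).
  by rewrite fourier_integral_real /u_init /= mul0r addr0; ring.
have ReE' y : complex.Re ((a * (norm3 y ^+ 2)^-1)%:C * phiC y) =
    a * ((norm3 y ^+ 2)^-1 * phi y).
  by rewrite /= mul0r subr0 mulrA.
have ImE' y : complex.Im ((a * (norm3 y ^+ 2)^-1)%:C * phiC y) = 0.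
  by rewrite /= mul0r mulr0 addr0.
split.
- split.
  + have := integrableZl measurableT (2 / pi * c0 R) (iK 0).
    by apply: eq_integrable => // x _; exact: (congr1 EFin (esym (ReE x))).
  + have := integrableZl measurableT (2 / pi * c0 R) (iK (pi / 2)).
    by apply: eq_integrable => // x _; exact: (congr1 EFin (esym (ImE x))).
- split.
  + have := integrableZl measurableT a iphi2.
    by apply: eq_integrable => // x _; exact: (congr1 EFin (esym (ReE' x))).
  + have := integrable0 mu3 setT.
    by apply: eq_integrable => // x _; exact: (congr1 EFin (esym (ImE' x))).
- rewrite /cintegral; congr (_ +i* _).
  + transitivity (\int[mu3]_x (2 / pi * c0 R * ((norm3 x)^-1 * cosint phi x 0))).
      by apply: eq_Rintegral => x _; rewrite ReE.
    rewrite RintegralZl// P0 cos0 mulr1 mulrA c0_mul8 -RintegralZl//.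
    by apply: eq_Rintegral => x _; rewrite ReE'.
  + transitivity (\int[mu3]_x (2 / pi * c0 R * ((norm3 x)^-1 * cosint phi x (pi / 2)))).
      by apply: eq_Rintegral => x _; rewrite ImE.
    rewrite RintegralZl// P1 cos_pihalf mulr0 mul0r mulr0.
    transitivity (\int[mu3]_x (cst 0 x : R)); last by apply: eq_Rintegral => x _; rewrite ImE'.
    by rewrite Rintegral_cst//= mul0r.
Qed.

End coulomb.

(*@P12*)
Section triangle.
Context {R : realType}.
Notation mu := (@lebesgue_measure R).
Notation mu3 := (lebesgue3 R).

(** From sin (pi / 6) = 1 / 2 and sin x < x. *)
Lemma pi_gt3 : 3 < pi :> R.
Proof.
pose x : R := pi / 6; pose s := sin x.
have p0 := @pi_gt0 R.
have x0 : 0 < x by rewrite divr_gt0.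
have xpi (y : R) : 0 < y <= x -> 0 < sin y.
  move=> /andP[y0 yx]; apply: sin_gt0_pi; rewrite y0/=; apply: le_lt_trans yx _.
  by rewrite /x ltr_pdivrMr// ltr_pMr// ltr1n.
have s0 : 0 < s by apply: xpi; rewrite x0 lexx.
have s3 : 3 * s - 4 * s ^+ 3 = 1.
  transitivity (sin (x + (x + x))); last first.
    rewrite -[RHS](@sin_pihalf R); congr sin; rewrite /x.
    by move: (pi : R) => p; field.
  rewrite !sinD !cosD -/s.
  have := cos2Dsin2 x; rewrite -/s; move: (cos x) => c h.
  have -> : s * (c * c - s * s) + c * (s * c + c * s) = s * (3 * c ^+ 2 - s ^+ 2) by ring.
  have -> : c ^+ 2 = 1 - s ^+ 2 by rewrite -h addrK.
  by ring.
have sE : s = 1 / 2.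
  have : (s + 1) * (2 * s - 1) ^+ 2 = 0.
    have -> : (s + 1) * (2 * s - 1) ^+ 2 = 1 - (3 * s - 4 * s ^+ 3) by ring.
    by rewrite s3 subrr.
  move/eqP; rewrite mulf_eq0 sqrf_eq0 gt_eqF ?addr_gt0//= => /eqP h.
  by lra.
have dsin c : c \in `]0, x[ -> is_derive c (1 : R) (@sin R) (cos c).
  by move=> _; exact: is_derive_sin.
have csin : {within `[0, x], continuous (@sin R)}.
  by apply: continuous_subspaceT; exact: continuous_sin.
have [c] := MVT x0 dsin csin.
rewrite in_itv/= => /andP[c0 cx]; rewrite sin0 !subr0 -/s sE => h.
have sc : 0 < sin c by apply: xpi; rewrite c0 ltW.
have cc : cos c < 1.
  have := cos2Dsin2 c; have := cos_le1 c; move: (cos c) (sin c) sc => u v v0; nra.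
have : cos c * x < x by rewrite gtr_pMl.
by rewrite -h /x; lra.
Qed.

(** An improper integral over a half line, by an antiderivative. *)
Lemma ge0_integral_antiderivative (f F : R -> R) (l : R) :
  (forall x, 0 <= x -> 0 <= f x) -> continuous f ->
  (forall x : R, is_derive x 1 F (f x)) -> F n%:R @[n --> \oo] --> l ->
  (\int[mu]_(x in `]0%R, +oo[) (f x)%:E = (l - F 0)%:E)%E.
Proof.
move=> f0 cf dF Fl.
have cF : continuous F.
  by move=> x; apply: differentiable_continuous; apply/derivable1_diffP.
have mf : measurable_fun setT f by exact: continuous_measurable_fun.
rewrite integral_itv_obnd_cbnd; last by apply/measurable_EFinP; exact: measurable_funTS.
pose itv n : set R := `[0, n%:R]%classic.
have -> : `[0%R, +oo[%classic = \bigcup_n itv n.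
  apply/seteqP; split=> [x|x [n _]]; rewrite /itv /= !in_itv/= ?andbT.
    move=> x0; exists (Num.truncn x).+1 => //=; rewrite in_itv/= x0/=.
    by rewrite ltW// truncnS_gt.
  by move=> /andP[].
have nd : nondecreasing_seq itv.
  move=> m n mn; apply/subsetPset => x; rewrite /itv /= !in_itv/= => /andP[-> xm]/=.
  by apply: le_trans xm _; rewrite ler_nat.
have mfn n : measurable_fun (itv n) (fun x => (f x)%:E).
  by apply/measurable_EFinP; exact: measurable_funTS.
have f_ge0 n x : itv n x -> (0 <= (f x)%:E)%E.
  by rewrite /itv/= in_itv/= lee_fin => /andP[x0 _]; exact: f0.
have := @ge0_nondecreasing_set_cvg_integral _ (measurableTypeR R) R itv (fun x => (f x)%:E) mu nd
  (fun n => measurable_itv _) mfn f_ge0.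
set I := (X in _ --> X) => limI.
have ev n : (0 < n)%N -> (\int[mu]_(x in itv n) (f x)%:E = (F n%:R - F 0)%:E)%E.
  move=> n0; rewrite EFinB; apply: continuous_FTC2.
  - by rewrite ltr0n.
  - exact: continuous_subspaceT.
  - split.
    + by move=> x _.
    + by apply: cvg_at_right_filter; exact: cF.
    + by apply: cvg_at_left_filter; exact: cF.
  - by move=> x _; rewrite derive1E derive_val.
apply: cvg_unique limI _ => //.
have lim2 : (F n%:R - F 0)%:E @[n --> \oo] --> (l - F 0)%:E.
  by apply: cvg_EFin; [exact: nearW|apply: cvgB => //; exact: cvg_cst].
apply: cvg_trans lim2; apply: near_eq_cvg.
by exists 1%N => // n n1; rewrite ev.
Qed.

(** 1 / Z^3 as a mixture of Gaussians exp (- s^2 Z). *)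
Lemma integral_gamma3 (Z : R) : 0 < Z ->
  (\int[mu]_(x in `]0%R, +oo[) (x ^+ 5 * expR (- Z * x ^+ 2))%:E = ((Z ^+ 3)^-1)%:E)%E.
Proof.
move=> Z0; have Zn : Z != 0 by rewrite gt_eqF.
pose F x := - (1 / 2 * (x ^+ 4 / Z + 2 * x ^+ 2 / Z ^+ 2 + 2 / Z ^+ 3) * expR (- Z * x ^+ 2)).
pose f x := x ^+ 5 * expR (- Z * x ^+ 2).
have f0 x : 0 <= x -> 0 <= f x by move=> x0; rewrite mulr_ge0 ?expR_ge0// exprn_ge0.
have cf : continuous f.
  move=> x; apply: differentiable_continuous; apply/derivable1_diffP.
  exact: ex_derive.
have dF (x : R) : is_derive x (1 : R) F (f x).
  by rewrite /F; apply: is_derive_eq; rewrite /f /GRing.scale /=; field.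
suff F_0 : F n%:R @[n --> \oo] --> (0 : R).
  rewrite (ge0_integral_antiderivative f0 cf dF F_0).
  by congr EFin; rewrite /F !expr0n /= !mulr0 expR0; field.
pose C := 6 / Z ^+ 3 * (1 / Z + 2 / Z ^+ 2 + 2 / Z ^+ 3).
have hC : C * harmonic n @[n --> \oo] --> (0 : R).
  by rewrite -[X in _ --> X](mulr0 C); apply: cvgM; [exact: cvg_cst|exact: cvg_harmonic].
rewrite -cvg_shiftS; apply: norm_cvg0.
apply: (squeeze_cvgr _ (cvg_cst 0) hC); apply: nearW => n.
rewrite normr_ge0/= /harmonic; set y : R := n.+1%:R.
have y1 : 1 <= y by rewrite ler1n.
have y0 : 0 < y by rewrite (lt_le_trans ltr01).
have E : expR (- Z * y ^+ 2) <= 6 / Z ^+ 3 / y ^+ 6.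
  have -> : 6 / Z ^+ 3 / y ^+ 6 = ((Z * y ^+ 2) ^+ 3 / 6)^-1.
    by field; rewrite Zn gt_eqF.
  have Zy : 0 < Z * y ^+ 2 by rewrite mulr_gt0// exprn_gt0.
  rewrite mulNr expRN lef_pV2 ?posrE ?expR_gt0 ?divr_gt0 ?exprn_gt0//.
  have := @expR_ge1Dxn R _ 2 (ltW Zy); rewrite (_ : 3`! = 6)//.
  by apply: le_trans; rewrite lerDr.
have P0 : 0 <= 1 / 2 * (y ^+ 4 / Z + 2 * y ^+ 2 / Z ^+ 2 + 2 / Z ^+ 3).
  by rewrite mulr_ge0// !addr_ge0// ?divr_ge0 ?mulr_ge0 ?exprn_ge0// ltW.
rewrite /F normrN (ger0_norm (mulr_ge0 P0 (expR_ge0 _))).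
apply: le_trans (ler_wpM2l P0 E) _.
have P1 : 1 / 2 * (y ^+ 4 / Z + 2 * y ^+ 2 / Z ^+ 2 + 2 / Z ^+ 3) <=
    y ^+ 4 * (1 / Z + 2 / Z ^+ 2 + 2 / Z ^+ 3).
  have y2 : 1 <= y ^+ 2 by rewrite exprn_ege1.
  have y24 : y ^+ 2 <= y ^+ 4 by rewrite ler_weXn2l.
  have z1 : 0 <= Z^-1 by rewrite invr_ge0 ltW.
  have z2 : 0 <= (Z ^+ 2)^-1 by rewrite invr_ge0 exprn_ge0// ltW.
  have z3 : 0 <= (Z ^+ 3)^-1 by rewrite invr_ge0 exprn_ge0// ltW.
  move: (Z^-1) (Z ^+ 2)^-1 (Z ^+ 3)^-1 (y ^+ 2) (y ^+ 4) z1 z2 z3 y2 y24.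
  move=> a b c u v a0 b0 c0 u1 uv; nra.
apply: le_trans (ler_wpM2r _ P1) _.
  by rewrite !divr_ge0 ?exprn_ge0// ltW.
have -> : y ^+ 4 * (1 / Z + 2 / Z ^+ 2 + 2 / Z ^+ 3) * (6 / Z ^+ 3 / y ^+ 6) = C / y ^+ 2.
  by rewrite /C; field; rewrite Zn gt_eqF.
apply: ler_wpM2l.
  by rewrite /C mulr_ge0 ?addr_ge0 ?divr_ge0 ?exprn_ge0// ltW.
by rewrite lef_pV2 ?posrE ?exprn_gt0// expr2 ler_peMl// ltW.
Qed.

Lemma integral_gamma2 (q : R) : 0 < q ->
  (\int[mu]_(x in `]0%R, +oo[) (x ^+ 2 * expR (- q * x ^+ 2))%:E =
   (Num.sqrt pi / (4 * Num.sqrt q ^+ 3))%:E)%E.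
Proof.
move=> q0; have qn : q != 0 by rewrite gt_eqF.
pose g x : R := expR (- q * x ^+ 2).
pose f x := x ^+ 2 * g x.
pose F x := x * g x.
have q20 : 0 < q / 2 by rewrite divr_gt0.
have bound (x : R) : f x <= 2 / q * expR (- (q / 2) * x ^+ 2).
  rewrite /f /g; have -> : - q * x ^+ 2 = - (q / 2) * x ^+ 2 - q / 2 * x ^+ 2 by field.
  rewrite expRD mulrCA mulrC ler_pM2r ?expR_gt0// expRN ler_pdivrMr ?expR_gt0//.
  have q2 : 0 <= 2 / q by rewrite divr_ge0// ltW.
  apply: le_trans (ler_wpM2l q2 (expR_ge1Dx _)).
  have -> : 2 / q * (1 + q / 2 * x ^+ 2) = 2 / q + x ^+ 2 by field.
  by rewrite lerDr.
have cf : continuous f.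
  move=> x; apply: cvgM; [exact: exprn_continuous|exact: continuous_gaussian].
have f_ge0 x : 0 <= f x by rewrite mulr_ge0 ?sqr_ge0 ?expR_ge0.
have ig : mu.-integrable setT (EFin \o g) := integrable_gaussian0 q0.
have if_ : mu.-integrable setT (EFin \o f).
  have ib := integrableZl measurableT (2 / q) (integrable_gaussian0 q20).
  apply: (integrable_dominated _ (ib : mu.-integrable setT (EFin \o (fun x =>
    2 / q * expR (- (q / 2) * x ^+ 2))))) => [|x].
    exact: continuous_measurable_fun.
  by rewrite ger0_norm.
have dF (x : R) : is_derive x (1 : R) F (g x - 2 * q * f x).
  by rewrite /F /f /g; apply: is_derive_eq; rewrite /GRing.scale /=; ring.
have i2 : mu.-integrable setT (EFin \o (fun x => 2 * q * f x)).
  exact: (integrableZl measurableT (2 * q) if_).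
have F_0 (u : nat -> R) : (forall n, `|u n| = n%:R) -> F (u n) @[n --> \oo] --> (0 : R).
  move=> un; apply: norm_cvg0.
  pose C := 1 + 2 / q.
  have hC : C * expR (- (q / 2) * n%:R ^+ 2) @[n --> \oo] --> (0 : R).
    rewrite -[X in _ --> X](mulr0 C); apply: cvgM; first exact: cvg_cst.
    exact: cvg_expR_sqr.
  apply: (squeeze_cvgr _ (cvg_cst 0) hC); apply: nearW => n.
  rewrite normr_ge0/= /F normrM (ger0_norm (expR_ge0 _)).
  apply: le_trans (mulr_expR_gaussian_le (u n) q0) _.
  by rewrite -(real_normK (num_real (u n))) un.
have : \int[mu]_x (g x - 2 * q * f x) = 0.
  apply: (integral_derive_eq0 dF).
  - move=> x; apply: cvgB; first exact: continuous_gaussian.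
    by apply: cvgM; [exact: cvg_cst|exact: cf].
  - have := integrableB measurableT ig i2; exact: eq_integrable.
  - by apply: F_0 => n; rewrite normr_nat.
  - by apply: F_0 => n; rewrite normrN normr_nat.
rewrite RintegralB// RintegralZl// integral_gaussian0// => /eqP.
rewrite subr_eq0 => /eqP E.
rewrite (@integral_half_even _ f (Num.sqrt (pi / q) / (2 * q)))//.
- congr EFin; rewrite sqrtrM ?pi_ge0// sqrtrV ?ltW//.
  have {2}<- : Num.sqrt q ^+ 2 = q by rewrite sqr_sqrtr// ltW.
  by field; rewrite gt_eqF// sqrtr_gt0.
- by move=> x; rewrite /f /g /= sqrrN.
- rewrite E mulrC mulKf ?mulf_neq0//.
  by rewrite fineK// integrable_fin_num.
Qed.

(** The dimension 3 enters through pi^2 / 4. *)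
Lemma integral_cube_inv (m : R3 R) (w : R) : 0 < w ->
  (\int[mu3]_x (((norm3 (x - m) ^+ 2 + w ^+ 2) ^+ 3)^-1)%:E =
   (pi ^+ 2 / (4 * w ^+ 3))%:E)%E.
Proof.
move=> w0; have w20 : 0 < w ^+ 2 by rewrite exprn_gt0.
pose Z (x : R3 R) := norm3 (x - m) ^+ 2 + w ^+ 2.
have Z0 x : 0 < Z x by rewrite ltr_wpDl ?sqr_ge0.
pose k (z : R3 R * R) := heaviside z.2 * (z.2 ^+ 5 * expR (- Z z.1 * z.2 ^+ 2)).
have mk : measurable_fun setT k.
  apply: measurable_funM; first exact: (measurableT_comp measurable_heaviside measurable_snd).
  apply: measurable_funM; first exact: measurable_funX.
  apply: (measurableT_comp (f := expR)) => //; apply: measurable_funM.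
    apply: measurable_funN; apply: measurable_funD => //; apply: measurable_funX.
    by apply: measurable_fun_norm3; exact: measurable_fun_subR3.
  exact: measurable_funX.
have k0 z : (0 <= (k z)%:E)%E.
  rewrite lee_fin /k; case: (ltP 0 z.2) => z0; last by rewrite heaviside_le0 ?mul0r.
  by rewrite heaviside_gt0// mul1r mulr_ge0 ?expR_ge0// exprn_ge0// ltW.
transitivity (\int[mu3]_x \int[mu]_s (k (x, s))%:E)%E.
  apply: eq_integral => x _; apply: (etrans (esym (integral_gamma3 (Z0 x)))).
  exact: (esym (integral_heaviside (fun s => s ^+ 5 * expR (- Z x * s ^+ 2)))).
have mkE : measurable_fun setT (fun z => (k z)%:E) by exact/measurable_EFinP.
apply: (etrans (@fubini_tonelli _ _ _ _ R mu3 mu (fun z => (k z)%:E) mkE k0)).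
transitivity (\int[mu]_s ((Num.sqrt pi ^+ 3)%:E *
    (heaviside s * (s ^+ 2 * expR (- w ^+ 2 * s ^+ 2)))%:E))%E.
  apply: eq_integral => s _; rewrite /k /=.
  case: (ltP 0 s) => s0; last first.
    under eq_integral do rewrite heaviside_le0// mul0r.
    by rewrite integral0 heaviside_le0// mul0r mule0.
  have s20 : 0 < s ^+ 2 by rewrite exprn_gt0.
  rewrite heaviside_gt0// mul1r.
  transitivity (\int[mu3]_x ((s ^+ 5 * expR (- w ^+ 2 * s ^+ 2))%:E *
      (expR (- s ^+ 2 * norm3 (x - m) ^+ 2))%:E))%E.
    apply: eq_integral => x _; rewrite -EFinM; congr EFin.
    by rewrite -[RHS]mulrA -expRD ?mul1r /Z; congr (_ * expR _); ring.
  have C0 : 0 <= s ^+ 5 * expR (- w ^+ 2 * s ^+ 2).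
    by rewrite mulr_ge0 ?expR_ge0// exprn_ge0// ltW.
  have mG : measurable_fun setT (fun x : R3 R => (expR (- s ^+ 2 * norm3 (x - m) ^+ 2))%:E).
    by apply/measurable_EFinP; exact: measurable_gaussian3.
  rewrite ge0_integralZl_EFin//.
  rewrite integral_gaussian3// -!EFinM; congr EFin.
  rewrite sqrtrM ?pi_ge0// sqrtrV ?ltW// sqrtr_sqr ger0_norm ?ltW//.
  by field; rewrite gt_eqF.
have C0 : 0 <= Num.sqrt pi ^+ 3 :> R by rewrite exprn_ge0 ?sqrtr_ge0.
have m2 : measurable_fun setT
    (fun s : R => (heaviside s * (s ^+ 2 * expR (- w ^+ 2 * s ^+ 2)))%:E).
  apply/measurable_EFinP; apply: measurable_funM; first exact: measurable_heaviside.
  apply: measurable_funM; first exact: measurable_funX.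
  by apply: continuous_measurable_fun; exact: continuous_gaussian.
rewrite ge0_integralZl_EFin//; last first.
  move=> s _; rewrite lee_fin mulr_ge0 ?heaviside_ge0//.
  by rewrite mulr_ge0 ?sqr_ge0 ?expR_ge0.
rewrite (integral_heaviside (fun s => s ^+ 2 * expR (- w ^+ 2 * s ^+ 2))).
rewrite integral_gamma2// -EFinM; congr EFin.
rewrite sqrtr_sqr ger0_norm ?ltW//.
have -> : pi ^+ 2 / (4 * w ^+ 3) = Num.sqrt pi ^+ 4 / (4 * w ^+ 3).
  by rewrite (exprM _ 2 2) sqr_sqrtr// pi_ge0.
by field; rewrite gt_eqF.
Qed.

End triangle.

(*@P13*)
Section triangle.
Context {R : realType}.
Notation mu := (@lebesgue_measure R).
Notation mu3 := (lebesgue3 R).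

Lemma H3E (eta xi : R3 R) : xi != 0 ->
  H3 eta xi = norm3 xi / pi ^+ 3 * (norm3 eta ^+ 2 * norm3 (xi - eta) ^+ 2)^-1.
Proof.
move=> /norm3_gt0 k0; rewrite /H3 /h3 (invfM (norm3 eta ^+ 2)).
move: (norm3 eta ^+ 2)^-1 (norm3 (xi - eta) ^+ 2)^-1 => a b.
have := @pi_gt0 R; move: (pi : R) => p p0.
by field; rewrite !gt_eqF.
Qed.

Lemma H3_ge0 (eta xi : R3 R) : 0 <= H3 eta xi.
Proof.
by rewrite /H3 /h3 !(mulr_ge0, invr_ge0, exprn_ge0, pi_ge0, norm3_ge0).
Qed.

Lemma integral_two_centers (xi : R3 R) (a b w : R) : xi != 0 -> 0 < a -> 0 < b ->
  0 < w -> a * b = w ^+ 2 ->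
  (\int[mu3]_x (((a * norm3 x ^+ 2 + b * norm3 (xi - x) ^+ 2) ^+ 3)^-1)%:E =
   (pi ^+ 2 / (4 * (w * norm3 xi) ^+ 3))%:E)%E.
Proof.
move=> xi0 a0 b0 w0 abw; have k0 := norm3_gt0 xi0.
have s0 : 0 < a + b by rewrite addr_gt0.
have sn : a + b != 0 by rewrite gt_eqF.
pose m : R3 R := (b / (a + b)) *: xi + 0.
pose v := w * norm3 xi / (a + b).
have v0 : 0 < v by rewrite divr_gt0// mulr_gt0.
have E (x : R3 R) : a * norm3 x ^+ 2 + b * norm3 (xi - x) ^+ 2 =
    (a + b) * (norm3 (x - m) ^+ 2 + v ^+ 2).
  rewrite /v exprMn exprMn -abw /m lineE !norm3_sqr /=; field.
  exact: sn.
transitivity (\int[mu3]_x (((a + b) ^+ 3)^-1%:E *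
    (((norm3 (x - m) ^+ 2 + v ^+ 2) ^+ 3)^-1)%:E))%E.
  by apply: eq_integral => x _; rewrite E -EFinM exprMn invfM.
have pos x : 0 < norm3 (x - m) ^+ 2 + v ^+ 2 by rewrite ltr_wpDl ?sqr_ge0// exprn_gt0.
have c0 : 0 <= ((a + b) ^+ 3)^-1 by rewrite invr_ge0 exprn_ge0// ltW.
have mZ : measurable_fun setT
    (fun x : R3 R => (((norm3 (x - m) ^+ 2 + v ^+ 2) ^+ 3)^-1)%:E).
  apply/measurable_EFinP; apply: measurable_fun_inv; apply: measurable_funX.
  apply: measurable_funD => //; apply: measurable_funX; apply: measurable_fun_norm3.
  exact: measurable_fun_subR3.
rewrite ge0_integralZl_EFin//; last first.
  by move=> x _; rewrite lee_fin invr_ge0 exprn_ge0// ltW.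
rewrite integral_cube_inv// -EFinM; congr EFin; rewrite /v.
have := @pi_gt0 R; move: (pi : R) => p p0.
by field; rewrite sn !gt_eqF.
Qed.

Let unit_ind (u : R) : R := \1_(`]0, 1]%classic : set R) u.

Let unit_ind1 u : 0 < u <= 1 -> unit_ind u = 1.
Proof. by move=> u01; rewrite /unit_ind indicE mem_set//= in_itv. Qed.

Let unit_ind0 u : ~~ (0 < u <= 1) -> unit_ind u = 0.
Proof. by move=> u01; rewrite /unit_ind indicE memNset//= in_itv/=; exact/negP. Qed.

Let integral_unit_ind (f : R -> R) :
  (\int[mu]_u (unit_ind u * f u)%:E = \int[mu]_(u in `]0%R, 1%R]) (f u)%:E)%E.
Proof.
rewrite [RHS]integral_mkcond; apply: eq_integral => u _; rewrite patchE.
have [u01|u01] := boolP (0 < u <= 1).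
  by rewrite unit_ind1// mul1r mem_set//= in_itv/=.
by rewrite unit_ind0// mul0r memNset//= in_itv/=; exact/negP.
Qed.

(** Feynman parameters for 1 / (A (A + B)^2). *)
Let feynman (A B : R) : 0 < A -> 0 <= B ->
  (\int[mu]_(u in `]0%R, 1%R]) (4 * u ^+ 3 * ((A + u ^+ 2 * B) ^+ 3)^-1)%:E =
   ((A * (A + B) ^+ 2)^-1)%:E)%E.
Proof.
move=> A0 B0.
pose f u := 4 * u ^+ 3 * ((A + u ^+ 2 * B) ^+ 3)^-1.
pose F u := u ^+ 4 / (A * (A + u ^+ 2 * B) ^+ 2).
have Z0 (u : R) : A + u ^+ 2 * B != 0 by rewrite gt_eqF// ltr_wpDr// mulr_ge0// sqr_ge0.
have dF (u : R) : is_derive u (1 : R) F (f u).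
  have Z2 : A * (A + u ^+ 2 * B) ^+ 2 != 0 by rewrite mulf_neq0 ?expf_neq0 ?Z0 ?(gt_eqF A0).
  rewrite /F; apply: is_derive_eq; rewrite /f /GRing.scale /=; field.
  by rewrite Z0 gt_eqF.
have cf : continuous f.
  move=> u; apply: differentiable_continuous; apply/derivable1_diffP.
  have Z3 : (A + u ^+ 2 * B) ^+ 3 != 0 by rewrite expf_neq0.
  by rewrite /f; apply: ex_derive.
have cF : continuous F.
  by move=> u; apply: differentiable_continuous; apply/derivable1_diffP.
rewrite integral_itv_obnd_cbnd; last first.
  by apply/measurable_EFinP; apply: measurable_funTS; exact: continuous_measurable_fun.
rewrite -[LHS]/(\int[mu]_(u in `[0%R, 1%R]) (f u)%:E)%E (@continuous_FTC2 _ f F)//.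
- rewrite -EFinB; congr EFin; rewrite /F !expr0n/= mul0r subr0 !expr1n !mul1r.
  by [].
- exact: continuous_subspaceT.
- split.
  + by move=> u _.
  + by apply: cvg_at_right_filter; exact: cF.
  + by apply: cvg_at_left_filter; exact: cF.
- by move=> u _; rewrite derive1E derive_val.
Qed.

Let integral_feynman_le (N1 N2 : R3 R -> R) (c : R) :
  measurable_fun setT N1 -> measurable_fun setT N2 ->
  (forall x, 0 <= N1 x) -> (forall x, 0 <= N2 x) ->
  (forall u : R, 0 < u ->
    (\int[mu3]_x (((N1 x + u ^+ 2 * N2 x) ^+ 3)^-1)%:E = (c / u ^+ 3)%:E)%E) ->
  (\int[mu3]_x ((N1 x * (N1 x + N2 x) ^+ 2)^-1)%:E <= (4 * c)%:E)%E.
Proof.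
move=> mN1 mN2 N1_ge0 N2_ge0 ic.
pose k (z : R3 R * R) :=
  unit_ind z.2 * (4 * z.2 ^+ 3 * ((N1 z.1 + z.2 ^+ 2 * N2 z.1) ^+ 3)^-1).
have mk0 : measurable_fun setT k.
  apply: measurable_funM.
    by apply: (measurableT_comp (measurable_indic _) measurable_snd).
  apply: measurable_funM.
    by apply: measurable_funM => //; exact: measurable_funX.
  apply: measurable_fun_inv; apply: measurable_funX; apply: measurable_funD.
    exact: (measurableT_comp mN1 measurable_fst).
  apply: measurable_funM; first exact: measurable_funX.
  exact: (measurableT_comp mN2 measurable_fst).
have mk : measurable_fun setT (fun z => (k z)%:E) by exact/measurable_EFinP.
have k0 z : (0 <= (k z)%:E)%E.
  rewrite lee_fin /k; have [u01|u01] := boolP (0 < z.2 <= 1); last by rewrite unit_ind0// mul0r.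
  have z0 : 0 <= z.2 by case/andP: u01 => /ltW.
  rewrite unit_ind1// mul1r mulr_ge0 ?mulr_ge0 ?exprn_ge0//.
  by rewrite invr_ge0 exprn_ge0// addr_ge0// mulr_ge0// exprn_ge0.
apply: (@le_trans _ _ (\int[mu3]_x \int[mu]_u (k (x, u))%:E)%E).
  apply: ge0_le_integral => //.
  - by move=> x _; rewrite lee_fin invr_ge0 mulr_ge0// sqr_ge0.
  - apply/measurable_EFinP; apply: measurable_fun_inv; apply: measurable_funM => //.
    by apply: measurable_funX; exact: measurable_funD.
  - exact: (@measurable_fun_fubini_tonelli_F _ _ _ _ R mu (fun z => (k z)%:E) mk k0).
  move=> x _; rewrite /k /= integral_unit_ind.
  have := N1_ge0 x; rewrite le_eqVlt => /predU1P[<-|x0].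
    rewrite mul0r invr0; apply: integral_ge0 => u /=; rewrite in_itv /= => /andP[/ltW u0 _].
    by rewrite lee_fin mulr_ge0 ?invr_ge0 ?mulr_ge0 ?exprn_ge0// addr_ge0// mulr_ge0 ?exprn_ge0.
  by rewrite feynman.
rewrite (@fubini_tonelli _ _ _ _ R mu3 mu (fun z => (k z)%:E) mk k0).
apply: (@le_trans _ _ (\int[mu]_u (unit_ind u * (4 * c))%:E)%E); last first.
  rewrite integral_unit_ind integral_cst//= lebesgue_measure_itv/= lte_fin ltr01.
  by rewrite -EFinB subr0 mule1.
have mU : measurable_fun setT (fun u => unit_ind u * (4 * c)).
  by apply: measurable_funM => //; exact: measurable_indic.
apply: ge0_le_integral => //.
- by move=> u _; apply: integral_ge0.
- exact: (@measurable_fun_fubini_tonelli_G _ _ _ _ R mu3 (fun z => (k z)%:E) mk k0).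
- exact/measurable_EFinP.
move=> u _; rewrite /k /=.
have [u01|u01] := boolP (0 < u <= 1); last first.
  rewrite unit_ind0// mul0r; under eq_integral do rewrite mul0r.
  by rewrite integral0.
have u0 : 0 < u by case/andP: u01.
rewrite unit_ind1//; under eq_integral do rewrite mul1r EFinM.
rewrite ge0_integralZl_EFin//.
- rewrite ic// -EFinM lee_fin mul1r.
  by have -> : 4 * u ^+ 3 * (c / u ^+ 3) = 4 * c by field; rewrite gt_eqF.
- by move=> x _; rewrite lee_fin invr_ge0 exprn_ge0// addr_ge0// mulr_ge0 ?sqr_ge0.
- apply/measurable_EFinP; apply: measurable_fun_inv; apply: measurable_funX.
  by apply: measurable_funD => //; exact: measurable_funM.
- by rewrite mulr_ge0// exprn_ge0// ltW.
Qed.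

Let min_le (A B : R) : 0 <= A -> 0 <= B ->
  (A * B)^-1 * Num.min A^-1 B^-1 <=
  (A * (A + B) ^+ 2)^-1 + (B * (B + A) ^+ 2)^-1 + 4 * ((A + B) ^+ 3)^-1.
Proof.
rewrite le_eqVlt => /predU1P[<- B0|A0].
  by rewrite mul0r invr0 mul0r addr_ge0 ?addr_ge0 ?mulr_ge0 ?invr_ge0 ?mulr_ge0 ?exprn_ge0 ?addr_ge0.
rewrite le_eqVlt => /predU1P[<-|B0].
  rewrite mulr0 invr0 !mul0r addr_ge0 ?addr_ge0 ?mulr_ge0 ?invr_ge0 ?mulr_ge0 ?exprn_ge0 ?addr_ge0//; exact: ltW.
have S0 : 0 < A + B by rewrite addr_gt0.
wlog AB : A B A0 B0 S0 / A <= B.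
  move=> H; have [/H|/ltW/H] := leP A B; first exact.
  rewrite addrC minC (mulrC B) => /(_ B0 A0 S0) /le_trans; apply.
  by rewrite [(A * _)^-1 + _]addrC [A + B]addrC.
have -> : Num.min A^-1 B^-1 = B^-1.
  by apply/min_idPr; rewrite lef_pV2.
have -> : (A * (A + B) ^+ 2)^-1 + (B * (B + A) ^+ 2)^-1 + 4 * ((A + B) ^+ 3)^-1 =
   (A * B)^-1 * B^-1 + (2 * B - (A + B)) * (2 * B + (A + B)) / (B ^+ 2 * (A + B) ^+ 3).
  by field; rewrite !gt_eqF// addrC.
rewrite lerDl divr_ge0 ?mulr_ge0 ?exprn_ge0 ?(ltW B0) ?(ltW S0)//; lra.
Qed.

(** The bound 3 / pi < 1 is what makes the mean lifetimes summable: on average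
    the larger child frequency is at least pi / 3 times its parent's. *)
Lemma integral_H3_min_le (xi : R3 R) : xi != 0 ->
  (\int[mu3]_eta (H3 eta xi *
      Num.min (norm3 eta ^+ 2)^-1 (norm3 (xi - eta) ^+ 2)^-1)%:E <=
   (3 / pi * (norm3 xi ^+ 2)^-1)%:E)%E.
Proof.
move=> xi0; have k0 := norm3_gt0 xi0.
pose A (x : R3 R) := norm3 x ^+ 2; pose B (x : R3 R) := norm3 (xi - x) ^+ 2.
have A0 x : 0 <= A x by exact: sqr_ge0.
have B0 x : 0 <= B x by exact: sqr_ge0.
have mA : measurable_fun setT A by apply: measurable_funX; exact: measurable_norm3.
have mB : measurable_fun setT B.
  by apply: measurable_funX; apply: measurable_fun_norm3; exact: measurable_fun_subR3.
pose cc := pi ^+ 2 / (4 * norm3 xi ^+ 3).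
have I1 := @integral_feynman_le A B cc mA mB A0 B0.
have I2 := @integral_feynman_le B A cc mB mA B0 A0.
have {}I1 : (\int[mu3]_x ((A x * (A x + B x) ^+ 2)^-1)%:E <= (4 * cc)%:E)%E.
  apply: I1 => u u0; under eq_integral do rewrite -[A _]mul1r.
  rewrite (@integral_two_centers xi 1 (u ^+ 2) u) ?exprn_gt0 ?mul1r//.
  by rewrite /cc; congr EFin; field; rewrite !gt_eqF.
have {}I2 : (\int[mu3]_x ((B x * (B x + A x) ^+ 2)^-1)%:E <= (4 * cc)%:E)%E.
  apply: I2 => u u0; under eq_integral do rewrite -[B _]mul1r addrC.
  rewrite (@integral_two_centers xi (u ^+ 2) 1 u) ?exprn_gt0 ?mulr1//.
  by rewrite /cc; congr EFin; field; rewrite !gt_eqF.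
have I3 : (\int[mu3]_x (((A x + B x) ^+ 3)^-1)%:E = cc%:E)%E.
  under eq_integral do rewrite -[A _]mul1r -[B _]mul1r.
  by rewrite (@integral_two_centers xi 1 1 1) ?mul1r ?expr1n//.
pose D x := (A x * (A x + B x) ^+ 2)^-1 + (B x * (B x + A x) ^+ 2)^-1 + 4 * ((A x + B x) ^+ 3)^-1.
have S2 x : 0 <= (A x + B x) by rewrite addr_ge0.
have m1 : measurable_fun setT (fun x => (A x * (A x + B x) ^+ 2)^-1).
  apply: measurable_fun_inv; apply: measurable_funM => //.
  by apply: measurable_funX; exact: measurable_funD.
have m2 : measurable_fun setT (fun x => (B x * (B x + A x) ^+ 2)^-1).
  apply: measurable_fun_inv; apply: measurable_funM => //.
  by apply: measurable_funX; exact: measurable_funD.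
have m3 : measurable_fun setT (fun x => ((A x + B x) ^+ 3)^-1).
  apply: measurable_fun_inv.
  by apply: measurable_funX; exact: measurable_funD.
have p1 x : 0 <= (A x * (A x + B x) ^+ 2)^-1 by rewrite invr_ge0 mulr_ge0 ?sqr_ge0.
have p2 x : 0 <= (B x * (B x + A x) ^+ 2)^-1 by rewrite invr_ge0 mulr_ge0 ?sqr_ge0.
have p3 x : 0 <= ((A x + B x) ^+ 3)^-1 by rewrite invr_ge0 exprn_ge0.
have c0 : 0 <= norm3 xi / pi ^+ 3 by rewrite divr_ge0 ?exprn_ge0 ?pi_ge0 ?norm3_ge0.
have ID : (\int[mu3]_x (D x)%:E <= (4 * cc + 4 * cc + 4 * cc)%:E)%E.
  rewrite /D; under eq_integral do rewrite !EFinD EFinM.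
  rewrite ge0_integralD//; first last.
  - by apply: measurable_funeM; exact/measurable_EFinP.
  - by move=> x _; rewrite -EFinM lee_fin mulr_ge0.
  - by apply: emeasurable_funD; exact/measurable_EFinP.
  - by move=> x _; rewrite -EFinD lee_fin addr_ge0.
  rewrite ge0_integralD//; try (by move=> x _; rewrite lee_fin); try exact/measurable_EFinP.
  rewrite ge0_integralZl_EFin//; try (by move=> x _; rewrite lee_fin); try exact/measurable_EFinP.
  by rewrite I3 !EFinD -EFinM leeD ?leeD.
apply: (@le_trans _ _ (\int[mu3]_x ((norm3 xi / pi ^+ 3)%:E * (D x)%:E))%E).
  apply: ge0_le_integral => //.
  - by move=> x _; rewrite lee_fin mulr_ge0 ?H3_ge0// le_min !invr_ge0 A0 B0.
  - apply/measurable_EFinP; apply: measurable_funM; first exact: measurable_fun_H3.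
    by apply: measurable_minr; apply: measurable_fun_inv.
  - apply: measurable_funeM; apply/measurable_EFinP; apply: measurable_funD.
      exact: measurable_funD.
    exact: measurable_funM.
  move=> x _; rewrite -EFinM lee_fin H3E// -mulrA ler_wpM2l//.
  exact: (min_le (A0 x) (B0 x)).
rewrite ge0_integralZl_EFin//.
- apply: (@le_trans _ _ ((norm3 xi / pi ^+ 3)%:E * (4 * cc + 4 * cc + 4 * cc)%:E)%E).
    by rewrite lee_pmul2l// ?lte_fin ?divr_gt0 ?exprn_gt0 ?pi_gt0.
  rewrite -EFinM lee_fin /cc le_eqVlt; apply/orP; left; apply/eqP.
  have := @pi_gt0 R; move: (pi : R) => p p0.
  by field; rewrite !gt_eqF.
- by move=> x _; rewrite lee_fin !addr_ge0 ?mulr_ge0.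
- apply/measurable_EFinP; apply: measurable_funD.
    exact: measurable_funD.
  exact: measurable_funM.
Qed.

End triangle.

(*@P14*)
Section kernel.
Context {R : realType}.
Notation mu := (@lebesgue_measure R).
Notation mu3 := (lebesgue3 R).

Definition normalized_kernel :=
  forall xi : R3 R, xi != 0 -> (\int[mu3]_eta (H3 eta xi)%:E = 1)%E.

Lemma measurable_point3 (x0 : R3 R) : measurable [set x0].
Proof.
have -> : [set x0] = (fun x => norm3 (x - x0)) @^-1` [set 0].
  apply/seteqP; split=> x /=; first by move=> ->; rewrite subrr norm3_0.
  by move=> /eqP; rewrite norm3_eq0 subr_eq0 => /eqP.
rewrite -[X in measurable X]setTI; apply: measurable_fun_norm3 => //.
exact: measurable_fun_subR3.
Qed.

Lemma ae_neq (x0 : R3 R) : {ae mu3, forall x : R3 R, x != x0}.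
Proof.
exists [set x0]; split; [exact: measurable_point3|exact: lebesgue3_point|].
by move=> x /= /negP; rewrite negbK => /eqP.
Qed.

Lemma H3_eta0 (xi : R3 R) : H3 0 xi = 0.
Proof. by rewrite /H3 /h3 norm3_0 expr0n/= invr0 mulr0 !mul0r. Qed.

Lemma H3_etaxi (xi : R3 R) : H3 xi xi = 0.
Proof. by rewrite /H3 {2}/h3 subrr norm3_0 expr0n/= invr0 !mulr0 mul0r. Qed.

Lemma H3_xi0 (eta : R3 R) : H3 eta 0 = 0.
Proof. by rewrite /H3 norm3_0 mul0r invr0 mulr0. Qed.

Lemma norm3_sub_sqr_le (x y : R3 R) : norm3 (x - y) ^+ 2 <= 2 * (norm3 x ^+ 2 + norm3 y ^+ 2).
Proof.
rewrite !norm3_sqr /=.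
have := sqr_ge0 (x.1.1 + y.1.1); have := sqr_ge0 (x.1.2 + y.1.2).
have := sqr_ge0 (x.2 + y.2); rewrite !expr2; lra.
Qed.

(** The normalisation of H at a frequency of size m controls every weight
    |x|^-2 (|x|^2 + m^2)^-1, since |xi - x|^2 <= 2 (|x|^2 + m^2). *)
Lemma integral_weight_le (m : R) : normalized_kernel -> 0 < m ->
  (\int[mu3]_x ((norm3 x ^+ 2 * (norm3 x ^+ 2 + m ^+ 2))^-1)%:E <=
   (2 * pi ^+ 3 / m)%:E)%E.
Proof.
move=> nH m0; pose xi : R3 R := (m, 0, 0).
have kE : norm3 xi = m by rewrite /norm3 /dot3 /= !mul0r !addr0 -expr2 sqrtr_sqr gtr0_norm.
have xi0 : xi != 0 by rewrite -norm3_eq0 kE gt_eqF.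
have c0 : 0 <= 2 * pi ^+ 3 / m by rewrite divr_ge0 ?mulr_ge0 ?exprn_ge0 ?pi_ge0 ?ltW.
have mH : measurable_fun setT (fun x : R3 R => (H3 x xi)%:E).
  by apply/measurable_EFinP; exact: measurable_fun_H3.
rewrite -[leRHS]mule1 -(nH _ xi0) -ge0_integralZl_EFin//; last first.
  by move=> x _; rewrite lee_fin H3_ge0.
have mn : measurable_fun setT (fun x : R3 R => norm3 x ^+ 2).
  by apply: measurable_funX; exact: measurable_norm3.
apply: ae_ge0_le_integral => //.
- by move=> x _; rewrite lee_fin invr_ge0 mulr_ge0 ?addr_ge0 ?sqr_ge0.
- apply/measurable_EFinP; apply: measurable_fun_inv; apply: measurable_funM => //.
  exact: measurable_funD.
- by move=> x _; rewrite -EFinM lee_fin mulr_ge0 ?H3_ge0.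
- exact: measurable_funeM.
have [N [mN N0 sub]] := ae_neq xi; exists N; split => // x /= nle.
apply: sub => /= xxi; apply: nle => _; rewrite -EFinM lee_fin H3E// kE.
have [->|x0] := eqVneq x 0; first by rewrite norm3_0 expr0n/= !mul0r invr0 !mulr0.
have A0 : 0 < norm3 x ^+ 2 by rewrite exprn_gt0 ?norm3_gt0.
have B0 : 0 < norm3 (xi - x) ^+ 2.
  by rewrite exprn_gt0 ?norm3_gt0// subr_eq0 eq_sym.
have le : norm3 (xi - x) ^+ 2 <= 2 * (norm3 x ^+ 2 + m ^+ 2).
  by rewrite -kE (addrC (norm3 x ^+ 2)) norm3_sub_sqr_le.
move: (norm3 x ^+ 2) (norm3 (xi - x) ^+ 2) A0 B0 le => A B A0 B0 le.
have -> : 2 * pi ^+ 3 / m * (m / pi ^+ 3 * (A * B)^-1) = 2 * (A * B)^-1 :> R.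
  have := @pi_gt0 R; move: (pi : R) => p p0.
  by field; rewrite !gt_eqF.
have m20 : 0 < A + m ^+ 2 by rewrite addr_gt0 ?exprn_gt0.
rewrite !invfM mulrCA ler_pM2l ?invr_gt0//.
rewrite -(ler_pM2l m20) -(ler_pM2r B0) divff ?gt_eqF// mul1r.
by rewrite -!mulrA mulVf ?gt_eqF// mulr1 mulrC.
Qed.

Lemma integrable_weight : normalized_kernel ->
  mu3.-integrable setT
    (EFin \o (fun x => (norm3 x ^+ 2 * (1 + norm3 x ^+ 2))^-1)).
Proof.
move=> nH; apply/integrableP; split.
  apply/measurable_EFinP; apply: measurable_fun_inv.
  have mn : measurable_fun setT (fun x : R3 R => norm3 x ^+ 2).
    by apply: measurable_funX; exact: measurable_norm3.
  by apply: measurable_funM => //; exact: measurable_funD.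
apply: le_lt_trans (ltry (2 * pi ^+ 3 / 1)).
apply: le_trans (integral_weight_le nH ltr01); rewrite le_eqVlt; apply/orP; left; apply/eqP.
apply: eq_integral => x _ /=; rewrite expr1n addrC ger0_norm//.
by rewrite invr_ge0 mulr_ge0 ?addr_ge0 ?sqr_ge0.
Qed.

Lemma integral_H3_le1 (xi : R3 R) : normalized_kernel ->
  (\int[mu3]_eta (H3 eta xi)%:E <= 1)%E.
Proof.
move=> nH; have [->|/nH -> //] := eqVneq xi 0.
by under eq_integral do rewrite H3_xi0; rewrite integral0.
Qed.

Lemma measurable_exponential_pdf2 d (T : measurableType d) (f g : T -> R) :
  measurable_fun setT f -> measurable_fun setT g ->
  measurable_fun setT (fun x => exponential_pdf (f x) (g x)).
Proof.
move=> mf mg.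
have -> : (fun x => exponential_pdf (f x) (g x)) =
    (fun x => \1_(`[0, +oo[%classic : set R) (g x) * (f x * expR (- f x * g x))).
  apply/funext => x; rewrite indicE.
  have [x0|x0] := leP 0 (g x).
    by rewrite exponential_pdfE// mem_set ?mul1r//= in_itv/= x0.
  by rewrite lt0_exponential_pdf// memNset ?mul0r//= in_itv/= andbT; apply/negP; rewrite -ltNge.
apply: measurable_funM; first exact: (measurableT_comp (measurable_indic _) mg).
apply: measurable_funM => //; apply: (measurableT_comp (f := expR)) => //.
by apply: measurable_funM => //; exact: measurable_funN.
Qed.

Lemma exponential_pdf0 (u : R) : exponential_pdf 0 u = 0.
Proof.
have [u0|u0] := leP 0 u; last by rewrite lt0_exponential_pdf.
by rewrite exponential_pdfE// mul0r.
Qed.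

Lemma integral_exponential_pdf_le1 (r : R) : 0 <= r ->
  (\int[mu]_u (exponential_pdf r u)%:E <= 1)%E.
Proof.
rewrite le_eqVlt => /predU1P[<-|r0]; last by rewrite integral_exponential_pdf.
by under eq_integral do rewrite exponential_pdf0; rewrite integral0.
Qed.

Lemma mulr_exponential_pdf_le (r u : R) : 0 < r ->
  u * exponential_pdf r u <= 4 / r * exponential_pdf (r / 2) u.
Proof.
move=> r0; have rn : r != 0 by rewrite gt_eqF.
have [u0|u0] := leP 0 u; last by rewrite !lt0_exponential_pdf// !mulr0.
rewrite !exponential_pdfE//.
have -> : 4 / r * (r / 2 * expR (- (r / 2) * u)) = 2 * expR (- (r / 2) * u) by field.
have -> : - r * u = - (r / 2) * u - r / 2 * u by field.
rewrite expRD !mulrA (mulrAC (u * r)) ler_pM2r ?expR_gt0//.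
rewrite expRN ler_pdivrMr ?expR_gt0//.
have := expR_ge1Dx (r / 2 * u); lra.
Qed.

End kernel.

(*@P15*)
Section survival.
Context {R : realType}.
Notation mu := (@lebesgue_measure R).
Notation mu3 := (lebesgue3 R).
Local Open Scope ereal_scope.
Implicit Types q g : R3 R * R -> \bar R.

Definition branching q (z : R3 R * R) : \bar R :=
  \int[mu3]_eta ((H3 eta z.1)%:E * (q (eta, z.2) * q (z.1 - eta, z.2)%R)).

Definition renewal g (z : R3 R * R) : \bar R :=
  \int[mu]_u ((exponential_pdf (norm3 z.1 ^+ 2) u)%:E * g (z.1, z.2 - u)%R).

Fixpoint survival (n : nat) : R3 R * R -> \bar R :=
  if n is n'.+1 then renewal (branching (survival n'))
  else fun z => ((z.2 < 0)%R%:R)%:E.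

Lemma branching_ge0 q : (forall z, 0 <= q z) -> forall z, 0 <= branching q z.
Proof.
move=> q0 z; apply: integral_ge0 => eta _.
by rewrite mule_ge0 ?mule_ge0 ?lee_fin ?H3_ge0.
Qed.

Lemma renewal_ge0 g : (forall z, 0 <= g z) -> forall z, 0 <= renewal g z.
Proof.
move=> g0 z; apply: integral_ge0 => u _.
by rewrite mule_ge0// lee_fin exponential_pdf_ge0 ?sqr_ge0.
Qed.

Lemma measurable_branching_integrand q : measurable_fun setT q ->
  measurable_fun setT (fun y : (R3 R * R) * R3 R =>
    (H3 y.2 y.1.1)%:E * (q (y.2, y.1.2) * q (y.1.1 - y.2, y.1.2)%R)).
Proof.
move=> mq.
have m11 : measurable_fun setT (fun y : (R3 R * R) * R3 R => y.1.1).
  exact: (measurableT_comp measurable_fst measurable_fst).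
have m12 : measurable_fun setT (fun y : (R3 R * R) * R3 R => y.1.2).
  exact: (measurableT_comp measurable_snd measurable_fst).
apply: emeasurable_funM.
  by apply/measurable_EFinP; apply: measurable_fun_H3.
apply: emeasurable_funM; apply: (measurableT_comp mq).
  by apply: measurable_fun_pair.
by apply: measurable_fun_pair => //=; exact: measurable_fun_subR3.
Qed.

Lemma measurable_branching q : (forall z, 0 <= q z) -> measurable_fun setT q ->
  measurable_fun setT (branching q).
Proof.
move=> q0 mq.
apply: (@measurable_fun_fubini_tonelli_F _ _ _ _ R mu3
  (fun y : (R3 R * R) * R3 R =>
    (H3 y.2 y.1.1)%:E * (q (y.2, y.1.2) * q (y.1.1 - y.2, y.1.2)%R))).
  exact: measurable_branching_integrand.
by move=> y; rewrite mule_ge0 ?mule_ge0 ?lee_fin ?H3_ge0.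
Qed.

Lemma measurable_renewal_integrand g : measurable_fun setT g ->
  measurable_fun setT (fun y : (R3 R * R) * R =>
    (exponential_pdf (norm3 y.1.1 ^+ 2) y.2)%:E * g (y.1.1, y.1.2 - y.2)%R).
Proof.
move=> mg.
have m11 : measurable_fun setT (fun y : (R3 R * R) * R => y.1.1).
  exact: (measurableT_comp measurable_fst measurable_fst).
have m12 : measurable_fun setT (fun y : (R3 R * R) * R => y.1.2).
  exact: (measurableT_comp measurable_snd measurable_fst).
apply: emeasurable_funM.
  apply/measurable_EFinP; apply: measurable_exponential_pdf2 => //.
  by apply: measurable_funX; exact: measurable_fun_norm3.
apply: (measurableT_comp mg); apply: measurable_fun_pair => //=.
exact: measurable_funB.
Qed.

Lemma measurable_renewal g : (forall z, 0 <= g z) -> measurable_fun setT g ->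
  measurable_fun setT (renewal g).
Proof.
move=> g0 mg.
apply: (@measurable_fun_fubini_tonelli_F _ _ _ _ R mu
  (fun y : (R3 R * R) * R =>
    (exponential_pdf (norm3 y.1.1 ^+ 2) y.2)%:E * g (y.1.1, y.1.2 - y.2)%R)).
  exact: measurable_renewal_integrand.
by move=> y; rewrite mule_ge0// lee_fin exponential_pdf_ge0 ?sqr_ge0.
Qed.

Lemma survival_ge0 n z : 0 <= survival n z.
Proof.
elim: n z => [|n IH] z /=; first by rewrite lee_fin.
exact/renewal_ge0/branching_ge0.
Qed.

Lemma measurable_survival n : measurable_fun setT (survival n).
Proof.
elim: n => [|n IH] /=.
  apply/measurable_EFinP.
  have -> : (fun z : R3 R * R => ((z.2 < 0)%R%:R : R)) =
      \1_(`]-oo, 0%R[%classic : set R) \o snd.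
    apply/funext => z /=; rewrite indicE.
    have [z0|z0] := ltP z.2 0%R; first by rewrite mem_set//= in_itv.
    by rewrite memNset//= in_itv/=; apply/negP; rewrite -leNgt.
  by apply: (measurableT_comp (measurable_indic _) measurable_snd).
apply: measurable_renewal; first exact/branching_ge0/survival_ge0.
apply: measurable_branching => //; exact: survival_ge0.
Qed.

(** sections, with the variables in the order of the integrals above *)
Lemma measurable_branching_section q (xi : R3 R) (s : R) : measurable_fun setT q ->
  measurable_fun setT
    (fun eta : R3 R => (H3 eta xi)%:E * (q (eta, s) * q (xi - eta, s)%R)).
Proof.
move=> /measurable_branching_integrand m.
exact: (measurableT_comp m (pair1_measurable (xi, s))).
Qed.

Lemma measurable_renewal_section g (xi : R3 R) (t : R) : measurable_fun setT g ->
  measurable_fun setT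
    (fun u : R => (exponential_pdf (norm3 xi ^+ 2) u)%:E * g (xi, t - u)%R).
Proof.
move=> /measurable_renewal_integrand m.
exact: (measurableT_comp m (pair1_measurable (xi, t))).
Qed.

Lemma measurable_exponential_pdf_cst (r : R) :
  measurable_fun setT (fun u : R => (exponential_pdf r u)%:E).
Proof. apply/measurable_EFinP; exact: measurable_exponential_pdf2. Qed.

Section bounds.
Context (nH : @normalized_kernel R).

Lemma branching_le q r (xi : R3 R) (s : R) (f : R3 R -> R) :
  (forall z, 0 <= q z) -> measurable_fun setT q -> measurable_fun setT f ->
  (forall eta, 0 <= f eta)%R ->
  (forall eta, eta != 0%R -> (xi - eta)%R != 0%R ->
     q (eta, s) * q (xi - eta, s)%R <= (f eta)%:E) ->
  \int[mu3]_eta (H3 eta xi * f eta)%:E <= r ->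
  branching q (xi, s) <= r.
Proof.
move=> q0 mq mf f0 qf; apply: le_trans; apply: ge0_le_integral => //.
- by move=> eta _; rewrite mule_ge0 ?mule_ge0 ?lee_fin ?H3_ge0.
- exact: measurable_branching_section.
- by apply/measurable_EFinP; apply: measurable_funM => //; exact: measurable_fun_H3.
move=> eta _ /=.
have [->|e0] := eqVneq eta 0%R; first by rewrite H3_eta0 mul0e mul0r.
have [/eqP|ex] := eqVneq (xi - eta)%R 0%R.
  by rewrite subr_eq0 => /eqP <-; rewrite H3_etaxi mul0e mul0r.
by rewrite (EFinM (H3 eta xi)); apply: lee_wpmul2l; [rewrite lee_fin H3_ge0|exact: qf].
Qed.

Lemma branching_le1 q z : (forall z, 0 <= q z) -> measurable_fun setT q ->
  (forall z, q z <= 1) -> branching q z <= 1.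
Proof.
move=> q0 mq q1; case: z => xi s; apply: (@branching_le q _ xi s (fun=> 1%R)) => //.
  by move=> eta _ _; rewrite -[leRHS]mule1; apply: lee_pmul.
by under eq_integral do rewrite mulr1; exact: integral_H3_le1.
Qed.

Lemma renewal_le1 g z : (forall z, 0 <= g z) -> measurable_fun setT g ->
  (forall z, g z <= 1) -> renewal g z <= 1.
Proof.
move=> g0 mg g1; apply: le_trans (integral_exponential_pdf_le1 (sqr_ge0 (norm3 z.1))).
have p0 u := exponential_pdf_ge0 (sqr_ge0 (norm3 z.1)) u.
apply: ge0_le_integral => //.
- by move=> u _; rewrite mule_ge0// lee_fin.
- exact: measurable_renewal_section.
- exact: measurable_exponential_pdf_cst.
- by move=> u _; rewrite -[leRHS]mule1; apply: lee_wpmul2l; rewrite ?lee_fin.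
Qed.

Lemma survival_le1 n z : survival n z <= 1.
Proof.
elim: n z => [|n IH] z /=; first by rewrite lee_fin; case: (_ < _)%R.
have q0 := survival_ge0 n; have mq := measurable_survival n.
apply: renewal_le1 => [||{}z]; first exact: branching_ge0.
  exact: measurable_branching.
exact: branching_le1.
Qed.

Lemma branching_lt0 q (xi : R3 R) (s : R) : xi != 0%R ->
  (forall eta, eta != 0%R -> q (eta, s) = 1) -> branching q (xi, s) = 1.
Proof.
move=> xi0 q1; rewrite -(nH xi0); apply: eq_integral => eta _ /=.
have [->|e0] := eqVneq eta 0%R; first by rewrite H3_eta0 mul0e.
have [/eqP|ex] := eqVneq (xi - eta)%R 0%R.
  by rewrite subr_eq0 => /eqP <-; rewrite H3_etaxi mul0e.
by rewrite !q1// !mule1.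
Qed.

Lemma survival_lt0 n (xi : R3 R) (s : R) : xi != 0%R -> (s < 0)%R ->
  survival n (xi, s) = 1.
Proof.
elim: n xi s => [|n IH] xi s xi0 s0 /=; first by rewrite s0.
rewrite /renewal /=.
transitivity (\int[mu]_u (exponential_pdf (norm3 xi ^+ 2) u)%:E); last first.
  by rewrite integral_exponential_pdf// exprn_gt0 ?norm3_gt0.
apply: eq_integral => u _; have [u0|u0] := leP 0%R u; last first.
  by rewrite lt0_exponential_pdf// mul0e.
rewrite branching_lt0 ?mule1// => eta e0; apply: IH => //.
by rewrite (le_lt_trans _ s0)// gerBl.
Qed.

(** Monotonicity holds off the zero frequency, which H does not charge. *)
Lemma le_branching q1 q2 (xi : R3 R) (s : R) :
  (forall z, 0 <= q1 z) -> measurable_fun setT q1 ->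
  (forall z, 0 <= q2 z) -> measurable_fun setT q2 ->
  (forall eta, eta != 0%R -> q1 (eta, s) <= q2 (eta, s)) ->
  branching q1 (xi, s) <= branching q2 (xi, s).
Proof.
move=> p1 m1 p2 m2 q12; apply: ge0_le_integral => //.
- by move=> eta _; rewrite mule_ge0 ?mule_ge0 ?lee_fin ?H3_ge0.
- exact: measurable_branching_section.
- exact: measurable_branching_section.
move=> eta _ /=.
have [->|e0] := eqVneq eta 0%R; first by rewrite H3_eta0 !mul0e.
have [/eqP|ex] := eqVneq (xi - eta)%R 0%R.
  by rewrite subr_eq0 => /eqP <-; rewrite H3_etaxi !mul0e.
by apply: lee_wpmul2l; [rewrite lee_fin H3_ge0|apply: lee_pmul => //; exact: q12].
Qed.

Lemma le_survival n (xi : R3 R) (t : R) : xi != 0%R ->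
  survival n (xi, t) <= survival n.+1 (xi, t).
Proof.
elim: n xi t => [|n IH] xi t xi0.
  have [t0|t0] := ltP t 0%R; first by rewrite !survival_lt0.
  by rewrite /survival ltNge t0 /=; exact: (survival_ge0 1).
have p0 u := exponential_pdf_ge0 (sqr_ge0 (norm3 xi)) u.
have q0 m := survival_ge0 m; have mq m := measurable_survival m.
apply: ge0_le_integral => //.
- by move=> u _; rewrite mule_ge0 ?lee_fin//; exact: branching_ge0.
- by apply: measurable_renewal_section; exact: (measurable_branching (q0 n) (mq n)).
- by apply: measurable_renewal_section; exact: (measurable_branching (q0 n.+1) (mq n.+1)).
move=> u _; apply: lee_wpmul2l; first by rewrite lee_fin.
exact: (@le_branching _ _ xi (t - u)%R (q0 n) (mq n) (q0 n.+1) (mq n.+1)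
  (fun eta e0 => IH eta (t - u)%R e0)).
Qed.

End bounds.
End survival.

(*@P16*)
Section decay.
Context {R : realType} (nH : @normalized_kernel R).
Notation mu := (@lebesgue_measure R).
Notation mu3 := (lebesgue3 R).
Local Open Scope ereal_scope.
Implicit Types q g : R3 R * R -> \bar R.

Let kappa : R := (3 / pi)%R.

Let kappa_ge0 : (0 <= kappa)%R.
Proof. by rewrite divr_ge0 ?pi_ge0. Qed.

Let kappa_lt1 : (kappa < 1)%R.
Proof. by rewrite ltr_pdivrMr ?pi_gt0// mul1r pi_gt3. Qed.

Lemma branching_decay q (C s : R) (xi : R3 R) : (0 < C)%R -> (0 < s)%R ->
  (forall z, 0 <= q z) -> measurable_fun setT q -> (forall z, q z <= 1) ->
  (forall eta, eta != 0%R -> q (eta, s) <= (C / (norm3 eta ^+ 2 * s))%:E) ->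
  xi != 0%R -> branching q (xi, s) <= (C * (3 / pi) / (norm3 xi ^+ 2 * s))%:E.
Proof.
move=> C0 s0 q0 mq q1 qC xi0.
pose f eta := (C / s * Num.min (norm3 eta ^+ 2)^-1 (norm3 (xi - eta) ^+ 2)^-1)%R.
have Cs0 : (0 <= C / s)%R by rewrite divr_ge0// ltW.
have min0 eta : (0 <= Num.min (norm3 eta ^+ 2)^-1 (norm3 (xi - eta) ^+ 2)^-1)%R.
  by rewrite le_min !invr_ge0 !sqr_ge0.
have mmin : measurable_fun setT
    (fun eta => Num.min (norm3 eta ^+ 2)^-1 (norm3 (xi - eta) ^+ 2)^-1)%R.
  apply: measurable_minr; apply: measurable_fun_inv; apply: measurable_funX.
    exact: measurable_norm3.
  by apply: measurable_fun_norm3; exact: measurable_fun_subR3.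
apply: (@branching_le _ q _ xi s f) => //.
- exact: measurable_funM.
- by move=> eta; exact: mulr_ge0.
- move=> eta e0 ex; rewrite /f minr_pMr// EFin_min le_min; apply/andP; split.
    rewrite -[(C / s / _)%R]mulrA -invfM mulrC [(s * _)%R]mulrC mulrC.
    by rewrite -[leRHS]mule1; apply: lee_pmul => //; exact: qC.
  rewrite -[(C / s / _)%R]mulrA -invfM [(s * _)%R]mulrC.
  by rewrite -[leRHS]mul1e; apply: lee_pmul => //; exact: qC.
rewrite /f; under eq_integral do rewrite mulrCA EFinM.
rewrite ge0_integralZl_EFin//.
- apply: (@le_trans _ _ ((C / s)%:E * (3 / pi * (norm3 xi ^+ 2)^-1)%:E)).
    by apply: lee_wpmul2l; [rewrite lee_fin|exact: integral_H3_min_le].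
  rewrite -EFinM lee_fin le_eqVlt; apply/orP; left; apply/eqP.
  have k0 := norm3_gt0 xi0; have := @pi_gt0 R; move: (pi : R) => p p0.
  by field; rewrite !gt_eqF.
- by move=> eta _; rewrite lee_fin mulr_ge0 ?H3_ge0.
- by apply/measurable_EFinP; apply: measurable_funM => //; exact: measurable_fun_H3.
Qed.

Lemma renewal_decay g (D th t : R) (xi : R3 R) : xi != 0%R -> (0 <= D)%R ->
  (0 < th)%R -> (th < 1)%R -> (0 < t)%R ->
  (forall z, 0 <= g z) -> measurable_fun setT g -> (forall z, g z <= 1) ->
  (forall s, (0 < s)%R -> g (xi, s) <= (D / (norm3 xi ^+ 2 * s))%:E) ->
  renewal g (xi, t) <= ((4 / th + D / (1 - th)) / (norm3 xi ^+ 2 * t))%:E.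
Proof.
move=> xi0 D0 th0 th1 t0 g0 mg g1 gD.
have : (0 < norm3 xi ^+ 2)%R by rewrite exprn_gt0 ?norm3_gt0.
rewrite /renewal /=; move: (norm3 xi ^+ 2)%R gD => r gD r0.
have rn : r != 0%R by rewrite gt_eqF.
have th'0 : (0 < 1 - th)%R by rewrite subr_gt0.
pose a := (4 / (r * th * t))%R; pose b := (D / (r * (1 - th) * t))%R.
have a0 : (0 <= a)%R by rewrite divr_ge0 ?mulr_ge0 ?(ltW r0) ?(ltW th0) ?(ltW t0).
have b0 : (0 <= b)%R by rewrite divr_ge0 ?mulr_ge0 ?(ltW r0) ?(ltW th'0) ?(ltW t0).
have r20 : (0 < r / 2)%R by rewrite divr_gt0.
have p0 u := exponential_pdf_ge0 (ltW r0) u.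
have p20 u := exponential_pdf_ge0 (ltW r20) u.
have mp := measurable_exponential_pdf_cst r.
have mp2 := measurable_exponential_pdf_cst (r / 2).
apply: (@le_trans _ _ (\int[mu]_u (a%:E * (exponential_pdf (r / 2) u)%:E +
                                   b%:E * (exponential_pdf r u)%:E))).
  apply: ge0_le_integral => //.
  - by move=> u _; rewrite mule_ge0 ?lee_fin.
  - apply: emeasurable_funM => //; apply: (measurableT_comp mg).
    by apply: measurable_fun_pair => //; exact: measurable_funB.
  - by apply: emeasurable_funD; apply: measurable_funeM.
  move=> u _; have [u0|u0] := leP 0%R u; last first.
    by rewrite !lt0_exponential_pdf// mul0e !mule0 adde0.
  have [ut|ut] := leP (th * t)%R u.
    apply: (@le_trans _ _ (exponential_pdf r u)%:E).
      by rewrite -[leRHS]mule1; apply: lee_wpmul2l; rewrite ?lee_fin.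
    rewrite -!EFinM -EFinD lee_fin.
    apply: (@le_trans _ _ (a * exponential_pdf (r / 2) u)%R); last first.
      by rewrite lerDl mulr_ge0.
    have tht : (0 < th * t)%R by rewrite mulr_gt0.
    have -> : a = (4 / r / (th * t))%R.
      by rewrite /a; field; rewrite rn !gt_eqF.
    rewrite mulrAC ler_pdivlMr//.
    apply: le_trans (mulr_exponential_pdf_le u r0).
    by rewrite mulrC ler_wpM2r.
  have st : ((1 - th) * t < t - u)%R by rewrite mulrBl mul1r ltrD2l ltrN2.
  have tu : (0 < t - u)%R by apply: lt_trans st; rewrite mulr_gt0.
  apply: (@le_trans _ _ (b%:E * (exponential_pdf r u)%:E)); last first.
    by rewrite leeDr// -EFinM lee_fin mulr_ge0.
  rewrite muleC; apply: lee_wpmul2r; first by rewrite lee_fin.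
  apply: le_trans (gD _ tu) _; rewrite lee_fin /b ler_wpM2l//.
  rewrite lef_pV2 ?posrE ?mulr_gt0// -mulrA ler_wpM2l ?(ltW r0)//.
  exact: ltW.
rewrite ge0_integralD//; try (by apply: measurable_funeM);
  try (by move=> u _; rewrite -EFinM lee_fin mulr_ge0).
rewrite !ge0_integralZl_EFin//; try (by move=> u _; rewrite lee_fin).
rewrite !integral_exponential_pdf// !mule1 -EFinD lee_fin /a /b.
rewrite le_eqVlt; apply/orP; left; apply/eqP.
by field; rewrite rn !gt_eqF.
Qed.

Definition decay_constant : R := (8 * (1 + kappa) / (1 - kappa) ^+ 2)%R.

Lemma decay_constant_gt0 : (0 < decay_constant)%R.
Proof.
rewrite divr_gt0// ?exprn_gt0 ?subr_gt0// mulr_gt0//.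
by rewrite ltr_wpDr.
Qed.

(** C is the fixed point of C |-> 4 / th + C kappa / (1 - th) for
    th = (1 - kappa) / 2, a contraction because kappa < 1 - th. *)
Lemma survival_decay n (xi : R3 R) (t : R) : xi != 0%R -> (0 < t)%R ->
  survival n (xi, t) <= (decay_constant / (norm3 xi ^+ 2 * t))%:E.
Proof.
have C0 := decay_constant_gt0.
elim: n xi t => [|n IH] xi t xi0 t0.
  rewrite /= ltNge (ltW t0) /= lee_fin divr_ge0 ?(ltW C0)//.
  by rewrite mulr_ge0 ?sqr_ge0 ?(ltW t0).
have q0 := @survival_ge0 R n; have mq := @measurable_survival R n.
have q1 := survival_le1 nH n.
pose th := ((1 - kappa) / 2)%R.
have k1 : (0 < 1 - kappa)%R by rewrite subr_gt0.
have th0 : (0 < th)%R by rewrite divr_gt0.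
have th1 : (th < 1)%R by rewrite /th; move: kappa_ge0; lra.
have CE : decay_constant = (4 / th + decay_constant * kappa / (1 - th))%R.
  rewrite /th /decay_constant; move: kappa k1 kappa_ge0 => k k1 k0.
  have hk : (1 + k != 0)%R by rewrite gt_eqF// ltr_wpDr.
  have hk' : (2 - (1 - k) != 0)%R by have -> : (2 - (1 - k) = 1 + k)%R by ring.
  by field; rewrite hk' gt_eqF.
rewrite {}CE.
apply: (@renewal_decay (branching (survival n)) (decay_constant * kappa) th t xi) => //.
- by rewrite mulr_ge0// ltW.
- exact: branching_ge0.
- exact: measurable_branching.
- by move=> z; exact: branching_le1.
- move=> s s0; apply: branching_decay => // eta e0; exact: IH.
Qed.

End decay.

(*@P17*)
Section limit.
Context {R : realType} (nH : @normalized_kernel R).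
Notation mu := (@lebesgue_measure R).
Notation mu3 := (lebesgue3 R).
Local Open Scope ereal_scope.
Implicit Types q g : R3 R * R -> \bar R.

Lemma renewal_xi0 g (t : R) : renewal g (0%R, t) = 0.
Proof.
rewrite /renewal /= norm3_0 expr0n/=.
by under eq_integral do rewrite exponential_pdf0 mul0e; rewrite integral0.
Qed.

Definition extinction (z : R3 R * R) : \bar R :=
  ereal_sup (range (fun n => survival n.+1 z)).

Lemma nondecreasing_survival (z : R3 R * R) :
  {homo (fun n => survival n.+1 z) : n m / (n <= m)%N >-> n <= m}.
Proof.
apply/nondecreasing_seqP => n; case: z => xi t.
have [->|xi0] := eqVneq xi 0%R; last exact: le_survival.
by rewrite -[survival n.+1 _]/(renewal _ _) -[survival n.+2 _]/(renewal _ _) !renewal_xi0.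
Qed.

Lemma cvg_survival z : survival n.+1 z @[n --> \oo] --> extinction z.
Proof. exact: ereal_nondecreasing_cvgn (nondecreasing_survival z). Qed.

Lemma measurable_extinction : measurable_fun setT extinction.
Proof.
apply: (emeasurable_fun_cvg (fun n => survival n.+1)) => [n|z _].
  exact: (@measurable_survival R n.+1).
exact: cvg_survival.
Qed.

Lemma extinction_ge0 z : 0 <= extinction z.
Proof.
apply: le_trans (ereal_sup_ubound _); first exact: (@survival_ge0 R 1).
by exists 0%N.
Qed.

Lemma extinction_le z x : (forall n, survival n.+1 z <= x) -> extinction z <= x.
Proof. by move=> h; apply: ge_ereal_sup => _ [n _ <-]. Qed.

Lemma extinction_le1 z : extinction z <= 1.
Proof. apply: extinction_le => n; exact: survival_le1. Qed.

Lemma extinction_decay (xi : R3 R) (t : R) : xi != 0%R -> (0 < t)%R ->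
  extinction (xi, t) <= (@decay_constant R / (norm3 xi ^+ 2 * t))%:E.
Proof. by move=> xi0 t0; apply: extinction_le => n; exact: survival_decay. Qed.

Lemma extinction_lt0 (xi : R3 R) (s : R) : xi != 0%R -> (s < 0)%R ->
  extinction (xi, s) = 1.
Proof.
move=> xi0 s0; apply/eqP; rewrite eq_le extinction_le1/=.
rewrite -(survival_lt0 nH 1 xi0 s0); apply: ereal_sup_ubound; by exists 0%N.
Qed.

Let fin_num01 (x : \bar R) : 0 <= x -> x <= 1 -> x \is a fin_num.
Proof. by move=> x0 x1; rewrite ge0_fin_numE// (le_lt_trans x1)// ltry. Qed.

Lemma cvg_branching (q : nat -> R3 R * R -> \bar R) (r : R3 R * R -> \bar R) z :
  (forall n z, 0 <= q n z) -> (forall n z, q n z <= 1) ->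
  (forall n, measurable_fun setT (q n)) ->
  (forall z, {homo q^~ z : n m / (n <= m)%N >-> n <= m}) ->
  (forall z, q n z @[n --> \oo] --> r z) -> (forall z, 0 <= r z <= 1) ->
  branching (q n) z @[n --> \oo] --> branching r z.
Proof.
move=> q0 q1 mq ndq qr r01.
pose f n (eta : R3 R) := (H3 eta z.1)%:E * (q n (eta, z.2) * q n (z.1 - eta, z.2)%R).
have fE : branching r z = \int[mu3]_eta limn (f ^~ eta).
  apply: eq_integral => eta _; apply/esym/cvg_lim => //.
  have fr w : r w \is a fin_num by apply: fin_num01; case/andP: (r01 w).
  have frr w w' : r w * r w' \is a fin_num by rewrite fin_numM.
  apply: cvgeM; [exact: mule_def_fin|exact: cvg_cst|].
  apply: cvgeM; [exact: mule_def_fin|exact: qr|exact: qr].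
rewrite fE; apply: (@cvg_monotone_convergence _ _ _ mu3 _ measurableT f) => //.
- by move=> n; exact: measurable_branching_section.
- by move=> n eta _; rewrite mule_ge0 ?mule_ge0 ?lee_fin ?H3_ge0.
- move=> eta _ n m nm; apply: lee_wpmul2l; first by rewrite lee_fin H3_ge0.
  by apply: lee_pmul => //; exact: ndq.
Qed.

Lemma cvg_renewal (g : nat -> R3 R * R -> \bar R) (r : R3 R * R -> \bar R) z :
  (forall n z, 0 <= g n z) -> (forall n, measurable_fun setT (g n)) ->
  (forall z, {homo g^~ z : n m / (n <= m)%N >-> n <= m}) ->
  (forall z, g n z @[n --> \oo] --> r z) -> (forall z, 0 <= r z <= 1) ->
  renewal (g n) z @[n --> \oo] --> renewal r z.
Proof.
move=> g0 mg ndg gr r01.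
pose f n (u : R) := (exponential_pdf (norm3 z.1 ^+ 2) u)%:E * g n (z.1, z.2 - u)%R.
have p0 u := exponential_pdf_ge0 (sqr_ge0 (norm3 z.1)) u.
have fE : renewal r z = \int[mu]_u limn (f ^~ u).
  apply: eq_integral => u _; apply/esym/cvg_lim => //.
  have fr w : r w \is a fin_num by apply: fin_num01; case/andP: (r01 w).
  by apply: cvgeM; [exact: mule_def_fin|exact: cvg_cst|exact: gr].
rewrite fE; apply: (@cvg_monotone_convergence _ _ _ mu _ measurableT f) => //.
- by move=> n; exact: measurable_renewal_section.
- by move=> n u _; rewrite mule_ge0 ?lee_fin.
- move=> u _ n m nm; apply: lee_wpmul2l; first by rewrite lee_fin.
  exact: ndg.
Qed.

Lemma extinction_renewal z : extinction z = renewal (branching extinction) z.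
Proof.
have q0 n := @survival_ge0 R n.+1; have mq n := @measurable_survival R n.+1.
have q1 n := survival_le1 nH n.+1.
have e01 w : 0 <= extinction w <= 1 by rewrite extinction_ge0 extinction_le1.
have h1 : survival n.+2 z @[n --> \oo] --> extinction z.
  rewrite (cvg_shiftS (fun n => survival n.+1 z)); exact: cvg_survival.
have h2 : renewal (branching (survival n.+1)) z @[n --> \oo] -->
    renewal (branching extinction) z.
  apply: cvg_renewal.
  - by move=> n w; exact: (branching_ge0 (q0 n)).
  - by move=> n; exact: (measurable_branching (q0 n) (mq n)).
  - move=> -[xi s] n m nm; exact: (@le_branching R _ _ xi s (q0 n) (mq n) (q0 m) (mq m)
      (fun eta _ => nondecreasing_survival (eta, s) nm)).
  - move=> w; exact: (@cvg_branching (fun n => survival n.+1) extinction w q0 q1 mq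
      nondecreasing_survival cvg_survival e01).
  - move=> w; rewrite branching_ge0 ?branching_le1//; try exact: extinction_ge0.
      exact: measurable_extinction.
    exact: extinction_le1.
have := cvg_unique _ h1 h2; exact.
Qed.

End limit.

(*@P18*)
Section lifetime.
Context {R : realType}.
Implicit Types f : vertex -> R.

Fixpoint lifetime (n : nat) f : R :=
  if n is n'.+1 then
    f [::] + Num.min (lifetime n' (fun w => f (false :: w)))
                     (lifetime n' (fun w => f (true :: w)))
  else 0.

Lemma lt_lifetime n (t : R) f :
  t < lifetime n.+1 f <->
  forall v, size v = n -> t < \sum_(j < n.+1) f (take j v).
Proof.
elim: n t f => [|n IH] t f.
  rewrite /= minxx addr0; split=> [tf v _|/(_ [::] erefl)].
    by rewrite big_ord_recl big_ord0 addr0 take0.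
  by rewrite big_ord_recl big_ord0 addr0.
have E b v : \sum_(j < n.+2) f (take j (b :: v)) =
    f [::] + \sum_(j < n.+1) f (b :: take j v) by rewrite big_ord_recl.
have -> : (t < lifetime n.+2 f) =
    (t - f [::] < lifetime n.+1 (fun w => f (false :: w))) &&
    (t - f [::] < lifetime n.+1 (fun w => f (true :: w))).
  by rewrite -lt_min ltrBlDl.
split=> [/andP[/IH h0 /IH h1] [//|b v] [vn]|h].
  by rewrite E -ltrBlDl; case: b; [exact: h1|exact: h0].
apply/andP; split; apply/IH => v vn; rewrite ltrBlDl -E; apply: h => /=;
  by rewrite vn.
Qed.

Lemma lt_explosion_time (Omega : Type) (T : vertex -> Omega -> R) (omega : Omega)
    (t : R) :
  (t%:E < explosion_time T omega)%E <->
  exists n, t < lifetime n.+1 (T ^~ omega).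
Proof.
have minP n : (t%:E < \big[mine/+oo]_(v : n.-tuple bool)
      (\sum_(j < n.+1) T (take j v) omega)%:E)%E <-> t < lifetime n.+1 (T ^~ omega).
  split=> h.
    apply/lt_lifetime => v /eqP vn; rewrite -lte_fin.
    by apply: (lt_le_trans h); rewrite (bigD1 (Tuple vn))//= ge_min lexx.
  elim/big_ind : _ => [|x y tx ty|v _]; first exact: ltry.
    by rewrite lt_min tx ty.
  by rewrite lte_fin; move/lt_lifetime : h; apply; rewrite size_tuple.
split=> [/ereal_sup_gt[_ [n _ <-] /minP]|[n /minP h]]; first by exists n.
by apply: (lt_le_trans h); apply: ereal_sup_ubound; exists n.
Qed.

Lemma measurable_lifetime d (X : measurableType d) n (T : vertex -> X -> R) :
  (forall v, measurable_fun setT (T v)) ->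
  measurable_fun setT (fun x => lifetime n (T ^~ x)).
Proof.
elim: n T => [|n IH] T mT /=; first exact: measurable_cst.
apply: measurable_funD => //; apply: measurable_minr.
  exact: (IH (fun w => T (false :: w))).
exact: (IH (fun w => T (true :: w))).
Qed.

Lemma path_measurable_lifetime n (s : R) :
  path_measurable [set p : path_space R | s < lifetime n (fun w => (p w).2)].
Proof.
pose X := g_sigma_algebraType (@path_cylinders R : set (set (vertex -> R3 R * R))).
have mp v : measurable_fun (setT : set X) (fun p : X => (p v).2 : R).
  move=> _ B mB; rewrite setTI; apply: sub_sigma_algebra.
  exists v, (setT `*` B); split; first exact: measurableX.
  by apply/seteqP; split=> p //= [].
have := @measurable_lifetime _ X n (fun v p => (p v).2) mp.
move=> /(_ measurableT `]s, +oo[%classic (measurable_itv _)).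
rewrite setTI; congr (path_measurable _).
by apply/seteqP; split=> p /=; rewrite in_itv/= andbT.
Qed.

Lemma lifetime_ge0 n f : (forall v, 0 <= f v) -> 0 <= lifetime n f.
Proof.
elim: n f => [//|n IH] f f0 /=.
by rewrite addr_ge0// le_min !IH.
Qed.

Lemma lifetime_le n f : (forall v, 0 <= f v) -> lifetime n f <= lifetime n.+1 f.
Proof.
elim: n f => [|n IH] f f0; first exact: (lifetime_ge0 1 f0).
rewrite -[lifetime n.+1 f]/(_ + Num.min _ _) -[lifetime n.+2 f]/(_ + Num.min _ _).
by rewrite lerD2l le_min !ge_min !IH ?orbT.
Qed.

End lifetime.

(*@P19*)
Section laws.
Context {R : realType}.
Local Open Scope ereal_scope.
Import HBNNSimple.

(** If phi has density g with respect to nu on the event E, integrals over E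
    of functions of phi are integrals against g. *)
Lemma integral_law d1 d2 (X : measurableType d1) (Y : measurableType d2)
    (m : {measure set X -> \bar R}) (nu : {measure set Y -> \bar R})
    (E : set X) (phi : X -> Y) (g : Y -> R) :
  measurable E -> measurable_fun setT phi ->
  measurable_fun setT g -> (forall y, 0 <= g y)%R ->
  (forall C, measurable C ->
     m (E `&` phi @^-1` C) = \int[nu]_(y in C) (g y)%:E) ->
  forall F : Y -> \bar R, (forall y, 0 <= F y) -> measurable_fun setT F ->
  \int[m]_(x in E) F (phi x) = \int[nu]_y (F y * (g y)%:E).
Proof.
move=> mE mphi mg g0 law F F0 mF.
pose h := nnsfun_approx measurableT mF.
have mgE : measurable_fun setT (fun y => (g y)%:E) by exact/measurable_EFinP.
have hF y : (h n y)%:E @[n --> \oo] --> F y.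
  by apply: (@cvg_nnsfun_approx _ _ _ _ measurableT _ mF) => // t _; exact: F0.
have -> : \int[m]_(x in E) F (phi x) = lim (\int[m]_(x in E) (h n (phi x))%:E @[n --> \oo]).
  transitivity (\int[m]_(x in E) lim ((h n (phi x))%:E @[n --> \oo])).
    by apply: eq_integral => x _; apply/esym/cvg_lim => //; exact: hF.
  apply: monotone_convergence => //.
  - move=> n; apply/measurable_EFinP; apply: measurable_funTS.
    exact: (measurableT_comp _ mphi).
  - by move=> n x _; rewrite lee_fin.
  - by move=> x _ a b ab; rewrite lee_fin; exact/lefP/nd_nnsfun_approx.
have -> : \int[nu]_y (F y * (g y)%:E) = lim (\int[nu]_y ((h n y)%:E * (g y)%:E) @[n --> \oo]).
  transitivity (\int[nu]_y lim (((h n y)%:E * (g y)%:E) @[n --> \oo])).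
    by apply: eq_integral => y _; apply/esym/cvg_lim => //; apply: cvgeZr.
  apply: monotone_convergence => //.
  - by move=> n; apply: emeasurable_funM => //; exact/measurable_EFinP.
  - by move=> n y _; rewrite mule_ge0 ?lee_fin.
  - move=> y _ a b ab; apply: lee_wpmul2r; rewrite lee_fin//.
    exact/lefP/nd_nnsfun_approx.
apply: congr_lim; apply/funext => n.
have mr r : measurable (h n @^-1` [set r]) by [].
transitivity (\int[m]_(x in E) (\sum_(r \in range (h n))
    (r * \1_(h n @^-1` [set r]) (phi x))%:E)).
  by apply: eq_integral => x _; rewrite /= fimfunE -fsumEFin.
rewrite ge0_integral_fsum//; last 2 first.
- move=> r; apply/measurable_EFinP; apply: measurable_funTS.
  by apply: measurable_funM => //; exact: (measurableT_comp (measurable_indic _) mphi).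
- by move=> r x _; exact: nnfun_muleindic_ge0.
transitivity (\int[nu]_y (\sum_(r \in range (h n))
    (r * \1_(h n @^-1` [set r]) y)%:E * (g y)%:E)); last first.
  apply: eq_integral => y _.
  rewrite -ge0_mule_fsuml => [|r]; last exact: nnfun_muleindic_ge0.
  by rewrite fsumEFin// -fimfunE.
rewrite ge0_integral_fsum//; last 2 first.
- move=> r; apply: emeasurable_funM => //; apply/measurable_EFinP.
  by apply: measurable_funM => //; exact: measurable_indic.
- by move=> r y _; rewrite mule_ge0 ?lee_fin// -lee_fin nnfun_muleindic_ge0.
apply: eq_fsbigr => r; rewrite inE => -[y0 _ r_].
have r0 : (0 <= r)%R by rewrite -r_.
have mphir : measurable (phi @^-1` (h n @^-1` [set r])).
  by rewrite -[X in measurable X]setTI; exact: mphi.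
transitivity (r%:E * m (E `&` phi @^-1` (h n @^-1` [set r]))).
  under eq_integral do rewrite EFinM.
  rewrite ge0_integralZl_EFin//.
  - by rewrite (integral_indic m mE mphir) setIC.
  - apply/measurable_EFinP; apply: measurable_funTS.
    exact: (measurableT_comp (measurable_indic _) mphi).
rewrite law//.
under [RHS]eq_integral do rewrite EFinM -muleA.
rewrite ge0_integralZl_EFin//.
- congr (_ * _); rewrite integral_mkcond; apply: eq_integral => y _.
  rewrite patchE indicE; case: ifPn => _; first by rewrite mul1e.
  by rewrite mul0e.
- by move=> y _; rewrite mule_ge0 ?lee_fin.
- by apply: emeasurable_funM => //; apply/measurable_EFinP; exact: measurable_indic.
Qed.

(** Independence is tested on the half-lines that generate the Borel sets. *)
Lemma independent_sum d (X : measurableType d) (P : probability X R)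
    (T Y : X -> R) (p : R -> R) :
  measurable_fun setT T -> measurable_fun setT Y ->
  measurable_fun setT p -> (forall u, 0 <= p u)%R ->
  (forall A, measurable A ->
     P (T @^-1` A) = \int[@lebesgue_measure R]_(u in A) (p u)%:E) ->
  (forall A s, measurable A -> P (T @^-1` A `&` [set x | s < Y x]%R) =
     P (T @^-1` A) * P [set x | s < Y x]%R) ->
  forall t, P [set x | t < T x + Y x]%R =
     \int[@lebesgue_measure R]_u ((p u)%:E * P [set x | t - u < Y x]%R).
Proof.
move=> mT mY mp p0 law indep t.
have pre (Z : X -> R) B : measurable_fun setT Z -> measurable B -> measurable (Z @^-1` B).
  by move=> mZ mB; rewrite -[X in measurable X]setTI; exact: mZ.
have setY s : [set x | s < Y x]%R = Y @^-1` `]s, +oo[%classic.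
  by apply/seteqP; split=> x /=; rewrite in_itv/= andbT.
have mTY : measurable_fun setT (fun x => (T x, Y x)) by exact: measurable_fun_pair.
pose mfT : {mfun X >-> R} := mfun_Sub (mem_set mT : T \in mfun).
pose mfY : {mfun X >-> R} := mfun_Sub (mem_set mY : Y \in mfun).
pose mfTY : {mfun X >-> (R * R)%type} := mfun_Sub (mem_set mTY : (fun x => (T x, Y x)) \in mfun).
have rect A B : measurable A -> measurable B ->
    P (T @^-1` A `&` Y @^-1` B) = P (T @^-1` A) * P (Y @^-1` B).
  move=> mA mB.
  have mTA : measurable (T @^-1` A) := pre T A mT mA.
  have fTA : (fine (P (T @^-1` A)))%:E = P (T @^-1` A).
    by rewrite fineK// fin_num_measure.
  pose mA0 : {nonneg R} := NngNum (fine_ge0 (measure_ge0 P (T @^-1` A))).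
  pose m1 : {measure set R -> \bar R} := pushforward (mrestr P mTA) mfY.
  pose m2 : {measure set R -> \bar R} := mscale mA0 (distribution P mfY).
  have m1E C : m1 mY C = P (T @^-1` A `&` Y @^-1` C) by rewrite setIC.
  have m2E C : m2 C = P (T @^-1` A) * P (Y @^-1` C) by rewrite -fTA.
  rewrite -m1E -m2E.
  apply: (@measure_unique _ R _ (@RGenOInfty.G R) (fun k => `](- k%:R)%R, +oo[%classic)) => //.
  - exact: RGenOInfty.measurableE.
  - move=> _ _ [a ->] [b ->]; exists (Num.max a b); apply/seteqP; split=> x /=;
      rewrite !in_itv/= !andbT gt_max; [by move=> [-> ->]|by move=> /andP].
  - by move=> k; exists (- k%:R)%R.
  - apply/seteqP; split=> // x _; exists (Num.truncn (- x)).+1 => //=.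
    rewrite in_itv/= andbT ltrNl; exact: truncnS_gt.
  - by move=> _ [s ->]; rewrite m1E m2E -setY indep.
  - move=> k; rewrite m1E; apply: (@le_lt_trans _ _ 1); last exact: ltry.
    by apply: probability_le1; apply: measurableI => //; exact: pre.
pose S : set (R * R) := [set z | t < z.1 + z.2]%R.
have mS : measurable S.
  have -> : S = (fun z : R * R => z.1 + z.2)%R @^-1` `]t, +oo[%classic.
    by apply/seteqP; split=> x /=; rewrite in_itv/= andbT.
  rewrite -[X in measurable X]setTI.
  exact: (measurable_funD measurable_fst measurable_snd).
have mPY : measurable_fun setT (fun u : R => P [set x | t - u < Y x]%R).
  have := measurable_fun_xsection (distribution P mfY) mS.
  apply: eq_measurable_fun => u _ /=; rewrite /distribution /pushforward.
  by congr (P _); apply/seteqP; split=> x; rewrite /xsection /= inE /S /= ltrBlDl.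
rewrite -[LHS]/(distribution P mfTY S).
rewrite -(@product_measure_unique _ _ _ _ R (distribution P mfT) (distribution P mfY))//; last first.
rewrite /product_measure1 /=.
transitivity (\int[distribution P mfT]_u P [set x | t - (u : R) < Y x]%R).
  apply: eq_integral => u _ /=; rewrite /distribution /pushforward.
  by congr (P _); apply/seteqP; split=> x; rewrite /xsection /= inE /S /= ltrBlDl.
under [RHS]eq_integral do rewrite muleC.
have lawT C : measurable C -> distribution P mfT (setT `&` id @^-1` C) =
    \int[@lebesgue_measure R]_(u in C) (p u)%:E by move=> mC; rewrite setTI; exact: law.
exact: (@integral_law _ _ R (measurableTypeR R) (distribution P mfT) (@lebesgue_measure R) setT id p
  measurableT (@measurable_id _ _ _) mp p0 lawT (fun u : R => P [set x | t - u < Y x]%R)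
  (fun u => measure_ge0 _ _) mPY).
Qed.

End laws.

(*@P20*)
Section cascade_law.
Context {R : realType} (d : R3 R -> measure_display)
  (Omega : forall xi : R3 R, measurableType (d xi))
  (P : forall xi : R3 R, probability (Omega xi) R)
  (W : forall xi : R3 R, vertex -> Omega xi -> R3 R)
  (T : forall xi : R3 R, vertex -> Omega xi -> R)
  (cascadeWT : is_cascade_family P W T).
Arguments W : clear implicits.
Arguments T : clear implicits.
Notation mu := (@lebesgue_measure R).
Notation mu3 := (lebesgue3 R).
Local Open Scope ereal_scope.

Let mW (xi : R3 R) v : xi != 0%R -> measurable_fun setT (W xi v).
Proof. by move=> xi0; have [m _ _ _] := cascadeWT xi0; have [] := m v. Qed.

Let mT (xi : R3 R) v : xi != 0%R -> measurable_fun setT (T xi v).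
Proof. by move=> xi0; have [m _ _ _] := cascadeWT xi0; have [] := m v. Qed.

Let pre (xi : R3 R) dY (Y : measurableType dY) (f : Omega xi -> Y) B :
  measurable_fun setT f -> measurable B -> measurable (f @^-1` B).
Proof. by move=> mf mB; rewrite -[X in measurable X]setTI; exact: mf. Qed.

Let measure_setI_ae (xi : R3 R) (A B : set (Omega xi)) :
  measurable A -> measurable B -> {ae P xi, forall omega, B omega} ->
  P xi (B `&` A) = P xi A.
Proof.
move=> mA mB aeB; rewrite [RHS](measureDI _ mA mB) setIC.
rewrite (@measure_negligible _ _ _ (P xi) (A `\` B)) ?add0e//; first exact: measurableD.
by apply: negligibleS aeB => omega [].
Qed.

Lemma joint_law (xi : R3 R) (B : set R) (C : set (R3 R)) :
  xi != 0%R -> measurable B -> measurable C ->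
  P xi [set omega | B (T xi [::] omega) /\ C (W xi [:: false] omega)] =
  exponential_prob (norm3 xi ^+ 2) B * \int[mu3]_(eta in C) (H3 eta xi)%:E.
Proof.
move=> xi0 mB mC; have [_ W0 step _] := cascadeWT xi0.
have [law _] := step [::].
pose D := [set omega | W xi [::] omega = xi].
have mD : measurable D.
  by apply: (pre (mW [::] xi0) (B := [set xi])); exact: measurable_point3.
have mS : measurable [set omega | B (T xi [::] omega) /\ C (W xi [:: false] omega)].
  apply: measurableI; first exact: (pre (mT [::] xi0) mB).
  exact: (pre (mW [:: false] xi0) mC).
rewrite -(measure_setI_ae mS mD W0).
transitivity (\int[P xi]_(omega in D) cst (exponential_prob (norm3 xi ^+ 2) B *
    \int[mu3]_(eta in C) (H3 eta xi)%:E) omega); last first.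
  have PD : P xi D = 1.
    by rewrite -[D]setIT (measure_setI_ae measurableT mD W0) probability_setT.
  by rewrite (integral_cst (P xi) mD) [X in _ * X]PD mule1.
transitivity (P xi [set omega | [/\ [set xi] (W xi [::] omega), B (T xi [::] omega) &
                                   C (W xi [:: false] omega)]]).
  by congr (P xi _); apply/seteqP; split=> omega /=; [move=> [? []]|move=> []].
rewrite (law [set xi] B C (measurable_point3 xi) mB mC).
by apply: eq_integral => omega; rewrite inE /= => ->.
Qed.

Lemma cascade_normalized : @normalized_kernel R.
Proof.
move=> xi xi0; have := joint_law xi0 (@measurableT _ R) (@measurableT _ (R3 R)).
rewrite /exponential_prob integral_exponential_pdf ?exprn_gt0 ?norm3_gt0// mul1e => <-.
have -> : [set omega | [set: R] (T xi [::] omega) /\ [set: R3 R] (W xi [:: false] omega)] = setT.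
  by apply/seteqP; split.
by rewrite probability_setT.
Qed.

Let T_ge0 (xi : R3 R) : xi != 0%R ->
  {ae P xi, forall omega, forall v, (0 <= T xi v omega)%R}.
Proof.
move=> xi0; have [_ _ step _] := cascadeWT xi0.
pose N (v : vertex) := [set omega | (T xi v omega < 0)%R].
have mN v : measurable (N v).
  have -> : N v = T xi v @^-1` `]-oo, 0%R[%classic.
    by apply/seteqP; split=> omega; rewrite /= in_itv.
  exact: (pre (mT v xi0)).
have N0 v : P xi (N v) = 0.
  have [law _] := step v.
  have := law setT `]-oo, 0%R[%classic setT measurableT (measurable_itv _) measurableT.
  rewrite (_ : [set omega | _] = N v); last first.
    by apply/seteqP; split=> omega /=; rewrite in_itv/=; [move=> []|].
  move=> ->; apply: integral0_eq => omega _.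
  rewrite [exponential_prob _ _]integral0_eq ?mul0e// => u.
  by rewrite /= in_itv/= => u0; rewrite lt0_exponential_pdf.
pose F k := if unpickle k is Some v then N v else set0.
apply: (@negligibleS _ _ _ _ (\bigcup_k F k)).
  move=> omega /= /existsNP[v /negP]; rewrite -ltNge => vN.
  by exists (pickle v) => //; rewrite /F pickleK.
apply: negligible_bigcup => k; rewrite /F; case: (unpickle k) => [v|].
  by exists (N v); split; [exact: mN|exact: N0|].
exact: negligible_set0.
Qed.

Let nH := cascade_normalized.

Let measurable_lifetime_gt (xi : R3 R) n (s : R) : xi != 0%R ->
  measurable [set omega | (s < lifetime n (T xi ^~ omega))%R].
Proof.
move=> xi0.
have -> : [set omega | (s < lifetime n (T xi ^~ omega))%R] =
    (fun omega => lifetime n (T xi ^~ omega)) @^-1` `]s, +oo[%classic.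
  by apply/seteqP; split=> omega; rewrite /= in_itv/= andbT.
by apply: pre => //; apply: measurable_lifetime => v; exact: mT.
Qed.

(** Splitting at the first branching: the lifetimes of the two subtrees are
    conditionally independent given the child frequencies. *)
Let branching_law n (xi : R3 R) (A : set R) (s : R) : xi != 0%R -> measurable A ->
  (forall eta : R3 R, eta != 0%R ->
     P eta [set omega | (s < lifetime n (T eta ^~ omega))%R] = survival n (eta, s)) ->
  P xi (T xi [::] @^-1` A `&` [set omega |
    (s < Num.min (lifetime n (fun w => T xi (false :: w) omega))
                 (lifetime n (fun w => T xi (true :: w) omega)))%R]) =
  exponential_prob (norm3 xi ^+ 2) A * branching (survival n) (xi, s).
Proof.
move=> xi0 mA IH; have [_ W0 step indep] := cascadeWT xi0.
have [_ W2] := step [::].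
pose C := [set p : path_space R | (s < lifetime n (fun w => (p w).2))%R].
have mC : path_measurable C by exact: path_measurable_lifetime.
pose c0 := P 0%R [set omega | (s < lifetime n (T 0%R ^~ omega))%R].
pose Q (eta : R3 R) := if norm3 eta == 0%R then c0 else survival n (eta, s).
have QE eta : P eta [set omega | (s < lifetime n (T eta ^~ omega))%R] = Q eta.
  rewrite /Q norm3_eq0; have [->|e0] := eqVneq eta 0%R; first by [].
  exact: IH.
have Q0 eta : 0 <= Q eta by rewrite -QE.
have mQ : measurable_fun setT Q.
  apply: measurable_fun_ifT.
  - by apply: measurable_fun_eqr => //; exact: measurable_norm3.
  - exact: measurable_cst.
  - exact: (measurableT_comp (@measurable_survival R n) (pair2_measurable s)).
pose E := T xi [::] @^-1` A.
have mE : measurable E := pre (mT [::] xi0) mA.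
have W12 : {ae P xi, forall omega,
    W xi [:: true] omega = xi - W xi [:: false] omega}%R.
  by apply: filterS2 W0 W2 => omega /= -> ->.
transitivity (\int[P xi]_(omega in E) (Q (W xi [:: false] omega) * Q (W xi [:: true] omega))).
  have := indep [::] A setT setT C C mA measurableT measurableT mC mC; cbv zeta.
  set E' := (X in P xi (X `&` _)); have E'E : E' = E.
    by apply/seteqP; split=> omega /=; [move=> []|].
  rewrite [in X in X -> _]E'E.
  have -> : E `&` [set omega | C (subtree (W xi) (T xi) (child1 [::]) omega) /\
                               C (subtree (W xi) (T xi) (child2 [::]) omega)] =
      T xi [::] @^-1` A `&` [set omega |
        (s < Num.min (lifetime n (fun w => T xi (false :: w) omega))
                     (lifetime n (fun w => T xi (true :: w) omega)))%R].
    apply/seteqP; split=> omega [EA h]; split=> //; move: h; rewrite /= lt_min.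
      by move=> [-> ->].
    by move=> /andP.
  by move=> ->; rewrite -/E' E'E; apply: eq_integral => omega _; rewrite -!QE.
have mW1 := mW [:: false] xi0; have mW2 := mW [:: true] xi0.
transitivity (\int[P xi]_(omega in E)
    (Q (W xi [:: false] omega) * Q (xi - W xi [:: false] omega)%R)).
  apply: ae_eq_integral => //.
  - apply: measurable_funTS; apply: emeasurable_funM; exact: (measurableT_comp mQ).
  - apply: measurable_funTS; apply: emeasurable_funM; apply: (measurableT_comp mQ) => //.
    exact: measurable_fun_subR3.
  - by apply: filterS W12 => omega /= -> _.
have e_fin : exponential_prob (norm3 xi ^+ 2) A \is a fin_num.
  have := joint_law xi0 mA (@measurableT _ (R3 R)).
  rewrite (nH xi0) mule1 => <-; apply: fin_num_measure.
  by apply: measurableI => //; exact: (pre mW1 measurableT).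
pose a := fine (exponential_prob (norm3 xi ^+ 2) A).
have aE : a%:E = exponential_prob (norm3 xi ^+ 2) A by rewrite fineK.
have a0 : (0 <= a)%R.
  apply: fine_ge0; apply: integral_ge0 => u _.
  by rewrite lee_fin exponential_pdf_ge0 ?sqr_ge0.
have mH : measurable_fun setT (fun eta => H3 eta xi) by exact: measurable_fun_H3.
have mQQ : measurable_fun setT (fun eta => Q eta * Q (xi - eta)%R).
  apply: emeasurable_funM => //; apply: (measurableT_comp mQ).
  exact: measurable_fun_subR3.
rewrite (@integral_law R _ _ _ _ (P xi) mu3 E (W xi [:: false])
  (fun eta => a * H3 eta xi)%R mE mW1 _ _ _ (fun eta => Q eta * Q (xi - eta)%R))//.
- rewrite -aE /branching -ge0_integralZl_EFin//.
  + apply: eq_integral => eta _ /=.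
    have [->|e0] := eqVneq eta 0%R; first by rewrite H3_eta0 mulr0 !(mul0e, mule0).
    have [/eqP|ex] := eqVneq (xi - eta)%R 0%R.
      by rewrite subr_eq0 => /eqP <-; rewrite H3_etaxi mulr0 !(mul0e, mule0).
    by rewrite /Q !norm3_eq0 (negbTE e0) (negbTE ex) (EFinM a) muleC -muleA.
  + by move=> eta _; rewrite !mule_ge0 ?survival_ge0// lee_fin H3_ge0.
  + by apply: measurable_branching_section; exact: measurable_survival.
- exact: measurable_funM.
- by move=> eta; rewrite mulr_ge0 ?H3_ge0.
- move=> B mB; transitivity (a%:E * \int[mu3]_(eta in B) (H3 eta xi)%:E).
    by rewrite aE -joint_law.
  rewrite -ge0_integralZl_EFin//; first by move=> eta _; rewrite lee_fin H3_ge0.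
  by apply: measurable_funTS; exact/measurable_EFinP.
- by move=> eta; rewrite mule_ge0.
Qed.

Lemma survival_law n (xi : R3 R) (t : R) : xi != 0%R ->
  P xi [set omega | (t < lifetime n (T xi ^~ omega))%R] = survival n (xi, t).
Proof.
elim: n xi t => [|n IH] xi t xi0.
  rewrite /=; have [t0|t0] := ltP t 0%R.
    rewrite (_ : [set _ | _] = setT) ?probability_setT//.
    by apply/seteqP; split.
  by rewrite (_ : [set _ | _] = set0) ?measure0//; apply/seteqP; split.
pose Y omega := Num.min (lifetime n (fun w => T xi (false :: w) omega))
                        (lifetime n (fun w => T xi (true :: w) omega)).
have mY : measurable_fun setT Y.
  apply: measurable_minr.
    by apply: (@measurable_lifetime R _ _ n (fun w => T xi (false :: w))) => v; exact: mT.
  by apply: (@measurable_lifetime R _ _ n (fun w => T xi (true :: w))) => v; exact: mT.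
have key A s : measurable A -> P xi (T xi [::] @^-1` A `&` [set omega | (s < Y omega)%R]) =
    exponential_prob (norm3 xi ^+ 2) A * branching (survival n) (xi, s).
  by move=> mA; apply: branching_law => // eta; exact: IH.
have e1 : exponential_prob (norm3 xi ^+ 2) setT = 1.
  by rewrite /exponential_prob integral_exponential_pdf// exprn_gt0 ?norm3_gt0.
have YE s : P xi [set omega | (s < Y omega)%R] = branching (survival n) (xi, s).
  by rewrite -[RHS]mul1e -e1 -key// preimage_setT setTI.
have TE A : measurable A -> P xi (T xi [::] @^-1` A) = exponential_prob (norm3 xi ^+ 2) A.
  move=> mA; have := joint_law xi0 mA (@measurableT _ (R3 R)).
  rewrite (nH xi0) mule1 => <-; congr (P xi _).
  by apply/seteqP; split=> [omega|omega []].
transitivity (\int[mu]_u ((exponential_pdf (norm3 xi ^+ 2) u)%:E *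
    P xi [set omega | (t - u < Y omega)%R])).
  apply: (@independent_sum R _ _ (P xi) (T xi [::]) Y) => //.
  - exact: mT.
  - exact: measurable_exponential_pdf2.
  - by move=> u; rewrite exponential_pdf_ge0 ?sqr_ge0.
  - by move=> A s mA; rewrite key// TE// YE.
by apply: eq_integral => u _; rewrite YE.
Qed.

Lemma explosion_law (xi : R3 R) (t : R) : xi != 0%R ->
  P xi [set omega | t%:E < explosion_time (T xi) omega] = extinction (xi, t).
Proof.
move=> xi0.
pose E n := [set omega | (t < lifetime n.+1 (T xi ^~ omega))%R].
have mE n : measurable (E n) by exact: measurable_lifetime_gt.
have -> : [set omega | t%:E < explosion_time (T xi) omega] = \bigcup_n E n.
  apply/seteqP; split=> omega /=; first by move=> /lt_explosion_time[n h]; exists n.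
  by move=> [n _ h]; apply/lt_explosion_time; exists n.
have [N [mN N0 sub]] := T_ge0 xi0.
have mNE n : measurable (E n `\` N) by exact: measurableD.
have PE (A : set (Omega xi)) : measurable A -> P xi (A `\` N) = P xi A.
  move=> mA; rewrite [RHS](measureDI _ mA mN) [X in _ + X](_ : _ = 0) ?adde0//.
  by apply: (subset_measure0 _ mN _ N0) => //; exact: measurableI.
rewrite -PE; last by apply: bigcupT_measurable.
rewrite setD_bigcupl.
have h1 : P xi (E n `\` N) @[n --> \oo] --> P xi (\bigcup_n (E n `\` N)).
  apply: nondecreasing_cvg_mu => //; first exact: bigcupT_measurable.
  apply/nondecreasing_seqP => n; apply/subsetPset => omega [En nN]; split=> //.
  apply: (lt_le_trans En); apply: lifetime_le => v.
  by apply: contrapT => Tv; apply: nN; apply: sub => /= /(_ v).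
apply: (cvg_unique _ h1) => //.
have -> : (fun n => P xi (E n `\` N)) = (fun n => survival n.+1 (xi, t)).
  by apply/funext => n; rewrite PE// survival_law.
exact: cvg_survival.
Qed.

End cascade_law.

(*@P21*)
Section profile.
Context {R : realType} (nH : @normalized_kernel R).
Notation mu := (@lebesgue_measure R).
Notation mu3 := (lebesgue3 R).
Notation a := (((2 / pi) `^ (3 / 2)) : R).

Lemma c0_amplitude : c0 R * a * pi ^+ 3 = 1.
Proof.
rewrite -c0_mul8 -[RHS]c0_sqr; have := @pi_gt0 R.
by move: (pi : R) (c0 R) => q c q0; field; rewrite gt_eqF.
Qed.

Lemma ge0_integral_fin d (X : measurableType d) (m : {measure set X -> \bar R})
    (D : set X) (f : X -> R) (c : R) : measurable D ->
  measurable_fun D f -> (forall x, D x -> 0 <= f x) ->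
  (\int[m]_(x in D) (f x)%:E = c%:E)%E ->
  m.-integrable D (EFin \o f) /\ Rintegral m D f = c.
Proof.
move=> mD mf f0 fc; split; last by rewrite /Rintegral fc.
apply/integrableP; split; first exact/measurable_EFinP.
rewrite (_ : (\int[m]_(x in D) _)%E = c%:E) ?ltry// -fc.
by apply: eq_integral => x; rewrite inE => /f0 fx; rewrite /= ger0_norm.
Qed.

Lemma fourier_equation_real (v0 : R3 R -> R) (v : R3 R -> R -> R) :
  (forall (xi : R3 R) (t : R), xi != 0 -> 0 <= t ->
     let g s := expR (- (s * norm3 xi ^+ 2)) * norm3 xi *
       \int[mu3]_eta (v eta (t - s) * v (xi - eta) (t - s)) in
     [/\ forall s, 0 < s < t -> mu3.-integrable setT
           (EFin \o (fun eta => v eta (t - s) * v (xi - eta) (t - s))),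
         mu.-integrable `[0, t] (EFin \o g) &
         v xi t = expR (- (t * norm3 xi ^+ 2)) * v0 xi +
                  c0 R * Rintegral mu `[0, t] g]) ->
  fourier_equation (fun xi => (v0 xi)%:C) (fun xi t => (v xi t)%:C).
Proof.
move=> h xi t xi0 t0.
pose g s := expR (- (s * norm3 xi ^+ 2)) * norm3 xi *
  \int[mu3]_eta (v eta (t - s) * v (xi - eta) (t - s)).
have [i1 i2 eq] := h xi t xi0 t0.
have {}i2 : mu.-integrable `[0, t] (EFin \o g) := i2.
have {}eq : v xi t = expR (- (t * norm3 xi ^+ 2)) * v0 xi +
  c0 R * Rintegral mu `[0, t] g := eq.
have ReM (x y : R) : complex.Re (x%:C * y%:C) = x * y by rewrite /= mulr0 subr0.
have ImM (x y : R) : complex.Im (x%:C * y%:C) = 0 by rewrite /= mulr0 mul0r addr0.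
have scE s : self_conv ((fun xi t => (v xi t)%:C) ^~ s) xi =
    (\int[mu3]_eta (v eta s * v (xi - eta) s))%:C.
  rewrite /self_conv /cintegral; congr Complex.
    by apply: eq_Rintegral => eta _; rewrite ReM.
  rewrite (eq_Rintegral _ (g := fun=> 0)); first by rewrite Rintegral_cst//= mul0r.
  by move=> eta _; rewrite ImM.
move=> G; have GE s : G s = (g s)%:C.
  by rewrite /G (scE (t - s)) -rmorphM.
split.
- move=> s st; split.
    by move: (i1 s st); apply: eq_integrable => // eta _ /=; rewrite mulr0 subr0.
  have := integrable0 mu3 setT.
  by apply: eq_integrable => // eta _ /=; rewrite mulr0 mul0r addr0.
- split.
    move: i2; apply: eq_integrable => // s _.
    exact: (congr1 (fun z => (complex.Re z)%:E) (esym (GE s))).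
  have := integrable0 mu `[0, t]%classic.
  apply: eq_integrable => // s _.
  exact: (congr1 (fun z => (complex.Im z)%:E) (esym (GE s))).
- have -> : cintegral mu `[0, t] G = (Rintegral mu `[0, t] g)%:C.
    rewrite /cintegral; congr Complex; first by apply: eq_Rintegral => s _; rewrite GE.
    rewrite (eq_Rintegral _ (g := fun=> 0)); first by rewrite Rintegral_cst//= mul0r.
    by move=> s _; rewrite GE.
  by rewrite eq rmorphD !rmorphM.
Qed.

Section solution.
Context (p : R3 R * R -> \bar R) (mp : measurable_fun setT p)
  (p0 : forall z, (0 <= p z)%E) (p1 : forall z, (p z <= 1)%E).

Definition profile (xi : R3 R) (t : R) : R := a * (norm3 xi ^+ 2)^-1 * fine (p (xi, t)).

Let a_ge0 : 0 <= a. Proof. exact: powR_ge0. Qed.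

Lemma profile_ge0 xi t : 0 <= profile xi t.
Proof. by rewrite !mulr_ge0 ?invr_ge0 ?sqr_ge0 ?fine_ge0. Qed.

Lemma measurable_profile : measurable_fun setT (fun z : R3 R * R => profile z.1 z.2).
Proof.
apply: measurable_funM.
  apply: measurable_funM => //; apply: measurable_fun_inv; apply: measurable_funX.
  exact: measurable_fun_norm3.
apply: (measurableT_comp (@fine_measurable R setT measurableT)).
have -> : (fun z : R3 R * R => p (z.1, z.2)) = p by apply/funext => -[].
exact: mp.
Qed.

Lemma measurable_profile_section t : measurable_fun setT (fun xi => profile xi t).
Proof. exact: (measurableT_comp measurable_profile (pair2_measurable t)). Qed.

Let fin_p z : p z \is a fin_num.
Proof. by rewrite ge0_fin_numE// (le_lt_trans (p1 z))// ltry. Qed.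

Let fin_branching z : branching p z \is a fin_num.
Proof.
rewrite ge0_fin_numE ?branching_ge0//.
by rewrite (le_lt_trans (branching_le1 nH z p0 mp p1))// ltry.
Qed.

Lemma self_conv_profile (xi : R3 R) (s : R) : xi != 0 ->
  (\int[mu3]_eta (profile eta s * profile (xi - eta) s)%:E =
   (a ^+ 2 * pi ^+ 3 / norm3 xi * fine (branching p (xi, s)))%:E)%E.
Proof.
move=> xi0; have k0 := norm3_gt0 xi0.
have c_ge0 : 0 <= a ^+ 2 * pi ^+ 3 / norm3 xi.
  by rewrite divr_ge0 ?mulr_ge0 ?exprn_ge0 ?pi_ge0 ?(ltW k0).
rewrite EFinM fineK// -ge0_integralZl_EFin//.
- apply: eq_integral => eta _ /=.
  rewrite -[p (eta, s)]fineK// -[p (xi - eta, s)]fineK// -!EFinM; congr EFin.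
  rewrite H3E// /profile (invfM (norm3 eta ^+ 2)).
  move: (fine _) (fine _) (norm3 eta ^+ 2)^-1 (norm3 (xi - eta) ^+ 2)^-1 => x y A B.
  have := @pi_gt0 R; move: a => b; move: (pi : R) => q q0.
  by field; rewrite !gt_eqF.
- by move=> eta _; rewrite mule_ge0 ?lee_fin ?H3_ge0// mule_ge0.
- exact: measurable_branching_section.
Qed.

Context (p_lt0 : forall (xi : R3 R) s, xi != 0 -> s < 0 -> p (xi, s) = 1%E)
  (p_eq : forall (xi : R3 R) t, xi != 0 -> p (xi, t) = renewal (branching p) (xi, t)).

(** After time t the clock at the root has not rung, which gives the heat
    factor; before it, the density of the clock turns into the Duhamel kernel. *)
Lemma renewal_duhamel (xi : R3 R) (t : R) : xi != 0 -> 0 <= t ->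
  (p (xi, t) = (expR (- (t * norm3 xi ^+ 2)))%:E +
     \int[mu]_(u in `[0%R, t]) (norm3 xi ^+ 2 * expR (- (u * norm3 xi ^+ 2)) *
                              fine (branching p (xi, t - u)))%:E)%E.
Proof.
move=> xi0 t0; have r0 : 0 < norm3 xi ^+ 2 by rewrite exprn_gt0 ?norm3_gt0.
rewrite p_eq// /renewal /=.
have br_ge0 := branching_ge0 p0.
have mbr := measurable_branching p0 mp.
have pdf0 u := exponential_pdf_ge0 (ltW r0) u.
pose f u := ((exponential_pdf (norm3 xi ^+ 2) u)%:E * branching p (xi, (t - u)%R))%E.
have mf : measurable_fun setT f by exact: measurable_renewal_section.
have f0 u : (0 <= f u)%E by rewrite mule_ge0// lee_fin.
have split (h : R -> \bar R) : measurable_fun setT h -> (forall u, 0 <= h u)%E ->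
    (\int[mu]_u h u = \int[mu]_(u in ~` `[0%R, t]) h u + \int[mu]_(u in `[0%R, t]) h u)%E.
  move=> mh h0; rewrite -ge0_integral_setU//.
  - by rewrite setUC setUv.
  - exact: measurableC.
  - by rewrite setUC setUv.
  - by rewrite disj_set2E setIC setICr.
have mpdf := measurable_exponential_pdf_cst (norm3 xi ^+ 2).
rewrite [LHS](split f)//; congr (_ + _)%E.
  transitivity (\int[mu]_(u in ~` `[0%R, t]) (exponential_pdf (norm3 xi ^+ 2) u)%:E)%E.
    apply: eq_integral => u; rewrite inE/= in_itv/= => /negP.
    rewrite negb_and -!ltNge => /orP[u0|tu].
      by rewrite /f lt0_exponential_pdf// mul0e.
    rewrite /f branching_lt0 ?mule1// => eta eta0.
    by apply: p_lt0 => //; rewrite subr_lt0.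
  have := integral_exponential_pdf r0; rewrite split//.
  rewrite -[X in (_ + X)%E]/(exponential_prob _ _).
  have -> : exponential_prob (norm3 xi ^+ 2) `[0, t] = (1 - (expR (- (t * norm3 xi ^+ 2)))%:E)%E.
    move: t0; rewrite le_eqVlt => /predU1P[<-|t0].
      rewrite /exponential_prob set_itv1 integral_set1 mul0r oppr0 expR0.
      by rewrite subee.
    by rewrite exponential_prob_itv0c// mulNr mulrC.
  move: (\int[mu]_(u in _) _)%E => I; case: I => [I| |]//=.
  by rewrite -EFinB -EFinD => -[] E; congr EFin; lra.
apply: eq_integral => u; rewrite inE/= in_itv/= => /andP[u0 _].
by rewrite /f exponential_pdfE// -[X in (_ * X)%E]fineK// -EFinM mulNr (mulrC _ u).
Qed.

Lemma fourier_equation_profile :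
  fourier_equation (fun xi => (a * (norm3 xi ^+ 2)^-1)%:C)
                   (fun xi t => (profile xi t)%:C).
Proof.
apply: fourier_equation_real => xi t xi0 t0 g.
have k0 := norm3_gt0 xi0.
have mprod s : measurable_fun setT (fun eta => profile eta s * profile (xi - eta) s).
  apply: measurable_funM; first exact: measurable_profile_section.
  apply: (measurableT_comp (measurable_profile_section s)).
  exact: measurable_fun_subR3.
have sc s := @ge0_integral_fin _ _ mu3 setT _ _ measurableT (mprod s)
  (fun eta _ => mulr_ge0 (profile_ge0 eta s) (profile_ge0 (xi - eta) s))
  (self_conv_profile s xi0).
pose g' s := norm3 xi ^+ 2 * expR (- (s * norm3 xi ^+ 2)) * fine (branching p (xi, t - s)).
have ac := c0_amplitude.
pose w := a * (norm3 xi ^+ 2)^-1 / c0 R.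
have c00 : 0 < c0 R by rewrite powR_gt0// mulr_gt0// pi_gt0.
have gE s : g s = w * g' s.
  rewrite /g (sc (t - s)).2 /g' /w.
  move: (fine _) (expR _) => b e; move: ac; have := @pi_gt0 R.
  move: a => A; move: (pi : R) (c0 R) c00 => q c c0' q0 ac.
  have -> : A ^+ 2 * q ^+ 3 = A / c.
    by rewrite -[RHS]mulr1 -ac; field; rewrite gt_eqF.
  by field; rewrite !gt_eqF.
have g'0 s : 0 <= g' s.
  apply: mulr_ge0; last exact/fine_ge0/branching_ge0.
  by apply: mulr_ge0; [exact: sqr_ge0|exact: expR_ge0].
have mg' : measurable_fun setT g'.
  apply: measurable_funM.
    apply: measurable_funM => //; apply: (measurableT_comp (f := expR)) => //.
    by apply: measurable_funN; exact: measurable_funM.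
  apply: (measurableT_comp (@fine_measurable R setT measurableT)).
  apply: (measurableT_comp (measurable_branching p0 mp)).
  by apply: measurable_fun_pair => //; exact: measurable_funB.
have E := renewal_duhamel xi0 t0.
have {E}E : (\int[mu]_(u in `[0%R, t]) (g' u)%:E =
    (fine (p (xi, t)) - expR (- (t * norm3 xi ^+ 2)))%:E)%E.
  move: E; rewrite -[p _]fineK//; move: (\int[mu]_(u in _) _)%E => I.
  case: I => [I| |]//= [] ->; congr EFin; ring.
have [ig' rg'] := @ge0_integral_fin _ _ mu _ _ _ (measurable_itv _)
  (measurable_funTS mg') (fun s _ => g'0 s) E.
have mI : measurable (`[0, t]%classic : set (measurableTypeR R)) by exact: measurable_itv.
have igE : mu.-integrable `[0, t] (EFin \o g).
  have := integrableZl mI w ig'.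
  by apply: eq_integrable => // s _ /=; rewrite gE.
split => //.
  by move=> s _; exact: (sc (t - s)).1.
have -> : Rintegral mu `[0, t] g = w * Rintegral mu `[0, t] g'.
  rewrite -(RintegralZl w mI ig').
  by apply: eq_Rintegral => s _; exact: gE.
rewrite rg' /w /profile.
move: (expR _) (fine _) => e q.
by field; rewrite !gt_eqF.
Qed.

End solution.
End profile.

(*@P22*)
Section decaying.
Context {R : realType} (nH : @normalized_kernel R).
Notation mu := (@lebesgue_measure R).
Notation mu3 := (lebesgue3 R).
Notation a := (((2 / pi) `^ (3 / 2)) : R).
Notation extinct := (@extinction R).
Notation V := (profile extinct).

Let a_gt0 : 0 < a. Proof. by rewrite powR_gt0// divr_gt0// pi_gt0. Qed.
Let ext_ge0 z : (0 <= extinct z)%E. Proof. exact: extinction_ge0. Qed.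
Let ext_le1 z : (extinct z <= 1)%E. Proof. exact: extinction_le1. Qed.
Let m_ext : measurable_fun setT extinct. Proof. exact: measurable_extinction. Qed.
Let fin_ext z : extinct z \is a fin_num.
Proof. by rewrite ge0_fin_numE// (le_lt_trans (ext_le1 z))// ltry. Qed.

(** min (A^-1, m^2 A^-2) <= 2 m^2 (A (A + m^2))^-1, with m^2 = C / t. *)
Lemma profile_le (xi : R3 R) (t m : R) : 0 < t -> m ^+ 2 = @decay_constant R / t ->
  V xi t <= 2 * a * m ^+ 2 * (norm3 xi ^+ 2 * (norm3 xi ^+ 2 + m ^+ 2))^-1.
Proof.
move=> t0 m2; rewrite /profile.
have [->|xi0] := eqVneq xi 0.
  by rewrite norm3_0 expr0n/= mul0r invr0 !(mulr0, mul0r).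
have Ct0 : 0 < @decay_constant R / t by rewrite divr_gt0// decay_constant_gt0.
have : 0 < norm3 xi ^+ 2 by rewrite exprn_gt0// norm3_gt0.
have x1 : fine (extinct (xi, t)) <= 1 by rewrite -lee_fin fineK.
have : fine (extinct (xi, t)) <= m ^+ 2 / norm3 xi ^+ 2.
  rewrite -lee_fin fineK// m2 -mulrA -invfM [t * _]mulrC.
  exact: extinction_decay.
move: (norm3 xi ^+ 2) (fine _) x1 => A x x1 xA A0.
have M0 : 0 < m ^+ 2 by rewrite m2.
move: (m ^+ 2) M0 xA => M M0 xA.
have -> : 2 * a * M * (A * (A + M))^-1 = a * A^-1 * (2 * M / (A + M)).
  by move: a => b; field; rewrite !gt_eqF// addr_gt0.
rewrite ler_wpM2l ?mulr_ge0 ?invr_ge0 ?(ltW a_gt0) ?(ltW A0)//.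
have [AM|MA] := leP A M.
  apply: le_trans x1 _; rewrite ler_pdivlMr ?addr_gt0//; lra.
apply: le_trans xA _; rewrite ler_pdivlMr ?addr_gt0// mulrAC ler_pdivrMr//.
by rewrite mulrC mulrAC ler_wpM2r ?(ltW M0)//; lra.
Qed.

Lemma integrable_profile (t : R) : 0 < t ->
  mu3.-integrable setT (EFin \o (V ^~ t)) /\
  \int[mu3]_xi `|V xi t| <= 4 * a * pi ^+ 3 * Num.sqrt (@decay_constant R / t).
Proof.
move=> t0; set m := Num.sqrt _.
have m0 : 0 < m by rewrite sqrtr_gt0 divr_gt0// decay_constant_gt0.
have V0 xi : 0 <= V xi t by exact: profile_ge0.
have mV : measurable_fun setT (V ^~ t) by exact: measurable_profile_section.
have mVE : measurable_fun setT (fun xi => (V xi t)%:E) by exact/measurable_EFinP.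
have c_ge0 : 0 <= 2 * a * m ^+ 2.
  by rewrite mulr_ge0 ?sqr_ge0// mulr_ge0// ltW.
have mw : measurable_fun setT
    (fun x : R3 R => (norm3 x ^+ 2 * (norm3 x ^+ 2 + m ^+ 2))^-1).
  have mn : measurable_fun setT (fun x : R3 R => norm3 x ^+ 2).
    by apply: measurable_funX; exact: measurable_norm3.
  apply: measurable_fun_inv; apply: measurable_funM => //.
  exact: measurable_funD.
have mwE : measurable_fun setT
    (fun x : R3 R => ((norm3 x ^+ 2 * (norm3 x ^+ 2 + m ^+ 2))^-1)%:E).
  exact/measurable_EFinP.
have w0 (x : R3 R) : 0 <= (norm3 x ^+ 2 * (norm3 x ^+ 2 + m ^+ 2))^-1.
  by rewrite invr_ge0 mulr_ge0 ?addr_ge0 ?sqr_ge0.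
have le : (\int[mu3]_xi (V xi t)%:E <= (4 * a * pi ^+ 3 * m)%:E)%E.
  apply: (@le_trans _ _ (\int[mu3]_x ((2 * a * m ^+ 2)%:E *
      ((norm3 x ^+ 2 * (norm3 x ^+ 2 + m ^+ 2))^-1)%:E))%E).
    apply: ge0_le_integral => //.
    - by move=> xi _; rewrite lee_fin.
    - exact: measurable_funeM.
    - move=> xi _; rewrite -EFinM lee_fin; apply: profile_le => //.
      by rewrite sqr_sqrtr// divr_ge0 ?(ltW t0)// ltW// decay_constant_gt0.
  rewrite ge0_integralZl_EFin//; last by move=> xi _; rewrite lee_fin.
  apply: le_trans (lee_wpmul2l _ (integral_weight_le nH m0)) _; first by rewrite lee_fin.
  rewrite -EFinM lee_fin le_eqVlt; apply/orP; left; apply/eqP.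
  by move: a => b; field; rewrite gt_eqF.
have absE : (\int[mu3]_xi (`|V xi t|)%:E = \int[mu3]_xi (V xi t)%:E)%E.
  by apply: eq_integral => xi _; rewrite ger0_norm.
split.
  apply/integrableP; split=> //; apply: le_lt_trans (ltry (4 * a * pi ^+ 3 * m)).
  by apply: le_trans le; rewrite -absE.
rewrite /Rintegral absE -lee_fin fineK//.
rewrite ge0_fin_numE ?(le_lt_trans le) ?ltry//.
by apply: integral_ge0 => xi _; rewrite lee_fin.
Qed.

Definition decaying_solution (x : R3 R) (t : R) : R[i] :=
  if 0 < t then inverse_fourier (V ^~ t) x else u_init x.

Lemma decaying_solution_le (x : R3 R) (t : R) : 0 < t ->
  `|decaying_solution x t| <=
  (8 * c0 R * a * pi ^+ 3 * Num.sqrt (@decay_constant R / t))%:C.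
Proof.
move=> t0; rewrite /decaying_solution t0; have [iV le] := integrable_profile t0.
apply: le_trans (inverse_fourier_le x iV) _; rewrite lecR.
have c00 : 0 <= 2 * c0 R by rewrite mulr_ge0// powR_ge0.
apply: le_trans (ler_wpM2l c00 le) _; rewrite le_eqVlt; apply/orP; left; apply/eqP.
by move: a (c0 R) => b c; ring.
Qed.

Lemma decaying_solution_uniform_decay (eps : R) : 0 < eps ->
  \forall t \near +oo, forall x : R3 R, `|decaying_solution x t| <= eps%:C.
Proof.
move=> eps0; pose K := 8 * c0 R * a * pi ^+ 3.
have K0 : 0 < K.
  have c00 : 0 < c0 R by rewrite powR_gt0// mulr_gt0// pi_gt0.
  by rewrite mulr_gt0 ?exprn_gt0 ?pi_gt0// mulr_gt0// mulr_gt0.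
have C0 := @decay_constant_gt0 R.
have e0 : 0 < (eps / K) ^+ 2 by rewrite exprn_gt0// divr_gt0.
exists (@decay_constant R / (eps / K) ^+ 2); split; first exact: num_real.
move=> t lt_t x.
have t0 : 0 < t by apply: lt_trans lt_t; rewrite divr_gt0.
apply: le_trans (decaying_solution_le x t0) _; rewrite lecR -/K.
rewrite mulrC -ler_pdivlMr// -(ger0_norm (ltW (divr_gt0 eps0 K0))) -sqrtr_sqr.
rewrite ler_wsqrtr// ler_pdivrMr// mulrC -ler_pdivrMr//; exact: ltW.
Qed.

Lemma decaying_solution_fourier (t : R) : 0 <= t ->
  is_fourier (decaying_solution ^~ t) (fun xi => (V xi t)%:C).
Proof.
rewrite le_eqVlt => /predU1P[<-|t0]; last first.
  have [iV _] := integrable_profile t0.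
  have -> : decaying_solution ^~ t = inverse_fourier (V ^~ t).
    by apply/funext => x; rewrite /decaying_solution t0.
  exact: is_fourier_inverse.
have -> : decaying_solution ^~ 0 = @u_init R.
  by apply/funext => x; rewrite /decaying_solution ltxx.
have -> : (fun xi => (V xi 0)%:C) = (fun xi => (a * (norm3 xi ^+ 2)^-1)%:C).
  apply/funext => xi; congr (_%:C); rewrite /profile.
  have [->|xi0] := eqVneq xi 0; first by rewrite norm3_0 expr0n/= invr0 mulr0 mul0r.
  have -> : extinct (xi, 0) = 1%E; last by rewrite mulr1.
  rewrite (renewal_duhamel nH m_ext ext_ge0 ext_le1 (extinction_lt0 nH)
    (fun xi t _ => extinction_renewal nH (xi, t)) xi0 (lexx 0)).
  by rewrite set_itv1 integral_set1 mul0r oppr0 expR0 adde0.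
exact/is_fourier_coulomb/integrable_weight.
Qed.

(** u_init is unbounded at the origin, a bounded function is not. *)
Lemma decaying_solution_neq : exists2 t : R, 0 < t &
  ~ {ae leb3 R, forall x : R3 R, decaying_solution x t = u_init x}.
Proof.
have e0 : 0 < (pi : R)^-1 by rewrite invr_gt0 pi_gt0.
have [M [_ decay]] := decaying_solution_uniform_decay e0.
pose t := Num.max M 0 + 1.
have t0 : 0 < t by rewrite ltr_wpDl// le_max lexx orbT.
exists t => // -[N [mN N0 sub]].
have Mt : M < t by rewrite (@le_lt_trans _ _ (Num.max M 0)) ?le_max ?lexx// ltrDl.
pose I : set R := `]0, 1[%classic.
have mI : measurable I by exact: measurable_itv.
have I1 : mu I = 1%E.
  by rewrite lebesgue_measure_itv/= lte_fin ltr01 -EFinB subr0.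
pose B : set (R3 R) := (I `*` I) `*` I.
have mB : measurable B by apply: measurableX => //; exact: measurableX.
have B1 : leb3 R B = 1%E.
  have mII : measurable (I `*` I) by exact: measurableX.
  have E2 : lebesgue2 R (I `*` I) = 1%E.
    apply: (etrans (product_measure1E mu mu mI mI)).
    by rewrite -[X in (X * _)%E]/(mu I) I1 mul1e.
  apply: (etrans (product_measure1E (lebesgue2 R) mu mII mI)).
  by rewrite -[X in (X * _)%E]/(lebesgue2 R (I `*` I)) E2 mul1e.
have BN : B `<=` N.
  move=> -[[x y] z] [[]]; rewrite /I /= !in_itv /= => /andP[x0 x1] /andP[y0 y1] /andP[z0 z1].
  apply: sub => /= eq; have := decay t Mt (x, y, z); rewrite eq /u_init.
  have n0 : 0 < norm3 (x, y, z).
    by apply: norm3_gt0; apply/eqP => -[xE _ _]; move: x0; rewrite xE ltxx.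
  have n2 : norm3 (x, y, z) < 2.
    rewrite -(ltr_pXn2r (n := 2))// ?nnegrE ?(ltW n0)//.
    by rewrite norm3_sqr /=; nra.
  have p0 := @pi_gt0 R.
  rewrite normc_def /= expr0n addr0 sqrtr_sqr ger0_norm; last first.
    by rewrite mulr_ge0 ?divr_ge0 ?invr_ge0 ?ltW.
  rewrite lecR ler_pdivrMr// mulrC ler_pM2l ?invr_gt0// => /(lt_le_trans n2).
  by rewrite ltxx.
have : (leb3 R B <= leb3 R N)%E by apply: le_measure => //; rewrite inE.
by rewrite B1 N0 lee_fin ler10.
Qed.

End decaying.

Theorem proposition4p10 (R : realType)
    (d : R3 R -> measure_display)
    (Omega : forall xi : R3 R, measurableType (d xi))
    (P : forall xi : R3 R, probability (Omega xi) R)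
    (W : forall xi : R3 R, vertex -> Omega xi -> R3 R)
    (T : forall xi : R3 R, vertex -> Omega xi -> R)
    (cascadeWT : is_cascade_family P W T) :
  exists u1 : R3 R -> R -> R[i],
    [/\ forall t : R, 0 <= t ->
          is_fourier (u1 ^~ t) (fun xi => cascade_profile P T xi t),
        is_solution (@u_init R) u1,
        forall eps : R, 0 < eps ->
          \forall t \near +oo, forall x : R3 R, `|u1 x t| <= eps%:C,
        is_solution (@u_init R) (fun x _ => u_init x) &
        exists2 t : R, 0 < t &
          ~ {ae leb3 R, forall x : R3 R, u1 x t = u_init x}].
Proof.
have nH := cascade_normalized cascadeWT.
have coulomb := is_fourier_coulomb (integrable_weight nH).
have profileE t : (fun xi => cascade_profile P T xi t) =
    (fun xi => (profile (@extinction R) xi t)%:C).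
  apply/funext => xi; rewrite /cascade_profile /profile.
  have [->|xi0] := eqVneq xi 0; first by rewrite norm3_0 expr0n/= invr0 mulr0 !mul0r.
  by rewrite (explosion_law cascadeWT).
exists (@decaying_solution R); split.
- by move=> t t0; rewrite profileE; exact: decaying_solution_fourier.
- exists (fun xi => ((2 / pi) `^ (3 / 2) * (norm3 xi ^+ 2)^-1)%:C).
  exists (fun xi t => (profile (@extinction R) xi t)%:C); split => //.
    by move=> t; exact: decaying_solution_fourier.
  apply: (fourier_equation_profile nH).
  + exact: measurable_extinction.
  + exact: extinction_ge0.
  + exact: extinction_le1.
  + by move=> xi s; exact: extinction_lt0.
  + by move=> xi t _; exact: extinction_renewal.
- exact: decaying_solution_uniform_decay.
- exists (fun xi => ((2 / pi) `^ (3 / 2) * (norm3 xi ^+ 2)^-1)%:C).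
  exists (fun xi _ => ((2 / pi) `^ (3 / 2) * (norm3 xi ^+ 2)^-1)%:C); split => //.
  have <- : (fun (xi : R3 R) (t : R) => (profile (cst 1%E) xi t)%:C) =
      (fun xi _ => ((2 / pi) `^ (3 / 2) * (norm3 xi ^+ 2)^-1)%:C).
    by apply/funext => xi; apply/funext => t; rewrite /profile mulr1.
  apply: (fourier_equation_profile nH) => // xi t xi0; rewrite /renewal.
  under eq_integral do rewrite (branching_lt0 nH xi0)// mule1.
  by rewrite integral_exponential_pdf// exprn_gt0 ?norm3_gt0.
- exact: decaying_solution_neq.
Qed.
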